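(* Let $p\geq 5$ be a prime, $q=2(p-1)$, and let $m,n,s,r$ be integers with $n\geq m+2>5$, $2\leq s<p$ and $2\leq r\leq s+3$. Put $t(s)=q(p^n+p^m+sp+s)$. Then $$\mathrm{Ext}_A^{s+3-r,\,t(s)+s-r-1}(\mathbb{Z}_p,\mathbb{Z}_p)=0.$$
   Context: $A$ is the mod $p$ Steenrod algebra; $\mathrm{Ext}_A^{s,t}(\mathbb{Z}_p,\mathbb{Z}_p)$ has homological degree $s$ and internal degree $t$. *)

(* Defs.v *)
(* The mod p Steenrod algebra A is encoded through its dual
   A_* = F_p[xi_1, xi_2, ...] (x) E(tau_0, tau_1, ...) (Milnor), and
   Ext_A^{s,t}(Z_p,Z_p) = Ext_{A_*}^{s,t}(F_p,F_p) is the cohomology of the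
   (reduced) cobar complex of A_*, in internal degree t. *)
From HB Require Import structures.
From mathcomp Require Import all_boot all_order all_algebra.
Set Implicit Arguments. Unset Strict Implicit. Unset Printing Implicit Defensive.
Import GRing.Theory.

(* A monomial xi_1^{e_1} xi_2^{e_2} ... tau_{j_1} ... tau_{j_k} (j_1<...<j_k):
   m.1 = [:: e_1; e_2; ...]  (position i = exponent of xi_{i+1}),
   m.2 = bit-vector of tau's  (position j = true iff tau_j occurs).
   Canonical monomials have no trailing 0 / false. *)
Definition Mono := (seq nat * seq bool)%type.
Definition unitM : Mono := ([::], [::]).

Fixpoint trimN (s : seq nat) : seq nat :=
  match s with
  | [::] => [::]
  | x :: s' => let u := trimN s' in if (x == 0%N) && (u == [::]) then [::] else x :: u
  end.
Fixpoint trimB (s : seq bool) : seq bool :=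
  match s with
  | [::] => [::]
  | x :: s' => let u := trimB s' in if (~~ x) && (u == [::]) then [::] else x :: u
  end.
Definition normM (m : Mono) : Mono := (trimN m.1, trimB m.2).

Definition degM (p : nat) (m : Mono) : nat :=
  (\sum_(i < size m.1) nth 0 m.1 i * (2 * (p ^ i.+1 - 1))
   + \sum_(i < size m.2) nth false m.2 i * (2 * p ^ i - 1))%N.

Definition tauCount (m : Mono) : nat := count id m.2.

(* product of canonical monomials in the graded-commutative algebra A_*:
   None if it is 0 (a repeated tau), otherwise Some (k, m'') meaning
   m * m' = (-1)^k m''. *)
Definition mulM (m m' : Mono) : option (nat * Mono) :=
  let n := maxn (size m.2) (size m'.2) in
  if has (fun i => nth false m.2 i && nth false m'.2 i) (iota 0 n) then None
  else Some (sumn [seq nat_of_bool [&& nth false m.2 a, nth false m'.2 b & (b < a)%N]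
                   | a <- iota 0 (size m.2), b <- iota 0 (size m'.2)],
             normM (mkseq (fun i => nth 0 m.1 i + nth 0 m'.1 i)%N
                          (maxn (size m.1) (size m'.1)),
                    mkseq (fun i => nth false m.2 i || nth false m'.2 i) n)).

(* a term c * (a (x) b) of A_* (x) A_* *)
Definition term := (int * (Mono * Mono))%type.
Definition sgnz (k : nat) : int := ((-1) ^+ k)%R.

(* product in A_* (x) A_*: (a (x) b)(a' (x) b') = (-1)^{|b||a'|} aa' (x) bb' *)
Definition mulT (x y : term) : seq term :=
  match mulM x.2.1 y.2.1, mulM x.2.2 y.2.2 with
  | Some (ka, ma), Some (kb, mb) =>
      [:: ((x.1 * y.1 * sgnz (ka + kb + tauCount x.2.2 * tauCount y.2.1)%N)%R, (ma, mb))]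
  | _, _ => [::]
  end.
Definition mulL (X Y : seq term) : seq term := flatten [seq mulT x y | x <- X, y <- Y].

Definition xiPow (k e : nat) : Mono :=
  if k is 0 then unitM else normM (rcons (nseq k.-1 0%N) e, [::]).
Definition tauM (j : nat) : Mono := ([::], rcons (nseq j false) true).

(* Milnor coproduct: psi(xi_k) = sum_{i=0}^k xi_{k-i}^{p^i} (x) xi_i,
   psi(tau_k) = tau_k (x) 1 + sum_{i=0}^k xi_{k-i}^{p^i} (x) tau_i *)
Definition psiXi (p k : nat) : seq term :=
  [seq (1%R, (xiPow (k - i) (p ^ i), xiPow i 1)) | i <- iota 0 k.+1].
Definition psiTau (p k : nat) : seq term :=
  (1%R, (tauM k, unitM)) :: [seq (1%R, (xiPow (k - i) (p ^ i), tauM i)) | i <- iota 0 k.+1].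

Definition psiFactors (p : nat) (m : Mono) : seq (seq term) :=
  flatten [seq nseq (nth 0 m.1 i) (psiXi p i.+1) | i <- iota 0 (size m.1)]
  ++ [seq psiTau p j | j <- iota 0 (size m.2) & nth false m.2 j].
Definition psi (p : nat) (m : Mono) : seq term :=
  foldl mulL [:: (1%R, (unitM, unitM))] (psiFactors p m).

Definition coefPsi (p : nat) (a b c : Mono) : int :=
  (\sum_(x <- psi p a | x.2 == (b, c)) x.1)%R.

Fixpoint allSeqs (A : Type) (n : nat) (vals : seq A) : seq (seq A) :=
  match n with
  | 0 => [:: [::]]
  | n'.+1 => [seq x :: s | x <- vals, s <- allSeqs n' vals]
  end.

(* all canonical monomials with at most B generator positions and exponents <= B;
   for B > t this contains every monomial of degree <= t *)
Definition monos (B : nat) : seq Mono :=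
  undup [seq normM (s1, s2) | s1 <- allSeqs B (iota 0 B.+1),
                              s2 <- allSeqs B [:: false; true]].

Definition cobarBasis (p t s : nat) : seq (seq Mono) :=
  [seq x <- allSeqs s [seq m <- monos t.+1 | m != unitM]
     | sumn (map (degM p) x) == t].

(* cochains are coefficient functions on words;
   cobar differential d[a_1|...|a_s] = sum_i (-1)^i [a_1|...|psibar(a_i)|...|a_s],
   read off on coefficients *)
Definition cochain (p t s : nat) (f : seq Mono -> 'F_p) : Prop :=
  forall x, f x != 0%R -> x \in cobarBasis p t s.

Arguments cochain : clear implicits.

Definition dcob (p t s : nat) (f : seq Mono -> 'F_p) (y : seq Mono) : 'F_p :=
  (\sum_(i < s) (-1) ^+ i.+1 *
     \sum_(a <- monos t.+1)
        f (take i y ++ a :: drop i.+2 y)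
        * (coefPsi p a (nth unitM y i) (nth unitM y i.+1))%:~R)%R.

Arguments dcob : clear implicits.

Definition ExtA_vanishes (p s t : nat) : Prop :=
  forall f : seq Mono -> 'F_p, cochain p t s f ->
    (forall y, y \in cobarBasis p t s.+1 -> dcob p t s f y = 0%R) ->
    match s with
    | 0 => forall x, f x = 0%R
    | s'.+1 => exists g, cochain p t s' g /\
                 forall x, x \in cobarBasis p t s -> dcob p t s' g x = f x
    end.

Definition tdeg (p n m s : nat) : nat := (2 * (p - 1) * (p ^ n + p ^ m + s * p + s))%N.

(* Main.v *)
(** The cobar complex of the dual Steenrod algebra carries a discrete Morse
    matching whose critical words are the Anick chains for the commutation
    relations and p-th powers of the generators xi_k^(p^j) and tau_j.  They
    correspond to the monomials in h_{i,j}, b_{i,j}, a_i of the E_1-term of the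
    May spectral sequence, and the group vanishes in every bidegree without
    critical words.  The matching is triangular because, modulo words with fewer
    generators, the Milnor product is the truncated commutative product.  That
    the differential squares to zero is the coassociativity of the Milnor
    coproduct, obtained by composing points with values in an exterior algebra
    over a polynomial ring, where monomials are linearly independent.

    In the bidegree at hand, a critical word would write p^n + p^m + sp + s as a
    sum of at most s+1 <= p blocks p^l + ... + p^(r-1).  The digits at 0 and 1
    force s of the blocks to start at 0 and to leave at most one other; the
    digits from 2 on are then those of a single block, or else p blocks all cover
    position 2, and the carry propagating up to position m cannot be absorbed. *)

From HB Require Import structures.
Require Import Defs.
From mathcomp Require Import all_boot all_order all_algebra.
From mathcomp Require Import zify mpoly.

Set Implicit Arguments.
Unset Strict Implicit.
Unset Printing Implicit Defensive.
Import GRing.Theory.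

(** * Monomials *)

#[local] Arguments xiPow : simpl never.
#[local] Arguments tauM : simpl never.
#[local] Arguments mulM : simpl never.

(** Cochains are functions on words, so the differential at a word y sums over the merges of two
    neighbours b, c of y into one monomial a, weighted by the coefficient of b (x) c in the
    coproduct of a, i.e. by a structure constant of the Milnor product in the dual basis. For the
    filtration by number of generators every generator is primitive in leading order, so the leading
    constants are binomials up to sign, and their vanishing mod p is read off base-p digits. No
    Morse complex is built. Without critical words the basis consists of type U words (to be split)
    and type D words (to be merged), and the differential from U to D is triangular for a finite
    strict order. Hence a cocycle f admits g supported on U such that f - dg vanishes on D. This
    difference is again a cocycle, and triangularity one degree higher makes it zero.
    Coassociativity serves only to give ddg = 0; on monomials it would mean following the signs of
    the taus through multinomial expansions, which evaluation at points avoids. *)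

Definition xe (m : Mono) (k : nat) : nat := nth 0 m.1 k.
Definition tb (m : Mono) (j : nat) : bool := nth false m.2 j.
Definition canon (m : Mono) : bool := normM m == m.

Lemma nth_trimN s i : nth 0 (trimN s) i = nth 0 s i.
Proof.
elim: s i => [|x s IH] i //=.
case: ifP => [/andP[/eqP-> /eqP E]|_]; last by case: i => //= i.
by case: i => [|i] //=; rewrite -IH E nth_nil.
Qed.

Lemma nth_trimB s i : nth false (trimB s) i = nth false s i.
Proof.
elim: s i => [|x s IH] i //=.
case: ifP => [/andP[/negbTE-> /eqP E]|_]; last by case: i => //= i.
by case: i => [|i] //=; rewrite -IH E nth_nil.
Qed.

Lemma trimN0 s : (forall i, nth 0 s i = 0) -> trimN s = [::].
Proof.
elim: s => [|x s IH] //= H.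
by move: (H 0) => /= ->; rewrite IH // => i; apply: (H i.+1).
Qed.

Lemma trimB0 s : (forall i, nth false s i = false) -> trimB s = [::].
Proof.
elim: s => [|x s IH] //= H.
by move: (H 0) => /= ->; rewrite IH // => i; apply: (H i.+1).
Qed.

Lemma trimN_ext s s' : (forall i, nth 0 s i = nth 0 s' i) -> trimN s = trimN s'.
Proof.
elim: s s' => [|x s IH] [|y s'] H //.
- by rewrite [RHS]trimN0 // => i; rewrite -H nth_nil.
- by rewrite [LHS]trimN0 // => i; rewrite H nth_nil.
by rewrite /= (IH s') => [|i]; [move: (H 0) => /= -> | apply: (H i.+1)].
Qed.

Lemma trimB_ext s s' :
  (forall i, nth false s i = nth false s' i) -> trimB s = trimB s'.
Proof.
elim: s s' => [|x s IH] [|y s'] H //.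
- by rewrite [RHS]trimB0 // => i; rewrite -H nth_nil.
- by rewrite [LHS]trimB0 // => i; rewrite H nth_nil.
by rewrite /= (IH s') => [|i]; [move: (H 0) => /= -> | apply: (H i.+1)].
Qed.

Lemma xe_normM m : xe (normM m) =1 xe m.
Proof. by move=> i; rewrite /xe nth_trimN. Qed.

Lemma tb_normM m : tb (normM m) =1 tb m.
Proof. by move=> i; rewrite /tb nth_trimB. Qed.

Lemma normM_ext m m' : xe m =1 xe m' -> tb m =1 tb m' -> normM m = normM m'.
Proof. by move=> ex et; rewrite /normM (trimN_ext ex) (trimB_ext et). Qed.

Lemma canon_normM m : canon (normM m).
Proof. by apply/eqP/normM_ext; [apply: xe_normM | apply: tb_normM]. Qed.

Lemma canon_ext m m' :
  canon m -> canon m' -> xe m =1 xe m' -> tb m =1 tb m' -> m = m'.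
Proof. by move=> /eqP e1 /eqP e2 ex et; rewrite -e1 -e2; apply: normM_ext. Qed.

Lemma xe_unitM k : xe unitM k = 0. Proof. by rewrite /xe nth_nil. Qed.
Lemma tb_unitM k : tb unitM k = false. Proof. by rewrite /tb nth_nil. Qed.

Definition mkM (N : nat) (f : nat -> nat) (g : nat -> bool) : Mono :=
  normM (mkseq f N, mkseq g N).

Lemma canon_mkM N f g : canon (mkM N f g). Proof. exact: canon_normM. Qed.

Lemma xe_mkM N f g k : (N <= k -> f k = 0) -> xe (mkM N f g) k = f k.
Proof.
move=> H; rewrite xe_normM /xe /=; case: (ltnP k N) => kN; first by rewrite nth_mkseq.
by rewrite nth_default ?size_mkseq // H.
Qed.

Lemma tb_mkM N f g k : (N <= k -> g k = false) -> tb (mkM N f g) k = g k.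
Proof.
move=> H; rewrite tb_normM /tb /=; case: (ltnP k N) => kN; first by rewrite nth_mkseq.
by rewrite nth_default ?size_mkseq // H.
Qed.

Lemma xe_size m k : size m.1 <= k -> xe m k = 0.
Proof. by move=> H; rewrite /xe nth_default. Qed.
Lemma tb_size m k : size m.2 <= k -> tb m k = false.
Proof. by move=> H; rewrite /tb nth_default. Qed.

Lemma size_trimN s : size (trimN s) <= size s.
Proof. by elim: s => //= x s IH; case: ifP. Qed.
Lemma size_trimB s : size (trimB s) <= size s.
Proof. by elim: s => //= x s IH; case: ifP. Qed.

Lemma xe_xiPow k e i : xe (xiPow k e) i = (i.+1 == k) * e.
Proof.
case: k => [|k]; first by rewrite /= xe_unitM.
rewrite xe_normM /xe /= nth_rcons size_nseq eqSS nth_nseq.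
by case: ltngtP => // _; rewrite ?mul1n.
Qed.

Lemma tb_xiPow k e i : tb (xiPow k e) i = false.
Proof. by case: k => [|k]; rewrite /= ?tb_normM /tb nth_nil. Qed.

Lemma xe_tauM j i : xe (tauM j) i = 0.
Proof. exact: nth_nil. Qed.

Lemma tb_tauM j i : tb (tauM j) i = (i == j).
Proof. by rewrite /tb /= nth_rcons size_nseq nth_nseq; case: ltngtP. Qed.

(** Weight u i for xi_(i+1) and v j for tau_j. Degree, number of generators and number of taus are
    all of this kind, so additivity is proved once. *)
Definition stat (u v : nat -> nat) (m : Mono) : nat :=
  \sum_(i < size m.1) xe m i * u i + \sum_(j < size m.2) tb m j * v j.

Lemma sum_wide (F : nat -> nat) n N : n <= N -> (forall i, n <= i -> F i = 0) ->
  \sum_(i < n) F i = \sum_(i < N) F i.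
Proof.
move=> nN F0; rewrite (big_ord_widen N F nN) [RHS](bigID (fun i : 'I_N => i < n)) /=.
by rewrite [X in _ + X]big1 ?addn0 // => i; rewrite -leqNgt; apply: F0.
Qed.

Lemma stat_wide u v m N : size m.1 <= N -> size m.2 <= N ->
  stat u v m = \sum_(i < N) (xe m i * u i + tb m i * v i).
Proof.
move=> h1 h2; rewrite big_split /= /stat.
rewrite (sum_wide (F := fun i => xe m i * u i) h1); last by move=> i /xe_size->.
by rewrite (sum_wide (F := fun i => tb m i * v i) h2) // => i /tb_size->.
Qed.

Lemma stat_add u v m m1 m2 : xe m =1 (fun i => xe m1 i + xe m2 i) ->
  (forall i, tb m i = tb m1 i + tb m2 i :> nat) -> stat u v m = stat u v m1 + stat u v m2.
Proof.
move=> ex et; pose N := maxn (maxn (size m.1) (size m.2))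
  (maxn (maxn (size m1.1) (size m1.2)) (maxn (size m2.1) (size m2.2))).
rewrite !(@stat_wide _ _ _ N) /N; try lia.
by rewrite -big_split; apply: eq_bigr => i _; rewrite ex et !mulnDl /=; lia.
Qed.

Lemma stat_unitM u v : stat u v unitM = 0.
Proof. by rewrite /stat !big_ord0. Qed.

Lemma stat_xiPow u v k e : stat u v (xiPow k.+1 e) = e * u k.
Proof.
rewrite (@stat_wide _ _ _ (maxn k.+1 (maxn (size (xiPow k.+1 e).1) (size (xiPow k.+1 e).2))));
  try lia.
have kN : k < maxn k.+1 (maxn (size (xiPow k.+1 e).1) (size (xiPow k.+1 e).2)) by lia.
rewrite (bigD1 (Ordinal kN)) //= xe_xiPow tb_xiPow eqxx big1 => [|i /eqP]; first lia.
rewrite xe_xiPow tb_xiPow eqSS => ik; case: eqP => // E.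
by case: ik; apply: val_inj.
Qed.

Lemma stat_tauM u v j : stat u v (tauM j) = v j.
Proof.
rewrite /stat big_ord0 add0n size_rcons size_nseq big_ord_recr /= tb_tauM eqxx mul1n.
by rewrite big1 // => i _; rewrite tb_tauM; case: eqP => // E; have := ltn_ord i; lia.
Qed.

Lemma degM_stat p m : degM p m = stat (fun i => 2 * (p ^ i.+1 - 1)) (fun j => 2 * p ^ j - 1) m.
Proof. by []. Qed.

(** Number of generators with multiplicity. The coproduct never lowers it, which separates leading
    from lower terms. *)
Definition wt (m : Mono) : nat := stat (fun=> 1) (fun=> 1) m.

(** [mulM] taken apart: [ovl] detects a repeated tau, [invM] is the exponent of the sign from
    reordering the taus, [prM] is the resulting monomial. *)
Definition ovl (m m' : Mono) : bool :=
  has (fun i => tb m i && tb m' i) (iota 0 (maxn (size m.2) (size m'.2))).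
Definition invM (m m' : Mono) : nat :=
  sumn [seq nat_of_bool [&& tb m a, tb m' b & (b < a)%N]
       | a <- iota 0 (size m.2), b <- iota 0 (size m'.2)].
Definition prM (m m' : Mono) : Mono :=
  normM (mkseq (fun i => xe m i + xe m' i) (maxn (size m.1) (size m'.1)),
         mkseq (fun i => tb m i || tb m' i) (maxn (size m.2) (size m'.2))).

Lemma mulME m m' : mulM m m' = if ovl m m' then None else Some (invM m m', prM m m').
Proof. by []. Qed.

Lemma ovlP m m' : reflect (exists i, tb m i && tb m' i) (ovl m m').
Proof.
apply: (iffP hasP) => [[i _ H]|[i H]]; exists i => //.
rewrite mem_iota add0n leq0n /=; apply: contraTT H; rewrite -leqNgt geq_max.
by case/andP=> h1 _; rewrite tb_size.
Qed.

Lemma canon_prM m m' : canon (prM m m'). Proof. exact: canon_normM. Qed.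

Lemma xe_prM m m' i : xe (prM m m') i = xe m i + xe m' i.
Proof.
rewrite xe_normM {1}/xe /=.
case: (ltnP i (maxn (size m.1) (size m'.1))) => h; first by rewrite nth_mkseq.
rewrite nth_default ?size_mkseq // !xe_size //; lia.
Qed.

Lemma tb_prM m m' i : tb (prM m m') i = tb m i || tb m' i.
Proof.
rewrite tb_normM {1}/tb /=.
case: (ltnP i (maxn (size m.2) (size m'.2))) => h; first by rewrite nth_mkseq.
rewrite nth_default ?size_mkseq // !tb_size //; lia.
Qed.

Lemma size_prM m m' : size (prM m m').1 <= maxn (size m.1) (size m'.1) /\
  size (prM m m').2 <= maxn (size m.2) (size m'.2).
Proof. by split; [have := size_trimN (mkseq (fun i => xe m i + xe m' i) (maxn (size m.1) (size m'.1))) |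
 have := size_trimB (mkseq (fun i => tb m i || tb m' i) (maxn (size m.2) (size m'.2)))];
 rewrite size_mkseq. Qed.

Lemma stat_prM u v m m' : ~~ ovl m m' -> stat u v (prM m m') = stat u v m + stat u v m'.
Proof.
move=> /ovlP no; apply: stat_add => i; first exact: xe_prM.
by rewrite tb_prM; case E1: (tb m i); case E2: (tb m' i) => //; case: no; exists i; rewrite E1 E2.
Qed.

Lemma prM_unitM m : canon m -> prM m unitM = m.
Proof.
move=> cm; apply: canon_ext => // [|i|i]; first exact: canon_prM.
  by rewrite xe_prM xe_unitM addn0.
by rewrite tb_prM tb_unitM orbF.
Qed.

Lemma ovl_unitM m : ovl m unitM = false.
Proof. by apply/ovlP => -[i]; rewrite tb_unitM andbF. Qed.
Lemma invM_unitM m : invM m unitM = 0.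
Proof. by rewrite /invM /=; elim: (iota _ _). Qed.

Lemma tb_invM0 m m' : tb m' =1 xpred0 -> invM m m' = 0.
Proof.
move=> H; rewrite /invM sumnE big_allpairs_dep big1 // => a _; rewrite big1 // => b _.
by rewrite H andbF.
Qed.

Lemma tauCount_stat m : tauCount m = stat (fun=> 0) (fun=> 1) m.
Proof.
rewrite /tauCount /stat big1 ?add0n => [|i _]; last by rewrite muln0.
rewrite -sum1_count big_mkcond /= (big_nth false) big_mkord.
by apply: eq_bigr => i _; rewrite /tb /=; case: (nth _ _ _).
Qed.

(** * Degree bounds: the finite enumeration of monomials is exhaustive *)

Lemma allSeqsP (T : eqType) n (vals : seq T) s :
  (s \in allSeqs n vals) = (size s == n) && all (mem vals) s.
Proof.
elim: n s => [|n IH] s /=; first by rewrite inE; case: s.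
apply/allpairsP/idP => [[[x u] /= [xv us ->]]|].
  by move: us; rewrite IH /= eqSS xv.
case: s => //= x u; rewrite eqSS => /andP[su /andP[xv au]].
by exists (x, u) => /=; rewrite IH su.
Qed.

Lemma last_trimN s : trimN s != [::] -> nth 0 (trimN s) (size (trimN s)).-1 != 0.
Proof.
elim: s => //= x s IH; case: ifP => // /negbT; rewrite negb_and => H _ /=.
case E: (trimN s) => [|y u] /=; first by move: H; rewrite E orbF.
by move: IH; rewrite E /= => ->.
Qed.
Lemma last_trimB s : trimB s != [::] -> nth false (trimB s) (size (trimB s)).-1.
Proof.
elim: s => //= x s IH; case: ifP => // /negbT; rewrite negb_and => H _ /=.
case E: (trimB s) => [|y u] /=; first by move: H; rewrite E orbF negbK.
by move: IH; rewrite E /= => ->.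
Qed.

Lemma deg_ge_xi p m i : 1 < p -> i < size m.1 -> xe m i * i.+1 <= degM p m.
Proof.
move=> p1 im; rewrite degM_stat /stat (bigD1 (Ordinal im)) //=.
have := ltn_expl i.+1 p1; set q := p ^ i.+1 => hq.
have : xe m i * i.+1 <= xe m i * (2 * (q - 1)) by rewrite leq_mul2l; apply/orP; right; lia.
lia.
Qed.

Lemma deg_ge_tau p m i : 1 < p -> i < size m.2 -> tb m i -> i < degM p m.
Proof.
move=> p1 im ti; rewrite degM_stat /stat (bigD1 (Ordinal im)) //= ti.
have := ltn_expl i p1; lia.
Qed.

(** In a canonical monomial the last listed exponent is nonzero and the last listed tau is present.
    As xi_(i+1) has degree at least i+1 and tau_i degree above i, the degree bounds both lengths and
    every exponent. *)
Lemma canon_deg_bounds p t m : 1 < p -> canon m -> degM p m <= t ->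
  [/\ size m.1 <= t, size m.2 <= t & forall i, xe m i <= t].
Proof.
move=> p1 /eqP cm dm; have hx i : xe m i <= t.
  case: (ltnP i (size m.1)) => him; last by rewrite xe_size.
  have := deg_ge_xi p1 him; have : xe m i <= xe m i * i.+1 by rewrite leq_pmulr.
  lia.
split=> //.
  case E: (size m.1) => [|k] //; have km : k < size m.1 by rewrite E.
  have := deg_ge_xi p1 km.
  have: xe m k != 0.
    have E1 : trimN m.1 = m.1 by rewrite -[in RHS]cm.
    have := @last_trimN m.1; rewrite E1 E /=; apply.
    by rewrite -size_eq0 E.
  rewrite -lt0n => h0; have : k.+1 <= xe m k * k.+1 by rewrite leq_pmull.
  lia.
case E: (size m.2) => [|k] //; have km : k < size m.2 by rewrite E.
have: tb m k.
  have E1 : trimB m.2 = m.2 by rewrite -[in RHS]cm.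
  have := @last_trimB m.2; rewrite E1 E /=; apply.
  by rewrite -size_eq0 E.
move/(deg_ge_tau p1 km); lia.
Qed.

Lemma normM_pad m B : canon m -> size m.1 <= B -> size m.2 <= B ->
  normM (mkseq (xe m) B, mkseq (tb m) B) = m.
Proof.
move=> cm h1 h2; apply: canon_ext => // [|i|i]; first exact: canon_normM.
  by rewrite -/(mkM B (xe m) (tb m)) xe_mkM // => /(leq_trans h1)/xe_size.
by rewrite -/(mkM B (xe m) (tb m)) tb_mkM // => /(leq_trans h2)/tb_size.
Qed.

Lemma mem_monos p t (m : Mono) : 1 < p -> canon m -> degM p m <= t -> m \in monos t.+1.
Proof.
move=> p1 cm dm; have [h1 h2 h3] := canon_deg_bounds p1 cm dm.
rewrite mem_undup; apply/allpairsP; exists (mkseq (xe m) t.+1, mkseq (tb m) t.+1).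
split; last by rewrite normM_pad //; lia.
  rewrite allSeqsP size_mkseq eqxx; apply/allP => x /mapP[i _ ->].
  by rewrite inE mem_iota; have := h3 i; lia.
by rewrite allSeqsP size_mkseq eqxx; apply/allP => -[].
Qed.

Lemma monos_canon B (m : Mono) : m \in monos B -> canon m.
Proof. by rewrite mem_undup => /allpairsP[x [_ _ ->]]; apply: canon_normM. Qed.

Definition good (m : Mono) : bool := canon m && (m != unitM).

Lemma cobarBasisP p t s (x : seq Mono) : 1 < p ->
  (x \in cobarBasis p t s) = [&& size x == s, all good x & sumn (map (degM p) x) == t].
Proof.
move=> p1; rewrite mem_filter allSeqsP andbC; case: eqP => // sx; rewrite andbC /=.
case: eqP => dx; rewrite ?andbF // !andbT.
apply/allP/allP => H m mx; move: (H _ mx); rewrite /= mem_filter /good => /andP[].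
  by move=> -> /monos_canon->.
move=> cm ->; apply: mem_monos p1 cm _.
rewrite -dx sumnE big_map (perm_big _ (perm_to_rem mx)) big_cons /=; lia.
Qed.

Lemma deg0_unitM p m : 1 < p -> canon m -> degM p m = 0 -> m = unitM.
Proof.
move=> p1 cm dm; have [|h1 h2 _] := canon_deg_bounds (t := 0) p1 cm; first by rewrite dm.
case: m h1 h2 {cm dm} => -[|x s] // [|y u] //.
Qed.

(** * Leading coefficients of the coproduct *)

Lemma mem_mulT x y z : z \in mulT x y ->
  [/\ ~~ ovl x.2.1 y.2.1, ~~ ovl x.2.2 y.2.2 &
      z.2 = (prM x.2.1 y.2.1, prM x.2.2 y.2.2)].
Proof.
rewrite /mulT !mulME; case: (ovl _ _) => //; case: (ovl _ _) => //.
by rewrite inE => /eqP ->.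
Qed.

Lemma mem_mulL X Y z : z \in mulL X Y ->
  exists x y, [/\ x \in X, y \in Y & z \in mulT x y].
Proof.
move=> /flattenP[l /allpairsP[[x y] [hx hy ->]] hz].
by exists x, y.
Qed.

Definition coefL (X : seq term) (bc : Mono * Mono) : int :=
  (\sum_(x <- X | x.2 == bc) x.1)%R.

Lemma coefL_mulL X Y bc :
  coefL (mulL X Y) bc = (\sum_(x <- X) \sum_(y <- Y) coefL (mulT x y) bc)%R.
Proof. by rewrite /coefL big_flatten big_allpairs_dep. Qed.

Lemma coefL_nil X bc : bc \notin map snd X -> coefL X bc = 0%R.
Proof.
move=> H; rewrite /coefL big_seq_cond big1 // => x /andP[hx /eqP E].
by case/mapP: H; exists x.
Qed.

Definition canon2 (x : term) := canon x.2.1 && canon x.2.2.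

Lemma prM_inj b' b'' g : canon b' -> canon b'' -> ~~ ovl b' g -> ~~ ovl b'' g ->
  prM b' g = prM b'' g -> b' = b''.
Proof.
move=> c1 c2 /ovlP o1 /ovlP o2 E; apply: canon_ext => // i.
  by have := congr1 (fun m => xe m i) E; rewrite !xe_prM => /addIn.
have := congr1 (fun m => tb m i) E; rewrite !tb_prM.
case E1: (tb b' i); case E2: (tb b'' i); case E3: (tb g i) => //= _.
  by case: o1; exists i; rewrite E1 E3.
by case: o2; exists i; rewrite E2 E3.
Qed.

Lemma mulT_left y1 b2 c2 g : canon c2 -> mulT (y1, (b2, c2)) (1%R, (g, unitM)) =
  if ovl b2 g then [::]
  else [:: ((y1 * sgnz (invM b2 g + tauCount c2 * tauCount g))%R, (prM b2 g, c2))].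
Proof.
move=> cc; rewrite /mulT /= !mulME ovl_unitM invM_unitM prM_unitM //.
by case: (ovl b2 g); rewrite ?mulr1 ?addn0.
Qed.

Lemma mulT_right y1 b2 c2 g : canon b2 -> mulT (y1, (b2, c2)) (1%R, (unitM, g)) =
  if ovl c2 g then [::] else [:: ((y1 * sgnz (invM c2 g))%R, (b2, prM c2 g))].
Proof.
move=> cc; rewrite /mulT /= !mulME ovl_unitM invM_unitM prM_unitM //.
by case: (ovl c2 g); rewrite ?mulr1 ?muln0 ?addn0.
Qed.

(** Multiplication by g (x) 1 is injective on the monomials it does not kill, so the coefficient at
    [(prM b' g, c)] has the single source [(b', c)]. *)
Lemma coefL_left X g b' c : all canon2 X -> canon b' -> canon c -> ~~ ovl b' g ->
  (\sum_(x <- X) coefL (mulT x (1, (g, unitM))) (prM b' g, c) =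
   sgnz (invM b' g + tauCount c * tauCount g) * coefL X (b', c))%R.
Proof.
move=> cX cb cc o; rewrite /coefL big_distrr /= [RHS]big_mkcond /= big_seq [RHS]big_seq.
apply: eq_bigr => -[y1 [b2 c2]] hy /=; have /andP[/= cb2 cc2] := allP cX _ hy.
rewrite mulT_left //; case: eqP => [[-> ->]|ne].
  by rewrite (negbTE o) big_cons big_nil /= eqxx addr0 mulrC.
case: (boolP (ovl b2 g)) => o2; rewrite ?big_nil ?big_cons //= ?big_nil.
case: eqP => // E; case: ne; have E2 : c2 = c := congr1 snd E.
by have E3 := prM_inj cb2 cb o2 o (congr1 fst E); rewrite E2 E3.
Qed.

Lemma coefL_leftP X g b c : all canon2 X ->
  (\sum_(x <- X) coefL (mulT x (1, (g, unitM))) (b, c) != 0)%R ->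
  exists b', [/\ canon b', canon c, ~~ ovl b' g, prM b' g = b & coefL X (b', c) != 0%R].
Proof.
move=> cX nz.
case: (boolP (has (fun x => [&& ~~ ovl x.2.1 g, prM x.2.1 g == b & x.2.2 == c]) X)).
  case/hasP=> -[x1 [b' c']] hx /= /and3P[o /eqP E /eqP Ec]; subst c'.
  have /andP[/= cb cc] := allP cX _ hx; exists b'; split=> //.
  by apply: contraNneq nz => E0; rewrite -E coefL_left // E0 mulr0.
move=> /hasPn H; case/eqP: nz; rewrite big_seq big1 // => x hx; apply: coefL_nil.
have /andP[/= cb cc] := allP cX _ hx; have := H _ hx; apply: contraNN => /mapP[z /mem_mulT].
by rewrite /= => -[o _ ->] [-> ->]; rewrite prM_unitM // o !eqxx.
Qed.

Lemma coefL_right X g b c' : all canon2 X -> canon b -> canon c' -> ~~ ovl c' g ->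
  (\sum_(x <- X) coefL (mulT x (1, (unitM, g))) (b, prM c' g) =
   sgnz (invM c' g) * coefL X (b, c'))%R.
Proof.
move=> cX cb cc o; rewrite /coefL big_distrr /= [RHS]big_mkcond /= big_seq [RHS]big_seq.
apply: eq_bigr => -[y1 [b2 c2]] hy /=; have /andP[/= cb2 cc2] := allP cX _ hy.
rewrite mulT_right //; case: eqP => [[-> ->]|ne].
  by rewrite (negbTE o) big_cons big_nil /= eqxx addr0 mulrC.
case: (boolP (ovl c2 g)) => o2; rewrite ?big_nil ?big_cons //= ?big_nil.
case: eqP => // E; case: ne; have E2 : b2 = b := congr1 fst E.
by have E3 := prM_inj cc2 cc o2 o (congr1 snd E); rewrite E2 E3.
Qed.

Lemma coefL_rightP X g b c : all canon2 X ->
  (\sum_(x <- X) coefL (mulT x (1, (unitM, g))) (b, c) != 0)%R ->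
  exists c', [/\ canon b, canon c', ~~ ovl c' g, prM c' g = c & coefL X (b, c') != 0%R].
Proof.
move=> cX nz.
case: (boolP (has (fun x => [&& ~~ ovl x.2.2 g, prM x.2.2 g == c & x.2.1 == b]) X)).
  case/hasP=> -[x1 [b' c']] hx /= /and3P[o /eqP E /eqP Ec]; subst b'.
  have /andP[/= cb cc] := allP cX _ hx; exists c'; split=> //.
  by apply: contraNneq nz => E0; rewrite -E coefL_right // E0 mulr0.
move=> /hasPn H; case/eqP: nz; rewrite big_seq big1 // => x hx; apply: coefL_nil.
have /andP[/= cb cc] := allP cX _ hx; have := H _ hx; apply: contraNN => /mapP[z /mem_mulT].
by rewrite /= => -[_ o ->] [-> ->]; rewrite prM_unitM // o !eqxx.
Qed.

(* Junk unless [g] divides [b]. *)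
Definition divM (b g : Mono) : Mono :=
  mkM (maxn (size b.1) (size b.2)) (fun i => xe b i - xe g i) (fun i => tb b i && ~~ tb g i).

Lemma xe_divM b g i : xe (divM b g) i = xe b i - xe g i.
Proof. by rewrite xe_mkM // => h; rewrite xe_size //; lia. Qed.

Lemma tb_divM b g i : tb (divM b g) i = tb b i && ~~ tb g i.
Proof. by rewrite tb_mkM // => h; rewrite tb_size //; lia. Qed.

Lemma divMP b g : canon b -> (forall i, xe g i <= xe b i) ->
  (forall i, tb g i -> tb b i) -> [/\ canon (divM b g), ~~ ovl (divM b g) g & prM (divM b g) g = b].
Proof.
move=> cb hx ht; split; first exact: canon_mkM.
  by apply/ovlP => -[i]; rewrite tb_divM -andbA andNb andbF.
apply: canon_ext => // [|i|i]; first exact: canon_prM.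
  by rewrite xe_prM xe_divM subnK.
rewrite tb_prM tb_divM; have := ht i; case: (tb g i) => [->|] //; case: (tb b i) => //.
Qed.

Section Psi.
Variable p : nat.
Hypothesis p1 : 1 < p.

Lemma psiXiP k y : y \in psiXi p k ->
  exists2 i, i <= k & y = (1%R, (xiPow (k - i) (p ^ i), xiPow i 1)).
Proof. by case/mapP => i; rewrite mem_iota add0n ltnS => /andP[_ ik] ->; exists i. Qed.

Lemma psiTauP k y : y \in psiTau p k -> y = (1%R, (tauM k, unitM)) \/
  exists2 i, i <= k & y = (1%R, (xiPow (k - i) (p ^ i), tauM i)).
Proof.
rewrite in_cons => /orP[/eqP->|/mapP[i]]; first by left.
by rewrite mem_iota add0n ltnS => /andP[_ ik] ->; right; exists i.
Qed.

Definition psiG (g : nat + nat) : seq term :=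
  match g with inl k => psiXi p k.+1 | inr j => psiTau p j end.

Definition gens (m : Mono) : seq (nat + nat) :=
  flatten [seq nseq (xe m i) (inl i) | i <- iota 0 (size m.1)] ++
  [seq inr j | j <- iota 0 (size m.2) & tb m j].

Lemma psiFactorsE m : psiFactors p m = map psiG (gens m).
Proof.
rewrite /psiFactors map_cat map_flatten -!map_comp; congr (flatten _ ++ _).
by apply: eq_map => i /=; rewrite map_nseq.
Qed.

Definition psiL (G : seq (nat + nat)) : seq term :=
  foldl mulL [:: (1%R, (unitM, unitM))] (map psiG G).

Lemma psiE m : psi p m = psiL (gens m).
Proof. by rewrite /psi psiFactorsE. Qed.

Lemma coefPsiE a b c : coefPsi p a b c = coefL (psiL (gens a)) (b, c).
Proof. by rewrite /coefPsi psiE. Qed.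

Lemma psiL_rcons G g : psiL (rcons G g) = mulL (psiL G) (psiG g).
Proof. by rewrite /psiL map_rcons foldl_rcons. Qed.

Lemma psiL_canon G : all canon2 (psiL G).
Proof.
elim/last_ind: G => [|G g _] //; rewrite psiL_rcons.
apply/allP => z /mem_mulL[x [y [_ _ /mem_mulT[_ _]]]] E.
by rewrite /canon2 E !canon_prM.
Qed.

Definition stat2 u v (bc : Mono * Mono) := stat u v bc.1 + stat u v bc.2.

Lemma stat2_mulT u v x y z : z \in mulT x y -> stat2 u v z.2 = stat2 u v x.2 + stat2 u v y.2.
Proof. by case/mem_mulT=> o1 o2 ->; rewrite /stat2 /= !stat_prM //; lia. Qed.

(** Used for the degree, on which every generator's coproduct is homogeneous; the inequality version
    that follows serves for the number of generators, on which it is only filtered. *)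
Lemma psiL_stat2 u v (w : nat + nat -> nat) G :
  (forall g y, g \in G -> y \in psiG g -> stat2 u v y.2 = w g) ->
  forall x, x \in psiL G -> stat2 u v x.2 = \sum_(g <- G) w g.
Proof.
elim/last_ind: G => [|G g IH] H x.
  by rewrite inE => /eqP-> /=; rewrite /stat2 /= !stat_unitM big_nil.
rewrite psiL_rcons => /mem_mulL[a [y [ha hy /stat2_mulT->]]].
rewrite (IH _ _ ha) ?(H g y) ?mem_rcons ?mem_head // -?cats1 ?big_cat ?big_seq1 //.
by move=> g' y' hg'; apply: H; rewrite mem_rcons inE hg' orbT.
Qed.

Lemma psiL_stat2_ge u v (w : nat + nat -> nat) G :
  (forall g y, g \in G -> y \in psiG g -> w g <= stat2 u v y.2) ->
  forall x, x \in psiL G -> \sum_(g <- G) w g <= stat2 u v x.2.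
Proof.
elim/last_ind: G => [|G g IH] H x; first by rewrite big_nil.
rewrite psiL_rcons => /mem_mulL[a [y [ha hy /stat2_mulT->]]].
rewrite -cats1 big_cat big_seq1 leq_add //; last by apply: H hy; rewrite mem_rcons mem_head.
by apply: IH ha => g' y' hg'; apply: H; rewrite mem_rcons inE hg' orbT.
Qed.

Lemma big_gens (w : nat + nat -> nat) m :
  \sum_(g <- gens m) w g = stat (fun k => w (inl k)) (fun j => w (inr j)) m.
Proof.
rewrite /gens big_cat /= big_flatten /= !big_map /stat; congr (_ + _).
  rewrite -(big_mkord xpredT (fun i => xe m i * w (inl i))) /index_iota subn0.
  by apply: eq_bigr => i _; rewrite big_nseq iter_addn_0 mulnC.
rewrite big_filter -(big_mkord xpredT (fun i => tb m i * w (inr i))) /index_iota subn0.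
by rewrite big_mkcond; apply: eq_bigr => i _ /=; case: (tb m i); rewrite ?mul1n.
Qed.

Lemma count_gens m g : count_mem g (gens m) =
  match g with inl k => xe m k | inr j => tb m j end.
Proof.
rewrite -sum1_count big_mkcond big_gens /=.
case: g => k; rewrite (@stat_wide _ _ _ (maxn k.+1 (maxn (size m.1) (size m.2)))); try lia.
  have kN : k < maxn k.+1 (maxn (size m.1) (size m.2)) by lia.
  rewrite (bigD1 (Ordinal kN)) //= eqxx big1 => [|i /eqP ik]; first lia.
  by case: eqP => [[E]|_]; [case: ik; apply: val_inj | lia].
have kN : k < maxn k.+1 (maxn (size m.1) (size m.2)) by lia.
rewrite (bigD1 (Ordinal kN)) //= eqxx big1 => [|i /eqP ik]; first lia.
by case: eqP => [[E]|_]; [case: ik; apply: val_inj | lia].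
Qed.

Lemma size_gens m : size (gens m) = wt m.
Proof. by rewrite -sum1_size big_gens. Qed.

Lemma deg_xiPow k e : degM p (xiPow k e) = e * (2 * (p ^ k - 1)).
Proof. by case: k => [|k]; rewrite degM_stat ?stat_unitM ?expn0 ?subnn ?muln0 ?stat_xiPow. Qed.

Lemma wt_xiPow k e : wt (xiPow k e) = e * (k != 0).
Proof. by case: k => [|k]; rewrite /wt ?stat_unitM ?muln0 ?stat_xiPow. Qed.

Lemma wt_tauM k : wt (tauM k) = 1.
Proof. by rewrite /wt stat_tauM. Qed.

Lemma psi_deg_mem a x : x \in psi p a -> degM p x.2.1 + degM p x.2.2 = degM p a.
Proof.
rewrite psiE => hx; pose u i := 2 * (p ^ i.+1 - 1); pose v i := 2 * p ^ i - 1.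
rewrite !degM_stat -/u -/v -/(stat2 u v x.2).
rewrite (@psiL_stat2 u v (fun g => match g with inl k => u k | inr j => v j end) (gens a)) //.
  by rewrite big_gens.
move=> [k|k] y _.
  (* For xi_(k+1-i)^(p^i) (x) xi_i: p^i (p^(k+1-i) - 1) + (p^i - 1) = p^(k+1) - 1. *)
  case/psiXiP=> i ik ->; rewrite /stat2 /= -!degM_stat !deg_xiPow /u.
  have := expnD p i (k.+1 - i); rewrite subnKC // => ->.
  have h1 := expn_gt0 p i; have h2 := expn_gt0 p (k.+1 - i); nia.
case/psiTauP=> [->|[i ik ->]]; first by rewrite /stat2 /= stat_tauM stat_unitM addn0.
rewrite /stat2 /= stat_tauM -degM_stat deg_xiPow /v.
have := expnD p i (k - i); rewrite subnKC // => ->.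
have h1 := expn_gt0 p i; have h2 := expn_gt0 p (k - i); nia.
Qed.

Lemma coefPsi_mem a b c : coefPsi p a b c != 0%R -> exists2 x, x \in psi p a & x.2 = (b, c).
Proof.
move=> nz; have: (b, c) \in map snd (psi p a).
  by apply: contraNT nz => h; rewrite /coefPsi -/(coefL _ _) coefL_nil.
by case/mapP => x hx E; exists x.
Qed.

Lemma psi_deg a b c : coefPsi p a b c != 0%R -> degM p b + degM p c = degM p a.
Proof. by case/coefPsi_mem => x /psi_deg_mem <- ->. Qed.

Lemma psi_canon a x : x \in psi p a -> canon x.2.1 && canon x.2.2.
Proof. by rewrite psiE => hx; apply: (allP (psiL_canon (gens a))) hx. Qed.

Lemma wt2_psiG g y : y \in psiG g -> 0 < stat2 (fun=> 1) (fun=> 1) y.2.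
Proof.
rewrite /stat2 -/(wt _) -/(wt _); case: g => k.
  case/psiXiP => i ik -> /=; rewrite !wt_xiPow.
  case: i ik => [|i] ik /=; last lia.
  by rewrite expn0.
case/psiTauP=> [->|[i _ ->]]; rewrite /= wt_tauM; lia.
Qed.

Lemma wt_psiL G x : x \in psiL G -> size G <= wt x.2.1 + wt x.2.2.
Proof.
move=> hx; rewrite -sum1_size; apply: (psiL_stat2_ge _ hx) => g y _; exact: wt2_psiG.
Qed.

Lemma coef_psi_wt a b c : coefPsi p a b c != 0%R -> wt a <= wt b + wt c.
Proof.
move=> nz; have: (b, c) \in map snd (psiL (gens a)).
  by apply: contraNT nz => h; rewrite coefPsiE coefL_nil.
by case/mapP => x hx E; have := wt_psiL hx; rewrite -E size_gens.
Qed.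

Definition gM (g : nat + nat) : Mono :=
  match g with inl k => xiPow k.+1 1 | inr j => tauM j end.

Lemma wt_gM g : wt (gM g) = 1.
Proof. by case: g => k; rewrite /= ?wt_tauM ?wt_xiPow. Qed.

(** Generators are primitive up to terms with more generators: a mixed term, xi_(k-i)^(p^i) tensored
    with xi_i or tau_i, contains at least two of them. *)
Lemma psiG_lead g : exists Y, perm_eq (psiG g)
   ((1%R, (gM g, unitM)) :: (1%R, (unitM, gM g)) :: Y) /\
   forall y, y \in Y -> 1 < wt y.2.1 + wt y.2.2.
Proof.
case: g => k /=.
  exists [seq (1%R, (xiPow (k.+1 - i) (p ^ i), xiPow i 1)) | i <- iota 1 k]; split.
    rewrite /psiXi -[k.+2]addn1 iotaD map_cat /= !add0n subnn perm_cons.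
    by rewrite perm_sym -cat1s perm_catC.
  move=> y /mapP[i]; rewrite mem_iota => /andP[i0 ik] -> /=.
  rewrite !wt_xiPow; have h := expn_gt0 p i; have -> : (k.+1 - i != 0) by lia.
  by have -> : i != 0; lia.
exists [seq (1%R, (xiPow (k - i) (p ^ i), tauM i)) | i <- iota 0 k]; split.
  rewrite /psiTau -[k.+1]addn1 iotaD map_cat /= !add0n subnn perm_cons.
  by rewrite perm_sym -cat1s perm_catC.
move=> y /mapP[i]; rewrite mem_iota => /andP[i0 ik] -> /=.
rewrite !wt_xiPow wt_tauM; have h := expn_gt0 p i; have -> : (k - i != 0) by lia.
lia.
Qed.

(** The earlier factors contribute at least [size G] generators and a nonprimitive term at least two
    more, which exceeds the weight of (b, c); only the two primitive terms survive. *)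
Lemma coefL_lead_step G g b c : wt b + wt c = (size G).+1 ->
  coefL (psiL (rcons G g)) (b, c) =
   (\sum_(x <- psiL G) coefL (mulT x (1, (gM g, unitM))) (b, c) +
    \sum_(x <- psiL G) coefL (mulT x (1, (unitM, gM g))) (b, c))%R.
Proof.
move=> hw; rewrite psiL_rcons coefL_mulL -big_split /= big_seq [RHS]big_seq.
apply: eq_bigr => x hx; have [Y [hp hY]] := psiG_lead g.
rewrite (perm_big _ hp) /= big_cons big_cons addrA big_seq big1 ?addr0 // => y hy.
apply: coefL_nil; apply/mapP => -[z /(stat2_mulT (fun=> 1) (fun=> 1)) E1 E2].
move: E1; rewrite -E2 /stat2 -!/(wt _) /= hw.
by move=> E1; move: (leq_add (wt_psiL hx) (hY _ hy)); rewrite -E1 addn2 ltnn.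
Qed.

Lemma wt_prM m m' : ~~ ovl m m' -> wt (prM m m') = wt m + wt m'.
Proof. exact: stat_prM. Qed.

Lemma xe_gM g k : xe (gM g) k = (g == inl k).
Proof.
case: g => j /=; last by rewrite xe_tauM.
by rewrite xe_xiPow eqSS muln1 eq_sym; congr nat_of_bool; apply/eqP/eqP => [->|[->]].
Qed.

Lemma tb_gM g j : tb (gM g) j = (g == inr j).
Proof.
case: g => k /=; first by rewrite tb_xiPow.
by rewrite tb_tauM eq_sym; apply/eqP/eqP => [->|[->]].
Qed.

Lemma tb_prM_add m m' j : ~~ ovl m m' -> tb (prM m m') j = tb m j + tb m' j :> nat.
Proof.
move/ovlP=> o; rewrite tb_prM; case E1: (tb m j); case E2: (tb m' j) => //.
by case: o; exists j; rewrite E1 E2.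
Qed.

Lemma lead_support G b c : wt b + wt c = size G -> coefL (psiL G) (b, c) != 0%R ->
  (forall k, count_mem (inl k) G = xe b k + xe c k) /\
  (forall j, count_mem (inr j) G = tb b j + tb c j).
Proof.
elim/last_ind: G b c => [|G g IH] b c hw.
  rewrite /psiL /= /coefL big_cons big_nil /=; case: ifP => [/eqP E _|_ /eqP //].
  have <- : unitM = b := congr1 fst E; have <- : unitM = c := congr1 snd E.
  by split=> i; rewrite ?xe_unitM ?tb_unitM.
move: hw; rewrite size_rcons => hw; rewrite coefL_lead_step // => nz.
have cX := psiL_canon G.
move: nz; set S1 := (\sum_(x <- _) _)%R; set S2 := (\sum_(x <- _) _)%R => nz.
have {nz} : (S1 != 0%R) || (S2 != 0%R).
  by apply: contraNT nz; rewrite negb_or !negbK => /andP[/eqP-> /eqP->]; rewrite addr0.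
case/orP=> [/(coefL_leftP cX)[b' [_ _ o Eb nz]]|/(coefL_rightP cX)[c' [_ _ o Ec nz]]].
  have [|h1 h2] := IH b' c _ nz; first by have := wt_prM o; rewrite Eb wt_gM; lia.
  split=> i; rewrite -cats1 count_cat /= addn0 ?h1 ?h2 -Eb ?xe_prM ?tb_prM_add //.
    by rewrite xe_gM addnAC.
  by rewrite tb_gM addnAC.
have [|h1 h2] := IH b c' _ nz; first by have := wt_prM o; rewrite Ec wt_gM; lia.
split=> i; rewrite -cats1 count_cat /= addn0 ?h1 ?h2 -Ec ?xe_prM ?tb_prM_add //.
  by rewrite xe_gM addnA.
by rewrite tb_gM addnA.
Qed.

Lemma lead_left0 G g b c : (forall k, xe (gM g) k <= xe b k) /\ (forall j, tb (gM g) j <= tb b j) \/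
  (\sum_(x <- psiL G) coefL (mulT x (1, (gM g, unitM))) (b, c) = 0)%R.
Proof.
set S := (\sum_(x <- _) _)%R; have [->|nz] := eqVneq S 0%R; first by right.
have [b' [_ _ o <- _]] := coefL_leftP (psiL_canon G) nz; left.
by split=> i; rewrite ?xe_prM ?tb_prM ?leq_addl //; case: (tb (gM g) i); rewrite ?orbT.
Qed.

Lemma lead_right0 G g b c : (forall k, xe (gM g) k <= xe c k) /\ (forall j, tb (gM g) j <= tb c j) \/
  (\sum_(x <- psiL G) coefL (mulT x (1, (unitM, gM g))) (b, c) = 0)%R.
Proof.
set S := (\sum_(x <- _) _)%R; have [->|nz] := eqVneq S 0%R; first by right.
have [b' [_ _ o <- _]] := coefL_rightP (psiL_canon G) nz; left.
by split=> i; rewrite ?xe_prM ?tb_prM ?leq_addl //; case: (tb (gM g) i); rewrite ?orbT.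
Qed.

(** Peels a generator off the left factor. The exponent e only records a sign, and even generators
    produce none, so that their coefficient can be computed exactly. *)
Lemma lead_left G g b c : canon b -> canon c ->
  (forall k, xe (gM g) k <= xe b k) -> (forall j, tb (gM g) j <= tb b j) ->
  wt b = (wt (divM b (gM g))).+1 /\ exists e, [/\ 
  (\sum_(x <- psiL G) coefL (mulT x (1, (gM g, unitM))) (b, c) =
   sgnz e * coefL (psiL G) (divM b (gM g), c))%R & (if g is inl _ then e = 0 else True)].
Proof.
move=> cb cc hx ht; have [|c' o E] := divMP cb hx.
  by move=> i; have := ht i; case: (tb (gM g) i) => //; case: (tb b i).
split; first by rewrite -{1}E wt_prM // wt_gM addn1.
exists (invM (divM b (gM g)) (gM g) + tauCount c * tauCount (gM g)); split.
  by rewrite -{1}E coefL_left //; apply: psiL_canon.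
case: g hx ht c' o E => // k hx ht c' o E; rewrite tb_invM0; last by move=> j; rewrite tb_gM.
by rewrite [tauCount (gM _)]tauCount_stat /= stat_xiPow !muln0.
Qed.

Lemma lead_right G g b c : canon b -> canon c ->
  (forall k, xe (gM g) k <= xe c k) -> (forall j, tb (gM g) j <= tb c j) ->
  wt c = (wt (divM c (gM g))).+1 /\ exists e, [/\ 
  (\sum_(x <- psiL G) coefL (mulT x (1, (unitM, gM g))) (b, c) =
   sgnz e * coefL (psiL G) (b, divM c (gM g)))%R & (if g is inl _ then e = 0 else True)].
Proof.
move=> cb cc hx ht; have [|c' o E] := divMP cc hx.
  by move=> i; have := ht i; case: (tb (gM g) i) => //; case: (tb c i).
split; first by rewrite -{1}E wt_prM // wt_gM addn1.
exists (invM (divM c (gM g)) (gM g)); split.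
  by rewrite -{1}E coefL_right //; apply: psiL_canon.
by case: g hx ht c' o E => // k hx ht c' o E; rewrite tb_invM0 // => j; rewrite tb_gM.
Qed.

Definition binM N (b c : Mono) : nat := \prod_(k < N) 'C(xe b k + xe c k, xe b k).

Lemma canon_unit_ext b : canon b -> (forall k, xe b k = 0) -> (forall j, tb b j = false) -> b = unitM.
Proof.
by move=> cb hx ht; apply: canon_ext => // i; rewrite ?xe_unitM ?tb_unitM ?hx ?ht.
Qed.

(** Coproduct of a polynomial algebra on primitive generators: the last factor goes to the left or
    to the right, which is Pascal's rule. *)
Lemma lead_xi N G b c : all (fun g => if g is inl k then k < N else false) G ->
  canon b -> canon c -> wt b + wt c = size G ->
  (forall k, count_mem (inl k) G = xe b k + xe c k) ->
  (forall j, tb b j = false) -> (forall j, tb c j = false) ->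
  coefL (psiL G) (b, c) = (binM N b c)%:R%R.
Proof.
elim/last_ind: G b c => [|G g IH] b c /= hG cb cc hw hc hb0 hc0.
  rewrite (canon_unit_ext cb) // => [|k]; last by have := hc k; rewrite /=; lia.
  rewrite (canon_unit_ext cc) // => [|k]; last by have := hc k; rewrite /=; lia.
  rewrite /coefL big_cons big_nil /= addr0 /binM big1 // => i _.
  by rewrite xe_unitM.
move: hG hw; rewrite all_rcons size_rcons => /andP[kN hG] hw.
rewrite coefL_lead_step //; case: g kN hc => // k kN hc.
have hc' i : count_mem (inl i) G + (k == i) = xe b i + xe c i.
  by rewrite -hc -cats1 count_cat /= addn0; congr (_ + nat_of_bool _); apply/eqP/eqP => [->|[]].
have xg i : xe (gM (inl k)) i = (k == i).
  by rewrite xe_gM; congr nat_of_bool; apply/eqP/eqP => [[]|->].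
have hk : 0 < xe b k + xe c k by have := hc' k; rewrite eqxx; lia.
(* With exponent 0 in b there is nothing to peel off, and [divM] would be junk. *)
have L : (\sum_(x <- psiL G) coefL (mulT x (1, (gM (inl k), unitM))) (b, c) =
   (if (xe b k == 0)%N then 0%N else binM N (divM b (gM (inl k))) c)%:R)%R.
  case: eqP => b0.
    case: (lead_left0 G (inl k) b c) => [[/(_ k)]|->] //.
    by rewrite xe_gM eqxx b0.
  have hx i : xe (gM (inl k)) i <= xe b i by rewrite xe_gM; case: eqP => // -[<-]; lia.
  have [|h1 [e [-> ->]]] := lead_left G cb cc hx; first by move=> j; rewrite tb_gM.
  rewrite [sgnz 0]expr0 mul1r IH //; first exact: canon_mkM.
  - by apply: succn_inj; rewrite -hw h1 addSn.
  - by move=> i; apply: (@addIn (k == i)); rewrite hc' xe_divM -xg addnAC subnK.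
  by move=> j; rewrite tb_divM hb0.
have R : (\sum_(x <- psiL G) coefL (mulT x (1, (unitM, gM (inl k)))) (b, c) =
   (if (xe c k == 0)%N then 0%N else binM N b (divM c (gM (inl k))))%:R)%R.
  case: eqP => b0.
    case: (lead_right0 G (inl k) b c) => [[/(_ k)]|->] //.
    by rewrite xe_gM eqxx b0.
  have hx i : xe (gM (inl k)) i <= xe c i by rewrite xe_gM; case: eqP => // -[<-]; lia.
  have [|h1 [e [-> ->]]] := lead_right G cb cc hx; first by move=> j; rewrite tb_gM.
  rewrite [sgnz 0]expr0 mul1r IH //; first exact: canon_mkM.
  - by apply: succn_inj; rewrite -hw h1 addnS.
  - by move=> i; apply: (@addIn (k == i)); rewrite hc' xe_divM -xg -addnA subnK.
  by move=> j; rewrite tb_divM hc0.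
rewrite L R -natrD; congr (_%:R)%R; rewrite /binM.
have P1 (b2 c2 : Mono) : (forall i, i != k -> xe b2 i = xe b i) -> (forall i, i != k -> xe c2 i = xe c i) ->
   \prod_(i < N) 'C(xe b2 i + xe c2 i, xe b2 i) =
   'C(xe b2 k + xe c2 k, xe b2 k) * \prod_(i < N | i != Ordinal kN) 'C(xe b i + xe c i, xe b i).
  move=> e1 e2; rewrite (bigD1 (Ordinal kN)) //=; congr (_ * _).
  apply: eq_bigr => i ik; rewrite e1 ?e2 //; by apply: contraNneq ik => E; apply/eqP/val_inj.
have dk b2 i : i != k -> xe (divM b2 (gM (inl k))) i = xe b2 i.
  by move=> ik; rewrite xe_divM xg eq_sym (negbTE ik) subn0.
rewrite (P1 b c) // (P1 _ c) //; last exact: dk.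
rewrite (P1 b) //; last exact: dk.
rewrite !xe_divM !xg eqxx; set Q := \prod_(i < N | _) _.
case: eqP => [b0|/eqP b0]; case: eqP => [c0|/eqP c0].
- by move: hk; rewrite b0 c0.
- by rewrite b0 !bin0.
- rewrite c0 !addn0 !binn; lia.
rewrite -mulnDl; congr (_ * _).
move: b0 c0; case: (xe b k) => // x; case: (xe c k) => // y _ _.
by rewrite !subn1 /= [x.+1 + y]addSnnS addnC -binS -addSn.
Qed.

(** A tau occurs at most once, so its side is forced by b and c and it contributes only a sign; the
    binomials come from the xi alone. *)
Lemma lead_tau N G T b c : all (fun g => if g is inl k then k < N else false) G ->
  uniq T -> canon b -> canon c -> wt b + wt c = size G + size T ->
  (forall k, count_mem (inl k) G = xe b k + xe c k) ->
  (forall j, count_mem j T = tb b j + tb c j) ->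
  exists e, coefL (psiL (G ++ map inr T)) (b, c) = ((-1) ^+ e * (binM N b c)%:R)%R.
Proof.
move=> hG; elim/last_ind: T b c => [|T j IH] b c.
  move=> _ cb cc hw hc ht; exists 0; rewrite cats0 expr0 mul1r (lead_xi hG) //.
  - by rewrite hw addn0.
  - by move=> j; have := ht j => /=; case: (tb b j).
  by move=> j; have := ht j => /=; case: (tb c j); rewrite ?addn1.
rewrite rcons_uniq size_rcons => /andP[jT uT] cb cc hw hc ht.
rewrite map_rcons -rcons_cat coefL_lead_step; last by rewrite hw size_cat size_map addnS.
have ht' i : count_mem i T + (j == i) = tb b i + tb c i.
  by rewrite -ht -cats1 count_cat /= addn0.
have cj : tb b j + tb c j = 1.
  by rewrite -ht' eqxx; move: jT => /count_memPn ->.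
set F := G ++ map inr T.
have hxg i : xe (gM (inr j)) i = 0 by rewrite xe_gM.
have htg i : tb (gM (inr j)) i = (j == i) by rewrite tb_gM; apply/eqP/eqP => [[]|->].
have bE b2 c2 : (forall k, xe b2 k = xe b k) -> (forall k, xe c2 k = xe c k) -> binM N b2 c2 = binM N b c.
  by move=> e1 e2; apply: eq_bigr => i _; rewrite e1 e2.
have dx b2 k : xe (divM b2 (gM (inr j))) k = xe b2 k by rewrite xe_divM hxg subn0.
case tbj : (tb b j) cj; case tcj : (tb c j) => // _.
  case: (lead_right0 F (inr j) b c) => [[_ /(_ j)]|->]; first by rewrite htg eqxx tcj.
  have [||h1 [e [-> _]]] := @lead_left F (inr j) b c cb cc.
  - by move=> k; rewrite hxg.
  - by move=> i; rewrite htg; case: eqP => // <-; rewrite tbj.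
  have [||||//|e' ->] := IH (divM b (gM (inr j))) c uT.
  - exact: canon_mkM.
  - by [].
  - by apply: succn_inj; rewrite -[RHS]addnS -hw h1 addSn.
  - by move=> k; rewrite dx.
  - move=> i; rewrite tb_divM htg; have := ht' i; case: eqP => [<-|]; rewrite ?tbj ?tcj /=; last by rewrite andbT; lia.
    lia.
  by exists (e + e'); rewrite addr0 bE // exprD mulrA.
case: (lead_left0 F (inr j) b c) => [[_ /(_ j)]|->]; first by rewrite htg eqxx tbj.
have [||h1 [e [-> _]]] := @lead_right F (inr j) b c cb cc.
- by move=> k; rewrite hxg.
- by move=> i; rewrite htg; case: eqP => // <-; rewrite tcj.
have [||||//|e' ->] := IH b (divM c (gM (inr j))) uT.
- by [].
- exact: canon_mkM.
- by apply: succn_inj; rewrite -[RHS]addnS -hw h1 addnS.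
- by move=> k; rewrite dx.
- move=> i; rewrite tb_divM htg; have := ht' i; case: eqP => [<-|]; rewrite ?tbj ?tcj /=; last by rewrite andbT; lia.
  lia.
by exists (e + e'); rewrite add0r bE // exprD mulrA.
Qed.

Lemma coefPsi_lead_support a b c : wt b + wt c = wt a -> coefPsi p a b c != 0%R ->
  (forall k, xe a k = xe b k + xe c k) /\ (forall j, tb a j = tb b j + tb c j :> nat).
Proof.
rewrite -(size_gens a) coefPsiE => hw /(lead_support hw)[h1 h2].
by split=> i; rewrite -?h1 -?h2 count_gens.
Qed.

(** The sign stays unspecified: what matters later is whether the coefficient vanishes mod p. *)
Lemma coefPsi_lead a b c : canon b -> canon c ->
  (forall k, xe a k = xe b k + xe c k) -> (forall j, tb a j = tb b j + tb c j :> nat) ->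
  exists e, coefPsi p a b c = ((-1) ^+ e * (binM (size a.1) b c)%:R)%R.
Proof.
move=> cb cc hx ht; rewrite coefPsiE /gens; apply: lead_tau => //.
- apply/allP => g /flattenP[s /mapP[i hi ->]] /nseqP[-> _].
  by move: hi; rewrite mem_iota.
- by rewrite filter_uniq // iota_uniq.
- have := size_gens a; rewrite /gens size_cat size_map => ->.
  by rewrite [RHS](stat_add _ _ (m1 := b) (m2 := c)).
- move=> k; rewrite -hx -(count_gens a (inl k)) /gens count_cat.
  rewrite [X in _ = _ + X](_ : _ = 0) ?addn0 //; apply/count_memPn.
  by apply/mapP => -[].
move=> j; rewrite -ht -(count_gens a (inr j)) /gens count_cat.
rewrite [X in _ = X + _](_ : _ = 0) ?add0n; last first.
  by apply/count_memPn/flattenP => -[s /mapP[i _ ->] /nseqP[]].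
by rewrite count_map; apply: eq_count => i /=; apply/eqP/eqP => [->|[]].
Qed.

End Psi.

(** * Evaluating the coproduct in exterior algebras *)

Section Evaluation.
Local Open Scope ring_scope.
Variables (R : comNzRingType) (L : pzRingType) (V : lmodType R).
(* [io] embeds the even scalars and [th] the odd elements of a
   graded-commutative algebra [L]. *)
Variables (io : {rmorphism R -> L}) (th : {additive V -> L}).
Hypothesis ioC : forall a z, io a * z = z * io a.
Hypothesis thZ : forall a v, th (a *: v) = io a * th v.
Hypothesis th2 : forall v, th v * th v = 0.

Lemma thA v w : th v * th w = - (th w * th v).
Proof.
have := th2 (v + w); rewrite raddfD mulrDl !mulrDr !th2 addr0 add0r.
by move/eqP; rewrite addr_eq0 => /eqP.
Qed.

Definition ext (t : nat -> V) (N : nat) (P : nat -> bool) : L :=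
  \prod_(0 <= j < N | P j) th (t j).

Definition cnt (N : nat) (P : nat -> bool) : nat := (\sum_(0 <= j < N) P j)%N.

Lemma ext_recr t N P : ext t N.+1 P = ext t N P * (if P N then th (t N) else 1).
Proof. by rewrite /ext [LHS]big_mkcond [X in X * _]big_mkcond big_nat_recr. Qed.

Lemma signC n (z : L) : (-1) ^+ n * z = z * (-1) ^+ n.
Proof. by apply: commr_sym; apply: commr_sign. Qed.

Lemma th_ext v t N P : th v * ext t N P = (-1) ^+ cnt N P * (ext t N P * th v).
Proof.
elim: N => [|N IH]; first by rewrite /ext /cnt !big_nil expr0 !mul1r mulr1.
rewrite ext_recr mulrA IH /cnt big_nat_recr //= -/(cnt N P) exprD -!mulrA.
congr (_ * _); rewrite [RHS]mulrA signC -!mulrA; congr (_ * _).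
case: (P N); rewrite ?expr0 ?mul1r ?mulr1 // expr1 thA.
by rewrite mulNr mul1r.
Qed.

Lemma ext_swap t t' N N' P Q :
  ext t' N' Q * ext t N P = (-1) ^+ (cnt N' Q * cnt N P)%N * (ext t N P * ext t' N' Q).
Proof.
elim: N' => [|N' IH]; first by rewrite /ext /cnt !big_nil mul0n expr0 !mul1r mulr1.
rewrite ext_recr /cnt big_nat_recr //= -/(cnt N' Q) -/(cnt N P) mulnDl exprD.
case: (Q N'); last by rewrite mul0n expr0 !mulr1 IH.
rewrite -mulrA th_ext [LHS]mulrA -[ext t' N' Q * _ ^+ _]signC.
by rewrite -[LHS]mulrA [ext t' N' Q * (_ * _)]mulrA IH mul1n !mulrA -!exprD addnC.
Qed.

Definition invc (N : nat) (P Q : nat -> bool) : nat :=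
  (\sum_(0 <= a < N) \sum_(0 <= b < N) [&& P a, Q b & (b < a)%N])%N.

Lemma invc_recr N P Q : invc N.+1 P Q = (invc N P Q + P N * cnt N Q)%N.
Proof.
rewrite /invc big_nat_recr //=; congr addn.
  rewrite big_nat [RHS]big_nat; apply: eq_bigr => a /andP[_ aN].
  by rewrite big_nat_recr //= ltnNge (ltnW aN) /= !andbF addn0.
rewrite big_nat_recr //= ltnn !andbF addn0 /cnt.
case: (P N); rewrite ?mul0n ?mul1n; last by rewrite big1.
by rewrite big_nat [RHS]big_nat; apply: eq_bigr => b /andP[_ ->]; rewrite andbT.
Qed.

Lemma ext_mul t N P Q : ext t N P * ext t N Q =
  if has (fun i => P i && Q i) (iota 0 N) then 0
  else (-1) ^+ invc N P Q * ext t N (fun i => P i || Q i).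
Proof.
elim: N => [|N IH]; first by rewrite /ext /invc !big_nil expr0 !mulr1.
rewrite -[N.+1]addn1 iotaD has_cat /= orbF add0n addn1.
rewrite !ext_recr invc_recr.
have E : ext t N P * (if P N then th (t N) else 1) * (ext t N Q * (if Q N then th (t N) else 1))
  = (-1) ^+ (P N * cnt N Q)%N * (ext t N P * ext t N Q) *
    ((if P N then th (t N) else 1) * (if Q N then th (t N) else 1)).
  case: (P N); rewrite ?mul0n ?expr0 ?mul1r ?mulr1 ?mulrA // mul1n.
  rewrite -[ext t N P * th (t N) * _]mulrA th_ext mulrA -signC.
  by rewrite -!mulrA.
rewrite E IH; case: (has _ _) => /=; first by rewrite mulr0 mul0r.
rewrite [X in X * _]mulrA -exprD [(_ * _ + _)%N]addnC -[LHS]mulrA.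
by case: (P N); case: (Q N) => /=; rewrite ?th2 ?mulr0 ?mulr1 ?mul1r.
Qed.

(** Value of a monomial at the point (x, t): xi_k goes to x k and tau_j to the odd element
    [th (t j)]. The entry x 0 stands for xi_0 = 1. *)
Definition ev (x : nat -> R) (t : nat -> V) (m : Mono) : L :=
  io (\prod_(i < size m.1) x i.+1 ^+ xe m i) * ext t (size m.2) (tb m).

Lemma prod_wide (F : nat -> R) n N : (n <= N)%N -> (forall i, (n <= i)%N -> F i = 1) ->
  \prod_(i < n) F i = \prod_(i < N) F i.
Proof.
move=> nN F0; rewrite (big_ord_widen N F nN) [RHS](bigID (fun i : 'I_N => i < n)%N) /=.
by rewrite [X in _ * X]big1 ?mulr1 // => i; rewrite -leqNgt; apply: F0.
Qed.

Lemma ext_wide t n N P : (n <= N)%N -> (forall i, (n <= i)%N -> P i = false) ->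
  ext t n P = ext t N P.
Proof.
move=> nN P0; rewrite /ext [RHS](big_cat_nat (n := n)) //= [X in _ = _ * X]big_nat_cond.
by rewrite [X in _ = _ * X]big_pred0 ?mulr1 // => i; case: (leqP n i) => //= /P0 ->; rewrite andbF.
Qed.

Lemma ev_wide N x t m : (size m.1 <= N)%N -> (size m.2 <= N)%N ->
  ev x t m = io (\prod_(i < N) x i.+1 ^+ xe m i) * ext t N (tb m).
Proof.
move=> h1 h2; rewrite /ev (prod_wide (F := fun i => x i.+1 ^+ xe m i) h1); last first.
  by move=> i /xe_size ->; rewrite expr0.
by rewrite (ext_wide t h2) // => i /tb_size.
Qed.

Lemma ext_eq t N P Q : (forall i, P i = Q i) -> ext t N P = ext t N Q.
Proof. by move=> PQ; apply: eq_bigl. Qed.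

Lemma cnt_tau N m : (size m.2 <= N)%N -> cnt N (tb m) = tauCount m.
Proof.
move=> h; rewrite tauCount_stat /stat big1 ?add0n => [|i _]; last by rewrite muln0.
rewrite /cnt big_mkord -(sum_wide (F := fun j => tb m j) h) => [|i /tb_size -> //].
by apply: eq_bigr => i _; rewrite muln1.
Qed.

Lemma has_iota_wide (P : nat -> bool) n N : (n <= N)%N ->
  (forall i, (n <= i)%N -> P i = false) -> has P (iota 0 n) = has P (iota 0 N).
Proof.
move=> nN P0; rewrite -(subnKC nN) iotaD has_cat [X in _ || X](_ : _ = false) ?orbF //.
by apply/hasP => -[i]; rewrite mem_iota add0n => /andP[/P0 ->].
Qed.

Lemma invc_invM N m m' : (size m.2 <= N)%N -> (size m'.2 <= N)%N ->
  invc N (tb m) (tb m') = invM m m'.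
Proof.
move=> h1 h2; rewrite /invM sumnE big_allpairs_dep /invc !big_mkord.
rewrite -[X in iota 0 X]subn0 -/(index_iota 0 _) big_mkord.
rewrite [RHS](sum_wide (F := (fun a => \sum_(j <- iota 0 (size m'.2)) [&& tb m a, tb m' j & j < a])%N) h1).
  apply: eq_bigr => a _; rewrite big_mkord -[X in iota 0 X]subn0 -/(index_iota 0 _) big_mkord.
  rewrite [RHS](sum_wide (F := (fun j => nat_of_bool [&& tb m a, tb m' j & j < a])%N) h2) //.
  by move=> j /tb_size ->; rewrite andbF.
by move=> a /tb_size ->; rewrite big1.
Qed.

Lemma ev_mulM x t m m' : ev x t m * ev x t m' =
  if mulM m m' is Some (k, m'') then (-1) ^+ k * ev x t m'' else 0.
Proof.
rewrite mulME; pose N := maxn (maxn (size m.1) (size m.2)) (maxn (size m'.1) (size m'.2)).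
have [h1 h2] := size_prM m m'.
have -> : ev x t m * ev x t m' = io (\prod_(i < N) x i.+1 ^+ (xe m i + xe m' i)%N) *
  (ext t N (tb m) * ext t N (tb m')).
  rewrite !(@ev_wide N) /N; try lia.
  rewrite -!mulrA [ext _ _ _ * (_ * _)]mulrA -ioC !mulrA -rmorphM -big_split /=.
  by congr (io _ * _ * _); apply: eq_bigr => i _; rewrite exprD.
rewrite ext_mul.
have -> : has (fun i => tb m i && tb m' i) (iota 0 N) = ovl m m'.
  rewrite /ovl; symmetry; apply: has_iota_wide; first by rewrite /N; lia.
  by move=> i; rewrite geq_max => /andP[/tb_size -> _].
case: ovl; first by rewrite mulr0.
rewrite invc_invM /N; try lia.
rewrite (@ev_wide N) /N; try lia.
rewrite mulrA -signC -mulrA; congr (_ * (io _ * _)).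
  by apply: eq_bigr => i _; rewrite xe_prM.
by apply: ext_eq => i; rewrite tb_prM.
Qed.

Lemma io_swap a b (E F : L) n : F * E = (-1) ^+ n * (E * F) ->
  (io b * F) * (io a * E) = (-1) ^+ n * ((io a * E) * (io b * F)).
Proof.
move=> H; rewrite -[LHS]mulrA [F * _]mulrA -ioC -[io a * F * E]mulrA H.
have -> : io a * E * (io b * F) = io b * (io a * (E * F)).
  by rewrite -[LHS]mulrA [E * _]mulrA -ioC !mulrA (ioC a (io b)).
by rewrite [io a * (_ ^+ _ * _)]mulrA -signC -[_ * io a * _]mulrA
  [LHS]mulrA -signC -[LHS]mulrA.
Qed.

Lemma ev_swap x t x' t' b a : ev x' t' b * ev x t a =
  (-1) ^+ (tauCount b * tauCount a)%N * (ev x t a * ev x' t' b).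
Proof. by rewrite -!(cnt_tau (leqnn _)); apply/io_swap/ext_swap. Qed.

Lemma shuffle (c c' : int) (A B C D : L) n : B * C = (-1) ^+ n * (C * B) ->
  (c%:~R * (A * B)) * (c'%:~R * (C * D)) = (c * c')%:~R * ((-1) ^+ n * ((A * C) * (B * D))).
Proof.
move=> H; rewrite intrM -!mulrA; congr (_ * _).
have zC (w : L) : w * c'%:~R = c'%:~R * w by apply: commrMz; apply: commr1.
rewrite [B * _]mulrA zC -[_ * B * _]mulrA mulrA zC -mulrA; congr (_ * _).
by rewrite [B * _]mulrA H -!mulrA mulrA -signC -mulrA.
Qed.

Lemma shuffle_sign (c : int) (A B : L) n k l :
  c%:~R * ((-1) ^+ n * (((-1) ^+ k * A) * ((-1) ^+ l * B))) =
  (c * (-1) ^+ (k + l + n))%:~R * (A * B).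
Proof.
rewrite intrM rmorph_sign -!mulrA; congr (_ * _).
rewrite [A * (_ * _)]mulrA -signC -[_ * A * _]mulrA; move: (A * B) => X.
by rewrite 2!mulrA -!exprD; congr (_ ^+ _ * _); rewrite -addnA addnC.
Qed.

Section Two.
Variables (x x' : nat -> R) (t t' : nat -> V).

Definition ev2 (bc : Mono * Mono) : L := ev x t bc.1 * ev x' t' bc.2.
Definition evT (X : seq term) : L := \sum_(y <- X) y.1%:~R * ev2 y.2.

(** The sign (-1)^(|b||a'|) of [mulT] is the one produced by moving the odd part of b past that of
    a', the even scalars being central. *)
Lemma evT_mulT y z : evT (mulT y z) = (y.1%:~R * ev2 y.2) * (z.1%:~R * ev2 z.2).
Proof.
rewrite /ev2 (shuffle _ _ _ _ (ev_swap x t x' t' y.2.2 z.2.1)) !ev_mulM /mulT.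
case: (mulM y.2.1 z.2.1) => [[ka ma]|]; last by rewrite mul0r !mulr0 /evT big_nil.
case: (mulM y.2.2 z.2.2) => [[kb mb]|]; last by rewrite !mulr0 /evT big_nil.
by rewrite /evT big_cons big_nil addr0 shuffle_sign.
Qed.

Lemma evT_mulL X Y : evT (mulL X Y) = evT X * evT Y.
Proof.
rewrite {1}/evT big_flatten big_allpairs_dep /= mulr_suml; apply: eq_bigr => y _.
by rewrite mulr_sumr; apply: eq_bigr => z _; rewrite -evT_mulT.
Qed.
End Two.

Lemma ev_unitM x t : ev x t unitM = 1.
Proof. by rewrite /ev /ext big_ord0 big_geq // rmorph1 mulr1. Qed.

Lemma ev_xiPow x t k e : x 0%N = 1 -> ev x t (xiPow k e) = io (x k ^+ e).
Proof.
case: k => [|k] x0; first by rewrite ev_unitM x0 expr1n rmorph1.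
pose N := maxn k.+1 (maxn (size (xiPow k.+1 e).1) (size (xiPow k.+1 e).2)).
have kN : (k < N)%N by rewrite /N; lia.
rewrite (@ev_wide N) /N; try lia; rewrite -/N.
rewrite /ext big_pred0 ?mulr1 => [|i]; last by rewrite tb_xiPow.
rewrite (bigD1 (Ordinal kN)) //= xe_xiPow eqxx mul1n big1 ?mulr1 // => i /eqP ik.
rewrite xe_xiPow eqSS; case: eqP => // E.
by case: ik; apply: val_inj.
Qed.

Lemma ev_tauM x t j : ev x t (tauM j) = th (t j).
Proof.
rewrite /ev big_ord0 rmorph1 mul1r size_rcons size_nseq ext_recr tb_tauM eqxx.
rewrite /ext big_nat_cond big_pred0 ?mul1r // => i.
by rewrite tb_tauM; case: eqP => [->|_]; rewrite ?ltnn ?andbF.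
Qed.

Variable p : nat.

(* Composition of the points of the dual Steenrod algebra, with x 0 = 1. *)
Definition comp (x x' : nat -> R) (k : nat) : R :=
  \sum_(i < k.+1) x (k - i)%N ^+ (p ^ i) * x' i.
Definition compT (x : nat -> R) (t t' : nat -> V) (k : nat) : V :=
  t k + \sum_(i < k.+1) x (k - i)%N ^+ (p ^ i) *: t' i.

Lemma comp0 x x' : x 0%N = 1 -> x' 0%N = 1 -> comp x x' 0 = 1.
Proof. by move=> h h'; rewrite /comp big_ord1 subn0 h h' expr1n mulr1. Qed.

Lemma evT_psiXi x x' t t' k : x 0%N = 1 -> x' 0%N = 1 ->
  evT x x' t t' (psiXi p k) = io (comp x x' k).
Proof.
move=> h h'; rewrite /evT big_map /comp rmorph_sum /= -(big_mkord xpredT (fun i => io (x (k - i)%N ^+ (p ^ i) * x' i))).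
rewrite /index_iota subn0; apply: eq_bigr => i _.
by rewrite mul1r /ev2 /= !ev_xiPow // expr1 rmorphM.
Qed.

Lemma evT_psiTau x x' t t' k : x 0%N = 1 ->
  evT x x' t t' (psiTau p k) = th (compT x t t' k).
Proof.
move=> h; rewrite /evT big_cons big_map /compT raddfD raddf_sum; congr (_ + _).
  by rewrite mul1r /ev2 /= ev_tauM ev_unitM mulr1.
rewrite -(big_mkord xpredT (fun i => th (x (k - i)%N ^+ (p ^ i) *: t' i))).
rewrite /index_iota subn0; apply: eq_bigr => i _.
by rewrite mul1r /ev2 /= ev_xiPow // ev_tauM thZ.
Qed.

Lemma evT_psiL x x' t t' G : x 0%N = 1 -> x' 0%N = 1 ->
  evT x x' t t' (psiL p G) =
  \prod_(g <- G) match g with inl k => io (comp x x' k.+1) | inr j => th (compT x t t' j) end.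
Proof.
move=> h h'; elim/last_ind: G => [|G g IH].
  by rewrite /psiL /evT big_cons !big_nil /ev2 !ev_unitM addr0 !mulr1.
rewrite psiL_rcons evT_mulL IH -cats1 big_cat big_seq1; congr (_ * _).
by case: g => k; [apply: evT_psiXi | apply: evT_psiTau].
Qed.

(** The coproduct is given on generators and extended multiplicatively, so evaluating its two sides
    at two points evaluates the monomial at their composite. *)
Lemma evT_psi x x' t t' m : x 0%N = 1 -> x' 0%N = 1 ->
  evT x x' t t' (psi p m) = ev (comp x x') (compT x t t') m.
Proof.
move=> h h'; rewrite psiE evT_psiL // /gens big_cat /ev; congr (_ * _).
  rewrite big_flatten big_map /= rmorph_prod /=.
  rewrite -(big_mkord xpredT (fun i => io (comp x x' i.+1 ^+ xe m i))) /index_iota subn0.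
  by apply: eq_bigr => i _; rewrite big_nseq rmorphXn /= -Monoid.iteropE.
by rewrite big_map big_filter /ext /index_iota subn0.
Qed.

(** Reindexes the triangle i + j <= k by l = i + j. *)
Lemma tri_sum (M : nmodType) (F : nat -> nat -> M) k :
  \sum_(i < k.+1) \sum_(j < (k - i).+1) F i j =
  \sum_(l < k.+1) \sum_(i < l.+1) F i (l - i)%N.
Proof.
elim: k => [|k IH]; first by rewrite !big_ord1.
rewrite [RHS]big_ord_recr /= -IH [LHS]big_ord_recr /= subnn big_ord1.
rewrite [X in _ = _ + X]big_ord_recr /= subnn addrA -big_split /=; congr (_ + _).
apply: eq_bigr => i _; have ik : (i <= k)%N by rewrite -ltnS.
by rewrite subSn // big_ord_recr.
Qed.

Hypothesis pR : p \in [pchar R].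

Lemma pexp_sum (I : Type) (r : seq I) (F : I -> R) k :
  (\sum_(i <- r) F i) ^+ (p ^ k) = \sum_(i <- r) F i ^+ (p ^ k).
Proof.
elim: k F => [|k IH] F; first by rewrite expn0 expr1; apply: eq_bigr => i _; rewrite expr1.
rewrite expnS exprM -(pFrobenius_autE pR) rmorph_sum /= IH.
by apply: eq_bigr => i _; rewrite pFrobenius_autE exprM.
Qed.

(** [comp x x'] lists the coefficients of x'(x(T)) for the series x(T) = sum x_i T^(p^i) and x'(T) =
    sum x'_i T^(p^i), so this is associativity of substitution. Characteristic p makes p^i-th powers
    additive. *)
Lemma compA x0 x1 x2 k : comp (comp x0 x1) x2 k = comp x0 (comp x1 x2) k.
Proof.
pose F i j := x0 (k - i - j)%N ^+ (p ^ (j + i)) * x1 j ^+ (p ^ i) * x2 i.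
transitivity (\sum_(i < k.+1) \sum_(j < (k - i).+1) F i j).
  apply: eq_bigr => i _; rewrite pexp_sum mulr_suml; apply: eq_bigr => j _.
  by rewrite exprMn -exprM -expnD.
rewrite tri_sum; apply: eq_bigr => l _; rewrite mulr_sumr; apply: eq_bigr => i _.
have il : (i <= l)%N by rewrite -ltnS.
by rewrite /F subnK // -subnDA subnKC // mulrA.
Qed.

(** With the odd series t(T) = sum t_i T^(p^i), [compT x t t'] lists the coefficients of t(T) +
    t'(x(T)), and the same argument applies. *)
Lemma compTA x0 x1 t0 t1 t2 k :
  compT (comp x0 x1) (compT x0 t0 t1) t2 k = compT x0 t0 (compT x1 t1 t2) k.
Proof.
pose F i j := (x0 (k - i - j)%N ^+ (p ^ (j + i)) * x1 j ^+ (p ^ i)) *: t2 i.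
rewrite /compT -!addrA; congr (_ + _).
have -> : \sum_(i < k.+1) comp x0 x1 (k - i) ^+ (p ^ i) *: t2 i =
   \sum_(i < k.+1) \sum_(j < (k - i).+1) F i j.
  apply: eq_bigr => i _; rewrite pexp_sum scaler_suml; apply: eq_bigr => j _.
  by rewrite exprMn -exprM -expnD.
rewrite tri_sum -big_split; apply: eq_bigr => l _ /=.
rewrite scalerDr scaler_sumr; congr (_ + _); apply: eq_bigr => i _.
have il : (i <= l)%N by rewrite -ltnS.
by rewrite /F subnK // -subnDA subnKC // scalerA.
Qed.

Lemma ev_eq x y t u m : x =1 y -> t =1 u -> ev x t m = ev y u m.
Proof.
move=> xy tu; congr (io _ * _); first by apply: eq_bigr => i _; rewrite xy.
by apply: eq_bigr => i _; rewrite tu.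
Qed.

Lemma intr_mul3 (c c' : int) (A B C : L) :
  c%:~R * (A * (c'%:~R * (B * C))) = (c * c')%:~R * (A * B * C).
Proof.
have zC (w : L) : w * c'%:~R = c'%:~R * w by apply: commrMz; apply: commr1.
by rewrite [A * _]mulrA zC intrM -!mulrA.
Qed.

(** Both sides are the value of a at the composite of three points, bracketed in the two ways. *)
Lemma eval_coassoc x0 x1 x2 t0 t1 t2 a : x0 0%N = 1 -> x1 0%N = 1 -> x2 0%N = 1 ->
  \sum_(u <- psi p a) \sum_(v <- psi p u.2.1)
     (u.1 * v.1)%:~R * (ev x0 t0 v.2.1 * ev x1 t1 v.2.2 * ev x2 t2 u.2.2) =
  \sum_(u <- psi p a) \sum_(v <- psi p u.2.2)
     (u.1 * v.1)%:~R * (ev x0 t0 u.2.1 * ev x1 t1 v.2.1 * ev x2 t2 v.2.2).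
Proof.
move=> h0 h1 h2.
transitivity (ev (comp (comp x0 x1) x2) (compT (comp x0 x1) (compT x0 t0 t1) t2) a).
  rewrite -evT_psi ?comp0 //; apply: eq_bigr => u _.
  rewrite /ev2 -evT_psi // /evT mulr_suml mulr_sumr; apply: eq_bigr => v _.
  by rewrite intrM /ev2 -!mulrA.
rewrite (ev_eq a (compA x0 x1 x2) (compTA x0 x1 t0 t1 t2)).
rewrite -evT_psi ?comp0 //; apply: eq_bigr => u _.
rewrite /ev2 -evT_psi // /evT mulr_sumr mulr_sumr; apply: eq_bigr => v _.
by rewrite /ev2 intr_mul3.
Qed.

End Evaluation.

(** * Coassociativity *)

Section Exterior.
Local Open Scope ring_scope.
Variable R : comNzRingType.

(* The exterior algebra on [k] generators over [R] acts by matrices of size 2 ^ k: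
   a new generator e is put in front of the old ones, so that the coefficient of
   a monomial lies in the upper right block if e occurs in it and in the lower
   right block otherwise. *)
Fixpoint edim (k : nat) : nat := if k is k'.+1 then (edim k' + edim k')%N else 1%N.

Fixpoint eth (k : nat) : 'rV[R]_k -> 'M[R]_(edim k) :=
  match k with
  | 0 => fun _ => 0
  | k'.+1 => fun v =>
      let v' : 'rV[R]_(1 + k') := v in
      block_mx (- eth (rsubmx v')) ((lsubmx v' 0 0)%:M) 0 (eth (rsubmx v'))
  end.

Lemma eth_additive k : zmod_morphism (@eth k).
Proof.
elim: k => [|k IH] v w /=; first by rewrite subr0.
rewrite !linearB /= !mxE IH opp_block_mx add_block_mx.
by rewrite [(_ - _)%:M]raddfB opprD subr0.
Qed.

HB.instance Definition _ k := GRing.isZmodMorphism.Build _ _ (@eth k) (@eth_additive k).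

Lemma ethZ k a v : @eth k (a *: v) = a%:M *m eth v.
Proof.
elim: k a v => [|k IH] a v /=; first by rewrite mulmx0.
rewrite !linearZ /= !mxE IH !mul_scalar_mx scale_block_mx.
by rewrite scalerN scale_scalar_mx scaler0.
Qed.

(** The sign in the upper left block makes the new generator anticommute with the old ones: the
    diagonal blocks square to zero by induction, and the off-diagonal one is a commutator with a
    scalar matrix. *)
Lemma eth2 k v : @eth k v *m eth v = 0.
Proof.
elim: k v => [|k IH] v /=; first by rewrite mulmx0.
rewrite mulmx_block mulNmx mulmxN opprK IH mulmx0 !mul0mx mulmx0 !addr0.
by rewrite mulNmx scalar_mxC addNr block_mx0.
Qed.

Fixpoint eka (k : nat) : ('I_k -> bool) -> 'M[R]_(edim k) -> R :=
  match k with
  | 0 => fun _ M => M 0 0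
  | k'.+1 => fun s M =>
      if s ord0 then eka (fun j => s (lift ord0 j)) (ursubmx M)
      else eka (fun j => s (lift ord0 j)) (drsubmx M)
  end.

Lemma eka_additive k s : zmod_morphism (@eka k s).
Proof.
elim: k s => [|k IH] s M N /=; first by rewrite !mxE.
by case: (s ord0); rewrite -IH; congr eka; apply/matrixP => i j; rewrite !mxE.
Qed.

HB.instance Definition _ k s := GRing.isZmodMorphism.Build _ _ (@eka k s) (@eka_additive k s).

Lemma ekaZ k s a M : @eka k s (a%:M *m M) = a * eka s M.
Proof.
elim: k s M => [|k IH] s M /=; first by rewrite mul_scalar_mx mxE.
by case: (s ord0); rewrite -IH !mul_scalar_mx; congr eka; apply/matrixP => i j; rewrite !mxE.
Qed.

Definition eprod (k : nat) (s : 'I_k -> bool) : 'M[R]_(edim k) :=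
  \prod_(j < k | s j) eth (delta_mx 0 j).

Lemma eth_delta_lift k (j : 'I_k) :
  @eth k.+1 (delta_mx 0 (lift ord0 j)) =
  block_mx (- eth (delta_mx 0 j)) 0 0 (eth (delta_mx 0 j)).
Proof.
rewrite /=; have -> : rsubmx (delta_mx 0 (lift ord0 j) : 'rV[R]_(1 + k)) = delta_mx 0 j.
  by apply/rowP => i; rewrite !mxE.
have -> : lsubmx (delta_mx 0 (lift ord0 j) : 'rV[R]_(1 + k)) 0 0 = 0.
  by rewrite !mxE; case: eqP => // /(congr1 val).
by rewrite raddf0.
Qed.

Lemma eth_delta0 k : @eth k.+1 (delta_mx 0 ord0) = block_mx 0 1%:M 0 0.
Proof.
rewrite /=; have -> : rsubmx (delta_mx 0 ord0 : 'rV[R]_(1 + k)) = 0.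
  by apply/rowP => i; rewrite !mxE; case: eqP => // /(congr1 val).
have -> : lsubmx (delta_mx 0 ord0 : 'rV[R]_(1 + k)) 0 0 = 1.
  by rewrite !mxE.
by rewrite raddf0 oppr0.
Qed.

(** The block A stays unspecified because [eka] reads only the right-hand blocks. *)
Lemma eprod_block k (s : 'I_k -> bool) : exists A,
  \prod_(j < k | s j) @eth k.+1 (delta_mx 0 (lift ord0 j)) = block_mx A 0 0 (eprod s).
Proof.
rewrite /eprod; elim/big_rec2: _ => [|j y1 y2 _ [A ->]].
  by exists 1%:M; rewrite -scalar_mx_block.
exists (- eth (delta_mx 0 j) *m A); rewrite eth_delta_lift.
by rewrite [LHS]mulmx_block !mulmx0 !mul0mx !addr0 add0r.
Qed.

(** Linear independence of the exterior monomials, by exhibiting the dual functionals. *)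
Lemma eka_eprod k (s s' : 'I_k -> bool) : eka s (eprod s') = [forall j, s j == s' j]%:R.
Proof.
elim: k s s' => [|k IH] s s'.
  rewrite /eprod big_ord0 /= mxE eqxx; congr (_%:R).
  by symmetry; congr nat_of_bool; apply/forallP => -[].
have [A E] := eprod_block (fun j => s' (lift ord0 j)).
have -> : eprod s' = (if s' ord0 then eth (delta_mx 0 ord0) else 1) *
    block_mx A 0 0 (eprod (fun j => s' (lift ord0 j))).
  by rewrite /eprod big_mkcond big_ord_recl -big_mkcond -/edim E.
have -> : [forall j, s j == s' j] =
   (s ord0 == s' ord0) && [forall j, s (lift ord0 j) == s' (lift ord0 j)].
  apply/forallP/andP => [H|[H /forallP H'] j]; first by split=> //; apply/forallP => j.
  by case: (unliftP ord0 j) => [j' ->|->].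
case: (s' ord0).
  rewrite eth_delta0; have -> : block_mx 0 1%:M 0 0 * block_mx A 0 0 (eprod (fun j => s' (lift ord0 j)))
     = block_mx 0 (eprod (fun j => s' (lift ord0 j))) 0 0 :> 'M_(edim k + edim k).
    by rewrite [LHS]mulmx_block !mulmx0 !mul0mx mul1mx !addr0 add0r.
  rewrite /=; case: (s ord0); rewrite ?block_mxKur ?block_mxKdr ?IH //=.
  by rewrite raddf0.
rewrite mul1r /=; case: (s ord0); rewrite ?block_mxKur ?block_mxKdr ?IH //=.
by rewrite raddf0.
Qed.

End Exterior.

(** Only xi_1, ..., xi_B and tau_0, ..., tau_(B-1) occur. Confining the coproduct of one monomial to
    finitely many generators allows polynomial and exterior algebras in finitely many variables. *)
Definition bdM (B : nat) (m : Mono) : bool := (size m.1 <= B) && (size m.2 <= B).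

Lemma bdM_xiPow B k e : k <= B -> bdM B (xiPow k e).
Proof.
case: k => [|k] kB //; rewrite /bdM andbT.
have := size_trimN (rcons (nseq k 0) e); rewrite size_rcons size_nseq => h.
exact: leq_trans h kB.
Qed.

Lemma bdM_tauM B k : k < B -> bdM B (tauM k).
Proof. by rewrite /bdM /= size_rcons size_nseq. Qed.

Lemma bdM_prM B m m' : bdM B m -> bdM B m' -> bdM B (prM m m').
Proof.
move=> /andP[h1 h2] /andP[h3 h4]; have [h5 h6] := size_prM m m'.
by rewrite /bdM (leq_trans h5) ?geq_max ?h1 // (leq_trans h6) // geq_max h2.
Qed.

Lemma bdM_psiG p B g y : (match g with inl k => k < B | inr j => j < B end) ->
  y \in psiG p g -> bdM B y.2.1 && bdM B y.2.2.
Proof.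
case: g => k kB; first by case/psiXiP=> i ik -> /=; rewrite !bdM_xiPow //; lia.
case/psiTauP=> [->|[i ik ->]] /=; first by rewrite bdM_tauM.
by rewrite bdM_xiPow ?bdM_tauM //; lia.
Qed.

Lemma bdM_psi p B a x : bdM B a -> x \in psi p a -> bdM B x.2.1 && bdM B x.2.2.
Proof.
move=> /andP[a1 a2]; rewrite psiE.
have: all (fun g => match g with inl k => k < B | inr j => j < B end) (gens a).
  rewrite /gens all_cat; apply/andP; split; apply/allP => g.
    case/flattenP=> s /mapP[i]; rewrite mem_iota => /andP[_ h] -> /nseqP[-> _].
    by apply: leq_trans a1.
  case/mapP=> i; rewrite mem_filter mem_iota => /andP[_ /andP[_ h]] ->.
  by apply: leq_trans a2.
elim/last_ind: (gens a) x => [|G g IH] x.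
  by move=> _; rewrite inE => /eqP ->.
rewrite all_rcons psiL_rcons => /andP[hg /IH hG] /mem_mulL[y [z [/hG hy /(bdM_psiG hg) hz]]].
by case/mem_mulT => _ _ -> /=; case/andP: hy hz => ? ? /andP[? ?]; rewrite !bdM_prM.
Qed.

Lemma split_inl m n (j : 'I_m) : split (lshift n j) = inl j.
Proof. exact: (unsplitK (inl j)). Qed.
Lemma split_inr m n (j : 'I_n) : split (rshift m j) = inr j.
Proof. exact: (unsplitK (inr j)). Qed.

(** * Three generic points in disjoint blocks of variables *)

Section Triple.
Local Open Scope ring_scope.
Variable B : nat.
Let N := (B + (B + B))%N.

Definition inj0 : 'I_B -> 'I_N := @lshift B (B + B).
Definition inj1 (j : 'I_B) : 'I_N := rshift B (lshift B j).
Definition inj2 (j : 'I_B) : 'I_N := rshift B (rshift B j).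

Definition cat3 (T : Type) (f0 f1 f2 : nat -> T) (i : 'I_N) : T :=
  match split i with
  | inl j => f0 j
  | inr j => match split j with inl j => f1 j | inr j => f2 j end
  end.

Lemma cat3_0 T f0 f1 f2 j : @cat3 T f0 f1 f2 (inj0 j) = f0 j.
Proof. by rewrite /cat3 split_inl. Qed.
Lemma cat3_1 T f0 f1 f2 j : @cat3 T f0 f1 f2 (inj1 j) = f1 j.
Proof. by rewrite /cat3 split_inr split_inl. Qed.
Lemma cat3_2 T f0 f1 f2 j : @cat3 T f0 f1 f2 (inj2 j) = f2 j.
Proof. by rewrite /cat3 !split_inr. Qed.

Variables (R : comNzRingType) (L : pzRingType) (V : lmodType R).
Variables (io : {rmorphism R -> L}) (th : {additive V -> L}).
Hypothesis ioC : forall a z, io a * z = z * io a.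
Variables (X : 'I_N -> R) (e : 'I_N -> V).

(** The generic point with coordinates in the block s: xi_0 is 1, and coordinates beyond B are 0. *)
Definition ptx (s : 'I_B -> 'I_N) (k : nat) : R :=
  if k is k'.+1 then (if insub k' is Some i then X (s i) else 0) else 1.
Definition ptt (s : 'I_B -> 'I_N) (j : nat) : V :=
  if insub j is Some i then e (s i) else 0.

Notation EV s b := (ev io th (ptx s) (ptt s) b).

Lemma ev_pt s b : bdM B b ->
  EV s b = io (\prod_(i < B) X (s i) ^+ xe b i) * \prod_(j < B | tb b j) th (e (s j)).
Proof.
move=> /andP[h1 h2]; rewrite (@ev_wide _ _ _ _ _ B) //; congr (io _ * _).
  by apply: eq_bigr => i _; rewrite /ptx valK.
by rewrite /ext big_mkord; apply: eq_bigr => j _; rewrite /ptt valK.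
Qed.

Lemma io_mul3 (a b c : R) (P Q S : L) :
  io a * P * (io b * Q) * (io c * S) = io a * (io b * io c) * (P * (Q * S)).
Proof.
by rewrite -!mulrA; congr (_ * _); rewrite [P * (_ * _)]mulrA -ioC -!mulrA; congr (_ * _);
  rewrite [Q * (_ * _)]mulrA -ioC -mulrA [P * _]mulrA -ioC -!mulrA.
Qed.

Lemma ev_pt3 b0 b1 b2 : bdM B b0 -> bdM B b1 -> bdM B b2 ->
  EV inj0 b0 * EV inj1 b1 * EV inj2 b2 =
  io (\prod_(i < N) X i ^+ cat3 (xe b0) (xe b1) (xe b2) i) *
  \prod_(j < N | cat3 (tb b0) (tb b1) (tb b2) j) th (e j).
Proof.
move=> h0 h1 h2; rewrite !ev_pt // !big_split_ord /=.
have e0 (f : 'I_B -> L) : \prod_(j < B | cat3 (tb b0) (tb b1) (tb b2) (lshift (B + B) j)) f j =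
    \prod_(j < B | tb b0 j) f j by apply: eq_bigl => j; rewrite cat3_0.
have e1 (f : 'I_B -> L) : \prod_(j < B | cat3 (tb b0) (tb b1) (tb b2) (rshift B (lshift B j))) f j =
    \prod_(j < B | tb b1 j) f j by apply: eq_bigl => j; rewrite cat3_1.
have e2 (f : 'I_B -> L) : \prod_(j < B | cat3 (tb b0) (tb b1) (tb b2) (rshift B (rshift B j))) f j =
    \prod_(j < B | tb b2 j) f j by apply: eq_bigl => j; rewrite cat3_2.
rewrite e0 e1 e2 !rmorphM.
have x0 : \prod_(j < B) X (lshift (B + B) j) ^+ cat3 (xe b0) (xe b1) (xe b2) (lshift (B + B) j) =
  \prod_(j < B) X (inj0 j) ^+ xe b0 j by apply: eq_bigr => j _; rewrite cat3_0.
have x1 : \prod_(j < B) X (rshift B (lshift B j)) ^+ cat3 (xe b0) (xe b1) (xe b2) (rshift B (lshift B j)) =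
  \prod_(j < B) X (inj1 j) ^+ xe b1 j by apply: eq_bigr => j _; rewrite cat3_1.
have x2 : \prod_(j < B) X (rshift B (rshift B j)) ^+ cat3 (xe b0) (xe b1) (xe b2) (rshift B (rshift B j)) =
  \prod_(j < B) X (inj2 j) ^+ xe b2 j by apply: eq_bigr => j _; rewrite cat3_2.
by rewrite x0 x1 x2 io_mul3.
Qed.

End Triple.

Section Coassoc.
Local Open Scope ring_scope.
Variable p : nat.
Hypothesis p_pr : prime p.

Lemma forall_cat3 B (T : eqType) (f0 f1 f2 g0 g1 g2 : nat -> T) :
  (forall i : 'I_(B + (B + B)), cat3 f0 f1 f2 i = cat3 g0 g1 g2 i) ->
  forall j, (j < B)%N -> [/\ f0 j = g0 j, f1 j = g1 j & f2 j = g2 j].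
Proof.
move=> H j jB; pose j' := Ordinal jB.
have := H (inj0 j'); rewrite !cat3_0 => h0.
have := H (inj1 j'); rewrite !cat3_1 => h1.
by have := H (inj2 j'); rewrite !cat3_2 => h2.
Qed.

Section Functional.
Variables (B : nat) (c0 c1 c2 : Mono).
Let N := (B + (B + B))%N.
Let R : comNzRingType := {mpoly 'F_p[N]}.

(** Coefficient of the monomial encoding c0 (x) c1 (x) c2, taken first in the odd and then in the
    even variables. *)
Definition kap (z : 'M[R]_(edim N)) : 'F_p :=
  (eka (cat3 (tb c0) (tb c1) (tb c2)) z)@_[multinom cat3 (xe c0) (xe c1) (xe c2) i | i < N].

Lemma kap_additive : zmod_morphism kap.
Proof. by move=> y z; rewrite /kap raddfB mcoeffB. Qed.

HB.instance Definition _ := GRing.isZmodMorphism.Build _ _ kap kap_additive.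

Definition Xvar (i : 'I_N) : R := 'X_i.
Definition Evar (i : 'I_N) : 'rV[R]_N := delta_mx 0 i.
Definition mio : {rmorphism R -> 'M[R]_(edim N)} := @scalar_mx R (edim N).

Lemma mioC a (z : 'M[R]_(edim N)) : mio a * z = z * mio a.
Proof. exact: esym (scalar_mxC a z). Qed.

Lemma kap_monomial (f : 'I_N -> nat) (s : 'I_N -> bool) :
  kap (mio (\prod_(i < N) Xvar i ^+ f i) * \prod_(j < N | s j) eth (Evar j)) =
  ([forall i, cat3 (xe c0) (xe c1) (xe c2) i == f i] &&
   [forall i, cat3 (tb c0) (tb c1) (tb c2) i == s i])%:R.
Proof.
rewrite /kap ekaZ -/(eprod R s) eka_eprod.
have -> : \prod_(i < N) Xvar i ^+ f i = 'X_[[multinom f i | i < N]].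
  by rewrite mpolyXE_id; apply: eq_bigr => i _; rewrite mnmE.
case: [forall i, _ == s i]; rewrite ?mulr0 ?mcoeff0 ?andbF // mulr1 andbT mcoeffX.
congr ((nat_of_bool _)%:R); apply/eqP/forallP => [E i|H].
  by move/mnmP: E => /(_ i); rewrite !mnmE => ->.
by apply/mnmP => i; rewrite !mnmE; apply/eqP; rewrite eq_sym.
Qed.

Notation EV s b := (ev mio (@eth R N) (ptx Xvar s) (ptt Evar s) b).

Lemma kap_ev b0 b1 b2 : canon c0 -> canon c1 -> canon c2 -> canon b0 -> canon b1 -> canon b2 ->
  bdM B c0 -> bdM B c1 -> bdM B c2 -> bdM B b0 -> bdM B b1 -> bdM B b2 ->
  kap (EV (@inj0 B) b0 * EV (@inj1 B) b1 * EV (@inj2 B) b2) =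
  ((b0 == c0) && (b1 == c1) && (b2 == c2))%:R.
Proof.
move=> cc0 cc1 cc2 cb0 cb1 cb2 hc0 hc1 hc2 hb0 hb1 hb2.
rewrite ev_pt3 //; last exact: mioC.
rewrite kap_monomial; congr ((nat_of_bool _)%:R).
apply/andP/andP => [[/forallP h1 /forallP h2]|[/andP[/eqP-> /eqP->] /eqP->]]; last first.
  by split; apply/forallP.
have h1' := @forall_cat3 B _ _ _ _ _ _ _ (fun i => eqP (h1 i)).
have h2' := @forall_cat3 B _ _ _ _ _ _ _ (fun i => eqP (h2 i)).
have ex (b c : Mono) : canon b -> canon c -> bdM B b -> bdM B c ->
    (forall j, (j < B)%N -> xe c j = xe b j) -> (forall j, (j < B)%N -> tb c j = tb b j) -> b == c.
  move=> cb cc /andP[b1' b2'] /andP[c1' c2'] hx ht; apply/eqP/canon_ext => // j.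
    case: (ltnP j B) => jB; first by rewrite hx.
    by rewrite !xe_size //; [apply: leq_trans jB | apply: leq_trans jB].
  case: (ltnP j B) => jB; first by rewrite ht.
  by rewrite !tb_size //; [apply: leq_trans jB | apply: leq_trans jB].
split; first (apply/andP; split); apply: ex => // j jB.
all: try by case: (h1' j jB).
all: by case: (h2' j jB).
Qed.

End Functional.
Lemma intr_coefPsi a b c : (coefPsi p a b c)%:~R =
  \sum_(x <- psi p a | x.2 == (b, c)) x.1%:~R :> 'F_p.
Proof. exact: rmorph_sum. Qed.

(** A functional dual to the triple (c0, c1, c2) turns the evaluated identity into one between
    coefficients. *)
Lemma coassoc_of_functional (L : pzRingType) (k : {additive L -> 'F_p})
    (E : Mono -> Mono -> Mono -> L) a c0 c1 c2 :
  \sum_(u <- psi p a) \sum_(v <- psi p u.2.1) (u.1 * v.1)%:~R * E v.2.1 v.2.2 u.2.2 =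
  \sum_(u <- psi p a) \sum_(v <- psi p u.2.2) (u.1 * v.1)%:~R * E u.2.1 v.2.1 v.2.2 ->
  (forall u v, u \in psi p a -> v \in psi p u.2.1 ->
     k (E v.2.1 v.2.2 u.2.2) = ((v.2.1 == c0) && (v.2.2 == c1) && (u.2.2 == c2))%:R) ->
  (forall u v, u \in psi p a -> v \in psi p u.2.2 ->
     k (E u.2.1 v.2.1 v.2.2) = ((u.2.1 == c0) && (v.2.1 == c1) && (v.2.2 == c2))%:R) ->
  \sum_(u <- psi p a | u.2.2 == c2) u.1%:~R * (coefPsi p u.2.1 c0 c1)%:~R =
  \sum_(u <- psi p a | u.2.1 == c0) u.1%:~R * (coefPsi p u.2.2 c1 c2)%:~R :> 'F_p.
Proof.
move=> /(congr1 k) H h1 h2.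
have kE (c : int) z : k (c%:~R * z) = c%:~R * k z by rewrite mulrzl raddfMz -mulrzl.
transitivity (\sum_(u <- psi p a) \sum_(v <- psi p u.2.1)
    (u.1 * v.1)%:~R * ((v.2.1 == c0) && (v.2.2 == c1) && (u.2.2 == c2))%:R : 'F_p).
  rewrite big_mkcond; apply: eq_bigr => u _; case: eqP => _; last first.
    by rewrite big1 // => v _; rewrite andbF mulr0.
  rewrite intr_coefPsi big_distrr big_mkcond /=; apply: eq_bigr => -[v1 [v2 v3]] _ /=.
  rewrite andbT xpair_eqE; case: ifP => _; rewrite ?mulr0 //.
  by rewrite mulr1 intrM.
transitivity (\sum_(u <- psi p a) \sum_(v <- psi p u.2.2)
    (u.1 * v.1)%:~R * ((u.2.1 == c0) && (v.2.1 == c1) && (v.2.2 == c2))%:R : 'F_p); last first.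
  rewrite [RHS]big_mkcond; apply: eq_bigr => u _; case: eqP => _; last first.
    by rewrite big1 // => v _; rewrite mulr0.
  rewrite intr_coefPsi big_distrr [RHS]big_mkcond /=; apply: eq_bigr => -[v1 [v2 v3]] _ /=.
  rewrite xpair_eqE; case: ifP => _; rewrite ?mulr0 //.
  by rewrite mulr1 intrM.
move: H; rewrite !raddf_sum => H.
transitivity (\sum_(u <- psi p a) k (\sum_(v <- psi p u.2.1) (u.1 * v.1)%:~R * E v.2.1 v.2.2 u.2.2)).
  rewrite big_seq [RHS]big_seq; apply: eq_bigr => u hu.
  rewrite raddf_sum big_seq [RHS]big_seq; apply: eq_bigr => v hv.
  by rewrite kE h1.
rewrite H big_seq [RHS]big_seq; apply: eq_bigr => u hu.
rewrite raddf_sum big_seq [RHS]big_seq; apply: eq_bigr => v hv.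
by rewrite kE h2.
Qed.

Lemma coassocF a c0 c1 c2 : canon c0 -> canon c1 -> canon c2 ->
  \sum_(u <- psi p a | u.2.2 == c2) u.1%:~R * (coefPsi p u.2.1 c0 c1)%:~R =
  \sum_(u <- psi p a | u.2.1 == c0) u.1%:~R * (coefPsi p u.2.2 c1 c2)%:~R :> 'F_p.
Proof.
move=> cc0 cc1 cc2.
pose sz (m : Mono) := maxn (size m.1) (size m.2).
pose B := maxn (maxn (sz a) (sz c0)) (maxn (sz c1) (sz c2)).
have [ba b0 b1 b2] : [/\ bdM B a, bdM B c0, bdM B c1 & bdM B c2].
  by split; apply/andP; split; rewrite /B /sz; lia.
clearbody B; pose N := (B + (B + B))%N; pose R : comNzRingType := {mpoly 'F_p[N]}.
have pR : p \in [pchar R] by apply: (rmorph_pchar (@mpolyC N 'F_p)); apply: pchar_Fp.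
have hu u : u \in psi p a -> [/\ canon u.2.1, canon u.2.2, bdM B u.2.1 & bdM B u.2.2].
  by move=> hu; have /andP[? ?] := psi_canon hu; have /andP[? ?] := bdM_psi ba hu.
pose EV i b := ev (mio B) (@eth R N) (ptx (@Xvar B) i) (ptt (@Evar B) i) b.
apply: (coassoc_of_functional (k := @kap B c0 c1 c2)
  (E := fun b0 b1 b2 => EV (@inj0 B) b0 * EV (@inj1 B) b1 * EV (@inj2 B) b2)
  (@eval_coassoc R _ _ (mio B) (@eth R N) (@mioC B) (@ethZ R N) (@eth2 R N) p pR
  (ptx (@Xvar B) (@inj0 B)) (ptx (@Xvar B) (@inj1 B)) (ptx (@Xvar B) (@inj2 B))
  (ptt (@Evar B) (@inj0 B)) (ptt (@Evar B) (@inj1 B)) (ptt (@Evar B) (@inj2 B)) a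
  erefl erefl erefl)).
  move=> u v /hu[? ? b3 b4] hv.
  have /andP[? ?] := psi_canon hv; have /andP[? ?] := bdM_psi b3 hv.
  exact: kap_ev.
move=> u v /hu[? ? b3 b4] hv.
have /andP[? ?] := psi_canon hv; have /andP[? ?] := bdM_psi b4 hv.
exact: kap_ev.
Qed.

(** The form in which the differential meets coassociativity, as a sum over the intermediate
    monomial; the degree bound on a puts all intermediate monomials in the enumeration. *)
Lemma coassoc_monos t a c0 c1 c2 : canon a -> (degM p a <= t)%N ->
  canon c0 -> canon c1 -> canon c2 ->
  \sum_(e <- monos t.+1) (coefPsi p a e c2)%:~R * (coefPsi p e c0 c1)%:~R =
  \sum_(e <- monos t.+1) (coefPsi p a c0 e)%:~R * (coefPsi p e c1 c2)%:~R :> 'F_p.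
Proof.
move=> ca da cc0 cc1 cc2; have := coassocF a cc0 cc1 cc2.
have mem u : u \in psi p a -> (u.2.1 \in monos t.+1) && (u.2.2 \in monos t.+1).
  move=> hu; have /andP[c3 c4] := psi_canon hu.
  by have := psi_deg_mem (prime_gt1 p_pr) hu => d; rewrite !(@mem_monos p) ?prime_gt1 //; lia.
have L : \sum_(u <- psi p a | u.2.2 == c2) u.1%:~R * (coefPsi p u.2.1 c0 c1)%:~R =
   \sum_(e <- monos t.+1) (coefPsi p a e c2)%:~R * (coefPsi p e c0 c1)%:~R :> 'F_p.
  rewrite [RHS](eq_bigr (fun e => \sum_(u <- psi p a | u.2 == (e, c2))
      u.1%:~R * (coefPsi p e c0 c1)%:~R : 'F_p)); last first.
    by move=> e _; rewrite intr_coefPsi big_distrl.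
  rewrite (exchange_big_dep (fun u => u.2.2 == c2)) /=; last first.
    by move=> e [u1 [u2 u3]] _ /=; rewrite xpair_eqE => /andP[].
  rewrite big_seq_cond [RHS]big_seq_cond; apply: eq_bigr => u /andP[hu /eqP uc].
  have /andP[m1 _] := mem _ hu.
  rewrite [RHS]big_mkcond (bigD1_seq u.2.1) ?undup_uniq //= -uc -surjective_pairing eqxx.
  rewrite big1 ?addr0 // => e ne; case: eqP => // E.
  by rewrite E eqxx in ne.
have L' : \sum_(u <- psi p a | u.2.1 == c0) u.1%:~R * (coefPsi p u.2.2 c1 c2)%:~R =
   \sum_(e <- monos t.+1) (coefPsi p a c0 e)%:~R * (coefPsi p e c1 c2)%:~R :> 'F_p.
  rewrite [RHS](eq_bigr (fun e => \sum_(u <- psi p a | u.2 == (c0, e))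
      u.1%:~R * (coefPsi p e c1 c2)%:~R : 'F_p)); last first.
    by move=> e _; rewrite intr_coefPsi big_distrl.
  rewrite (exchange_big_dep (fun u => u.2.1 == c0)) /=; last first.
    by move=> e [u1 [u2 u3]] _ /=; rewrite xpair_eqE => /andP[].
  rewrite big_seq_cond [RHS]big_seq_cond; apply: eq_bigr => u /andP[hu /eqP uc].
  have /andP[_ m1] := mem _ hu.
  rewrite [RHS]big_mkcond (bigD1_seq u.2.2) ?undup_uniq //= -uc -surjective_pairing eqxx.
  rewrite big1 ?addr0 // => e ne; case: eqP => // E.
  by rewrite E eqxx in ne.
by rewrite L L'.
Qed.

End Coassoc.

(** * The cobar differential squares to zero *)

Definition ins (T : Type) (i : nat) (a : T) (y : seq T) : seq T := take i y ++ a :: drop i.+2 y.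

Lemma size_ins T i (a : T) y : i.+1 < size y -> size (ins i a y) = (size y).-1.
Proof. by move=> h; rewrite size_cat /= size_drop size_takel; lia. Qed.

Lemma nth_ins (T : Type) (x0 : T) i a y k : i.+1 < size y ->
  nth x0 (ins i a y) k = if k < i then nth x0 y k else if k == i then a else nth x0 y k.+1.
Proof.
move=> h; rewrite nth_cat size_takel; last lia.
case: ltngtP => ki; first by rewrite nth_take.
  have -> : k - i = (k - i.+1).+1 by lia.
  by rewrite /= nth_drop; congr nth; lia.
by rewrite ki subnn.
Qed.

Lemma ins_ins_far (T : Type) (i j : nat) (a b : T) y : i < j -> j.+2 < size y ->
  ins j b (ins i a y) = ins i a (ins j.+1 b y).
Proof.
move=> ij jy; have s1 : size (ins i a y) = (size y).-1 by rewrite size_ins //; lia.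
have s2 : size (ins j.+1 b y) = (size y).-1 by rewrite size_ins.
apply: (@eq_from_nth _ a) => [|k _]; first by rewrite !size_ins //; lia.
rewrite !nth_ins; try lia.
by do !case: ifP => //; lia.
Qed.

(** The second merge overwrites the entry created by the first, so a and a' leave no trace. *)
Lemma ins_ins_near (T : Type) (i : nat) (a a' b : T) y : i.+2 < size y ->
  ins i b (ins i a y) = ins i b (ins i.+1 a' y).
Proof.
move=> jy; have s1 : size (ins i a y) = (size y).-1 by rewrite size_ins //; lia.
have s2 : size (ins i.+1 a' y) = (size y).-1 by rewrite size_ins.
apply: (@eq_from_nth _ a) => [|k _]; first by rewrite !size_ins //; lia.
rewrite !nth_ins; try lia.
by do !case: ifP => //; lia.
Qed.

Lemma mem_ins (T : eqType) i (a : T) y : a \in ins i a y.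
Proof. by rewrite mem_cat mem_head orbT. Qed.

Lemma perm_ins (T : eqType) (x0 a : T) i y : i.+1 < size y ->
  perm_eq (nth x0 y i :: nth x0 y i.+1 :: ins i a y) (a :: y).
Proof.
move=> h; have E : y = take i y ++ nth x0 y i :: nth x0 y i.+1 :: drop i.+2 y.
  by rewrite -drop_nth // -drop_nth ?cat_take_drop //; apply: ltnW.
rewrite [X in perm_eq _ (_ :: X)]E /ins; apply/permP => q; rewrite /= !count_cat /=; lia.
Qed.

(** The usual cancellation for alternating face maps: (i, j) with i <= j is paired with (j+1, i). *)
Lemma signed_sum_cancel (V : zmodType) (n : nat) (F : nat -> nat -> V) :
  (forall i j, i <= j -> j < n -> F i j = (- F j.+1 i)%R) ->
  (\sum_(i < n.+1) \sum_(j < n) F i j = 0)%R.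
Proof.
move=> H.
rewrite (eq_bigr (fun i : 'I_n.+1 => \sum_(j < n | (i <= j)%N) F i j + \sum_(j < n | ~~ (i <= j)%N) F i j)%R);
  last by move=> i _; rewrite [LHS](bigID (fun j : 'I_n => (i <= j)%N)).
rewrite big_split /= big_ord_recr /= [X in (_ + X + _)%R]big_pred0 ?addr0; last first.
  by move=> j; have := ltn_ord j; lia.
rewrite [X in (_ + X)%R]big_ord_recl /= [X in (_ + (X + _))%R]big_pred0 ?add0r //.
rewrite [X in (_ + X)%R](exchange_big_dep xpredT) //= -big_split big1 // => i _ /=.
rewrite [X in (_ + X)%R](eq_bigl (fun j : 'I_n => (i <= j)%N)); last first.
  by move=> j; rewrite /bump /=; lia.
rewrite -big_split big1 // => j ij.
by rewrite /= /bump leq0n add1n (H i j) // addNr.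
Qed.

Section DSquare.
Local Open Scope ring_scope.
Variables (p t : nat).
Hypothesis p_pr : prime p.
Let p1 : (1 < p)%N := prime_gt1 p_pr.
Notation F := 'F_p.
Notation cf a b c := ((coefPsi p a b c)%:~R : F).

Lemma goodP m : good m -> canon m /\ (0 < degM p m)%N.
Proof.
move=> /andP[cm /eqP nu]; split=> //; rewrite lt0n; apply/eqP => d0.
by case: nu; apply: deg0_unitM p1 cm d0.
Qed.

Lemma degM_unitM : degM p unitM = 0%N.
Proof. by rewrite degM_stat stat_unitM. Qed.

Lemma ins_basis s (y : seq Mono) i (a : Mono) : y \in cobarBasis p t s.+1 -> (i < s)%N -> canon a ->
  cf a (nth unitM y i) (nth unitM y i.+1) != 0 -> ins i a y \in cobarBasis p t s.
Proof.
rewrite !cobarBasisP // => /and3P[/eqP sy gy /eqP dy] is_ ca nz.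
have iy : (i.+1 < size y)%N by rewrite sy.
have : coefPsi p a (nth unitM y i) (nth unitM y i.+1) != 0.
  by apply: contraNneq nz => ->.
move/(psi_deg p1) => da.
have [_ d1] := goodP (allP gy _ (mem_nth unitM (ltnW iy))).
have hp := perm_ins unitM a iy.
apply/and3P; split; first by rewrite size_ins // sy.
  apply/allP => m; rewrite mem_cat inE => /or3P[/mem_take|/eqP->|/mem_drop]; try exact: (allP gy).
  by rewrite /good ca; apply/eqP => E; move: d1 da; rewrite E degM_unitM; case: (degM p _).
by have := perm_sumn (perm_map (degM p) hp); rewrite /= dy addnA da => /addnI ->.
Qed.

(** [dcob] can be nonzero off the basis, for instance on words with a unit entry; the restriction
    makes it a cochain. *)
Definition rcob (s : nat) (g : seq Mono -> F) (x : seq Mono) : F :=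
  if x \in cobarBasis p t s.+1 then dcob p t s g x else 0.

Lemma dcob_rcob s g (y : seq Mono) : cochain p t s g -> y \in cobarBasis p t s.+2 ->
  dcob p t s.+1 (rcob s g) y = 0.
Proof.
move=> cg hy; have := hy; rewrite cobarBasisP // => /and3P[/eqP sy gy _].
pose z i (a : Mono) : seq Mono := ins i a y.
pose T i j := \sum_(a <- monos t.+1) \sum_(b <- monos t.+1)
  cf a (nth unitM y i) (nth unitM y i.+1) *
  (g (ins j b (z i a)) * cf b (nth unitM (z i a) j) (nth unitM (z i a) j.+1)).
transitivity (\sum_(i < s.+1) \sum_(j < s) (-1) ^+ i.+1 * ((-1) ^+ j.+1 * T i j) : F).
  apply: eq_bigr => i _; rewrite -mulr_sumr; congr (_ * _).
  under [RHS]eq_bigr do rewrite /T mulr_sumr.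
  rewrite exchange_big /= big_seq [RHS]big_seq; apply: eq_bigr => a /monos_canon ca.
  have [E|nz] := eqVneq (cf a (nth unitM y i) (nth unitM y i.+1)) 0.
    rewrite E mulr0 big1 // => j _; rewrite big1 ?mulr0 // => b _; rewrite mul0r //.
  rewrite /rcob -/(ins i a y) (ins_basis hy (ltn_ord i) ca nz) /dcob mulr_suml.
  apply: eq_bigr => j _; rewrite -mulrA; congr (_ * _); rewrite mulr_suml.
  by apply: eq_bigr => b _; rewrite mulrC.
apply: (@signed_sum_cancel _ s (fun i j => (-1) ^+ i.+1 * ((-1) ^+ j.+1 * T i j))) => i j ij js.
suff -> : T i j = T j.+1 i.
  by rewrite !mulrA -!exprD -mulNr; congr (_ * _); rewrite [(j.+2 + _)%N]addSn exprS addnC mulNr mul1r opprK.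
(* Overlapping merges (i = j) agree by coassociativity, distant ones commute. *)
rewrite /T; move: ij; rewrite leq_eqVlt => /orP[/eqP E|ij].
  subst j.
  have iy : (i.+2 < size y)%N by rewrite sy; lia.
  have Ez a : nth unitM (z i a) i = a by rewrite nth_ins ?ltnn ?eqxx //; lia.
  have Ez1 a : nth unitM (z i a) i.+1 = nth unitM y i.+2.
    by rewrite nth_ins; last lia; rewrite ltnNge leqnSn /= -[X in _ == X]addn0 -addn1 eqn_add2l.
  have Ez' a : nth unitM (z i.+1 a) i = nth unitM y i.
    by rewrite nth_ins ?ltnSn.
  have Ez1' a : nth unitM (z i.+1 a) i.+1 = a by rewrite nth_ins ?ltnn ?eqxx.
  rewrite exchange_big [RHS]exchange_big /= big_seq [RHS]big_seq; apply: eq_bigr => b hb.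
  (* If g is nonzero on the doubly merged word, its support bounds the degree of b, as
     coassociativity requires. *)
  have [Eg|gnz] := eqVneq (g (ins i b (ins i unitM y))) 0.
    have Eg' a : g (ins i b (z i.+1 a)) = 0 by rewrite -(ins_ins_near unitM).
    have Eg'' a : g (ins i b (z i a)) = 0 by rewrite (ins_ins_near _ unitM) // -(ins_ins_near unitM).
    by rewrite !big1 // => a _; rewrite ?Eg' ?Eg'' mul0r mulr0.
  have /cg := gnz; rewrite cobarBasisP // => /and3P[_ gw /eqP dw].
  have db : (degM p b <= t)%N.
    have hb2 := mem_ins i b (ins i unitM y).
    rewrite -dw sumnE big_map (perm_big _ (perm_to_rem hb2)) big_cons /=; lia.
  have cy k : (k < s.+2)%N -> canon (nth unitM y k).
    by move=> ks; have [] := goodP (allP gy _ (mem_nth unitM (etrans (congr1 (leq k.+1) sy) ks))).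
  have A := coassoc_monos p_pr (monos_canon hb) db (cy i _) (cy i.+1 _) (cy i.+2 _).
  transitivity (g (ins i b (ins i unitM y)) *
     \sum_(a <- monos t.+1) cf b a (nth unitM y i.+2) * cf a (nth unitM y i) (nth unitM y i.+1)).
    rewrite mulr_sumr; apply: eq_bigr => a _; rewrite Ez Ez1 /z.
    by rewrite (ins_ins_near a unitM) // (ins_ins_near unitM unitM) // mulrCA; congr (_ * _); rewrite mulrC.
  rewrite A; try lia.
  rewrite mulr_sumr; apply: eq_bigr => a _; rewrite Ez' Ez1' /z.
  by rewrite (ins_ins_near unitM a) // [LHS]mulrA [RHS]mulrC.
rewrite exchange_big; apply: eq_bigr => b _; apply: eq_bigr => a _.
have jy : (j.+2 < size y)%N by rewrite sy; lia.
rewrite /z (ins_ins_far _ _ ij jy) mulrCA [RHS]mulrCA; congr (_ * _).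
have h1 : nth unitM (ins i a y) j = nth unitM y j.+1 by rewrite nth_ins; [do !case: ifP => //; lia | lia].
have h2 : nth unitM (ins i a y) j.+1 = nth unitM y j.+2 by rewrite nth_ins; [do !case: ifP => //; lia | lia].
have h3 : nth unitM (ins j.+1 b y) i = nth unitM y i by rewrite nth_ins; [do !case: ifP => //; lia | lia].
have h4 : nth unitM (ins j.+1 b y) i.+1 = nth unitM y i.+1 by rewrite nth_ins; [do !case: ifP => //; lia | lia].
by rewrite h1 h2 h3 h4 mulrC.
Qed.

End DSquare.

(** * Digits of exponents *)

Section Digits.
Variable p : nat.
Hypothesis p_pr : prime p.
Let p1 : 1 < p := prime_gt1 p_pr.
Let p0 : 0 < p := prime_gt0 p_pr.

Definition dg (n j : nat) : nat := (n %/ p ^ j) %% p.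

Lemma dg_lt n j : dg n j < p.
Proof. exact: ltn_pmod. Qed.

Lemma dg_big n j : n <= j -> dg n j = 0.
Proof. by move=> nj; rewrite /dg divn_small ?mod0n // (leq_trans (ltn_expl n p1)) // leq_exp2l. Qed.

Lemma divn_expS n j : n %/ p ^ j.+1 = n %/ p ^ j %/ p.
Proof. by rewrite expnSr divnMA. Qed.

Lemma dg_inj n n' : (forall j, dg n j = dg n' j) -> n = n'.
Proof.
elim/ltn_ind: n n' => n IH n' H.
have h0 := H 0; rewrite /dg !expn0 !divn1 in h0.
have hS j : dg (n %/ p) j = dg (n' %/ p) j.
  by have := H j.+1; rewrite /dg !expnS !divnMA.
case: (posnP n) => [n0|n_gt0]; last first.
  by rewrite (divn_eq n p) (divn_eq n' p) h0 (IH _ _ _ hS) // ltn_Pdiv.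
have E : n' = 0; last by rewrite n0 E.
have z j : dg n' j = 0 by rewrite -H n0 /dg div0n mod0n.
clear -z p1; elim/ltn_ind: n' z => n' IH z; case: (posnP n') => // n_gt0.
have := IH (n' %/ p) (ltn_Pdiv p1 n_gt0) => /(_ _)/wrap[].
  by move=> j; have := z j.+1; rewrite /dg !expnS !divnMA.
by move=> E; have := z 0; rewrite /dg expn0 divn1; have := divn_eq n' p; rewrite E; lia.
Qed.

(** Adding b and c in base p involves no carry. *)
Definition nocarry b c := forall j, (b + c) %/ p ^ j = b %/ p ^ j + c %/ p ^ j.

Lemma nocarryP b c : nocarry b c <-> forall j, dg (b + c) j = dg b j + dg c j.
Proof.
split=> H j.
  rewrite /dg H; have := H j.+1; rewrite !divn_expS H divnD //.
  case: leqP; rewrite ?addn1 => h E; first lia.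
  by rewrite -modnDm modn_small.
elim: j => [|j IH]; first by rewrite !expn0 !divn1.
rewrite !divn_expS IH divnD //; have := H j; rewrite /dg IH => E.
have := ltn_pmod (b %/ p ^ j + c %/ p ^ j) p0; rewrite E => lt.
by rewrite leqNgt lt addn0.
Qed.

Lemma nocarry_lt b c : (forall j, dg b j + dg c j < p) -> nocarry b c.
Proof.
move=> H; elim=> [|j IH]; first by rewrite !expn0 !divn1.
by rewrite !divn_expS IH divnD // leqNgt H addn0.
Qed.

Lemma logn_fact_wide N n : n <= N -> logn p n`! = \sum_(1 <= k < N.+1) n %/ p ^ k.
Proof.
move=> nN; rewrite logn_fact // [RHS](big_cat_nat (n := n.+1)) //=.
rewrite [X in _ = _ + X]big_nat [X in _ = _ + X]big1 ?addn0 // => k /andP[nk _].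
by rewrite divn_small // (ltn_trans nk) // ltn_expl.
Qed.

Lemma sum_eq_pointwise (s : seq nat) (A C : nat -> nat) : (forall k, C k <= A k) ->
  \sum_(k <- s) A k = \sum_(k <- s) C k -> forall k, k \in s -> A k = C k.
Proof.
move=> le; elim: s => [|x s IH] //; rewrite !big_cons => E k.
have h1 := le x; have h2 : \sum_(j <- s) C j <= \sum_(j <- s) A j by apply: leq_sum.
by rewrite inE => /orP[/eqP->|]; [lia | apply: IH; lia].
Qed.

(** Kummer's theorem: by Legendre's formula the valuation is the sum over k of floor((b+c)/p^k) -
    floor(b/p^k) - floor(c/p^k), and every term is nonnegative. *)
Lemma binomial_nocarry b c : ~~ (p %| 'C(b + c, b)) <-> nocarry b c.
Proof.
have C0 : 0 < 'C(b + c, b) by rewrite bin_gt0 leq_addr.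
have := congr1 (logn p) (bin_fact (leq_addr c b)).
rewrite addKn !lognM ?muln_gt0 ?fact_gt0 // !(@logn_fact_wide (b + c)) ?leq_addl ?leq_addr //.
rewrite -big_split /=.
set A := \sum_(1 <= k < _) (b + c) %/ _; set D := \sum_(1 <= k < _) _ => E.
have le k : b %/ p ^ k + c %/ p ^ k <= (b + c) %/ p ^ k.
  by rewrite divnD ?leq_addr // expn_gt0 p0.
have -> : ~~ (p %| 'C(b + c, b)) = (logn p 'C(b + c, b) == 0).
  by rewrite -leqn0 leqNgt logn_gt0 mem_primes p_pr C0.
split=> [/eqP L|H]; last first.
  have AD : A = D by apply: eq_bigr => k _; rewrite H.
  by apply/eqP; move: E; rewrite AD; lia.
move=> j; case: j => [|j]; first by rewrite !expn0 !divn1.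
case: (ltnP j (b + c)) => jn.
  apply: (sum_eq_pointwise le (s := index_iota 1 (b + c).+1)); first by rewrite -/A -E L.
  by rewrite mem_index_iota.
have e k : k <= b + c -> k %/ p ^ j.+1 = 0.
  by move=> kn; rewrite divn_small // (leq_ltn_trans kn) // (leq_ltn_trans jn) // (ltn_trans (ltnSn j)) // ltn_expl.
by rewrite !e ?leq_addl ?leq_addr.
Qed.


(** * Letters: base-p digits of the exponents *)

Definition letter : Type := (nat * nat)%type.

(* (0, j) stands for tau_j and (k.+1, j) for xi_{k+1}^(p^j). *)
Definition dig (m : Mono) (l : letter) : nat :=
  match l with (0, j) => tb m j | (k.+1, j) => dg (xe m k) j end.
Definition cap (l : letter) : nat := if l.1 is 0 then 2 else p.

Lemma dig_lt m l : dig m l < cap l.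
Proof. by case: l => -[|k] j /=; [case: tb | exact: dg_lt]. Qed.

Definition letters (m : Mono) : seq letter :=
  [seq (k, j) | k <- iota 0 (size m.1).+1, j <- iota 0 (size m.2 + \sum_(i < size m.1) xe m i)].

Lemma dig_letters m l : 0 < dig m l -> l \in letters m.
Proof.
case: l => k j H; apply/allpairsP; exists (k, j); split=> //; rewrite mem_iota //=.
  case: k H => // k; apply: contraTT; rewrite -leqNgt add0n ltnS => h.
  by rewrite /= xe_size // /dg div0n mod0n.
case: k H => [|k] /= H.
  have : j < size m.2 by move: H; case: (ltnP j (size m.2)) => // h; rewrite tb_size.
  by move=> h; rewrite (leq_trans h) // leq_addr.
have km : k < size m.1.
  by move: H; case: (ltnP k (size m.1)) => // h; rewrite xe_size // /dg div0n mod0n.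
rewrite (bigD1 (Ordinal km)) //=.
have : j < xe m k by move: H; case: (ltnP j (xe m k)) => // h; rewrite dg_big.
lia.
Qed.

Definition raw (m : Mono) : seq letter := flatten [seq nseq (dig m l) l | l <- letters m].

Lemma count_raw m l : count_mem l (raw m) = dig m l.
Proof.
have uL : uniq (letters m).
  by apply: allpairs_uniq; rewrite ?iota_uniq // => -[a b] [c d].
rewrite /raw count_flatten sumnE !big_map.
transitivity (\sum_(i <- letters m) (i == l) * dig m i).
  by apply: eq_bigr => i _; rewrite count_nseq.
case: (boolP (l \in letters m)) => hl.
  rewrite (bigD1_seq l) //= eqxx mul1n big1 ?addn0 // => i /negbTE ->; lia.
rewrite big_seq big1 => [|i hi]; last by case: eqP => // E; rewrite -E hi in hl.
by case: (posnP (dig m l)) => // /dig_letters; rewrite (negbTE hl).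
Qed.

Lemma dig_inj m m' : canon m -> canon m' -> dig m =1 dig m' -> m = m'.
Proof.
move=> cm cm' H; apply: canon_ext => // i.
  by apply: dg_inj => j; apply: (H (i.+1, j)).
by have := H (0, i) => /=; case: (tb m i); case: (tb m' i).
Qed.

Lemma dg_sum N (d : nat -> nat) i : (forall j, d j < p) ->
  dg (\sum_(j < N) d j * p ^ j) i = if i < N then d i else 0.
Proof.
move=> dp; elim: N d i dp => [|N IH] d i dp; first by rewrite big_ord0 /dg div0n mod0n.
rewrite big_ord_recl /= expn0 muln1.
have -> : \sum_(j < N) d (bump 0 j) * p ^ bump 0 j = p * \sum_(j < N) d j.+1 * p ^ j.
  by rewrite big_distrr /=; apply: eq_bigr => j _; rewrite /bump leq0n add1n expnS mulnCA.
case: i => [|i]; first by rewrite /dg expn0 divn1 addnC mulnC modnMDl modn_small.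
rewrite /dg expnS divnMA addnC mulnC divnMDl // [d 0 %/ p]divn_small // addn0.
by rewrite -/(dg _ i) (IH (fun j => d j.+1)).
Qed.

(** Inverse of taking letters, for words below the caps; N exceeds every index occurring in w. *)
Definition monoOf (w : seq letter) : Mono :=
  let N := (\sum_(l <- w) (l.1 + l.2)).+1 in
  mkM N (fun k => \sum_(j < N) count_mem (k.+1, nat_of_ord j) w * p ^ j)
    (fun j => 0 < count_mem (0, j) w).

Lemma count_bound (w : seq letter) l : \sum_(x <- w) (x.1 + x.2) < l.1 + l.2 -> count_mem l w = 0.
Proof.
move=> h; apply/count_memPn/negP => lw; move: h.
by rewrite (perm_big _ (perm_to_rem lw)) big_cons /= ltnNge leq_addr.
Qed.

Lemma tb_monoOf w j : tb (monoOf w) j = (0 < count_mem (0, j) w).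
Proof.
rewrite tb_mkM // => h; apply/negbTE; rewrite -leqNgt leqn0.
by apply/eqP/count_bound; rewrite add0n.
Qed.

Lemma xe_monoOf w k : xe (monoOf w) k =
  \sum_(j < (\sum_(l <- w) (l.1 + l.2)).+1) count_mem (k.+1, nat_of_ord j) w * p ^ j.
Proof.
rewrite xe_mkM // => h; rewrite big1 // => i _; rewrite count_bound //=.
by rewrite addSn ltnS (leq_trans (ltnW h)) // leq_addr.
Qed.

Lemma dig_monoOf (w : seq letter) l :
  (forall x, count_mem x w < cap x) -> dig (monoOf w) l = count_mem l w.
Proof.
move=> hw; case: l => -[|k] j /=.
  by rewrite tb_monoOf; have := hw (0, j); rewrite /cap /=; case: count => [|[|]].
rewrite xe_monoOf (dg_sum _ (d := fun j => count_mem (k.+1, j) w)) => [|i]; last exact: (hw (k.+1, i)).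
case: ltnP => // h; rewrite count_bound //=; apply: leq_trans h _.
by rewrite addSn (leq_trans (leq_addl k j)).
Qed.

Lemma canon_monoOf w : canon (monoOf w).
Proof. exact: canon_mkM. Qed.

(** By Kummer, a product of binomials nonzero mod p means that exponents add without carry. So the
    leading product merely joins the multisets of letters. *)
Lemma coefPsi_dig a b c : canon a -> canon b -> canon c ->
  wt b + wt c = wt a -> ((coefPsi p a b c)%:~R != 0 :> 'F_p)%R ->
  forall l, dig a l = dig b l + dig c l.
Proof.
move=> ca cb cc hw nz; have nz' : coefPsi p a b c != 0%R by apply: contraNneq nz => ->.
have [hx ht] := coefPsi_lead_support p1 hw nz'.
have [e E] := coefPsi_lead p1 cb cc hx ht.
case=> -[|k] j //=; rewrite hx; apply: (proj1 (nocarryP _ _)).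
apply/binomial_nocarry.
apply: contraNN nz; rewrite E => pk; apply/eqP.
rewrite rmorphM /= [X in (_ * X)%R](_ : _ = 0%R) ?mulr0 //.
rewrite rmorph_nat; apply/eqP.
rewrite -(dvdn_pcharf (pchar_Fp p_pr)).
case: (ltnP k (size a.1)) => ka.
  by rewrite /binM (bigD1 (Ordinal ka)) //= dvdn_mulr.
move: pk; have := hx k; rewrite xe_size // => /esym/eqP; rewrite addn_eq0 => /andP[/eqP-> /eqP->].
by rewrite bin0 dvdn1 => /eqP pp; move: p1; rewrite pp.
Qed.

(** Conversely, sums of digits that are again digits produce no carry, so no binomial is divisible
    by p. *)
Lemma coefPsi_dig_neq0 a b c : canon b -> canon c ->
  (forall l, dig a l = dig b l + dig c l) ->
  (forall k, xe a k = xe b k + xe c k) /\ ((coefPsi p a b c)%:~R != 0 :> 'F_p)%R.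
Proof.
move=> cb cc H.
have nc k : nocarry (xe b k) (xe c k).
  by apply: nocarry_lt => j; have := H (k.+1, j) => /= <-; apply: dg_lt.
have hx k : xe a k = xe b k + xe c k.
  by apply: dg_inj => j; have := H (k.+1, j) => /= ->; have /nocarryP -> := nc k.
split=> //; have [e ->] := coefPsi_lead p1 cb cc hx (fun j => H (0, j)).
rewrite rmorphM rmorph_sign mulf_neq0 ?signr_eq0 //=.
rewrite rmorph_nat -(dvdn_pcharf (pchar_Fp p_pr)).
rewrite /binM Euclid_dvd_prod // big_orE negb_exists; apply/forallP => k.
by apply/binomial_nocarry.
Qed.

Definition degL (l : letter) : nat :=
  if l.1 is k.+1 then p ^ l.2 * (2 * (p ^ k.+1 - 1)) else 2 * p ^ l.2 - 1.

Lemma dg_expand N n : n <= N -> n = \sum_(j < N) dg n j * p ^ j.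
Proof.
move=> nN; apply: dg_inj => j; rewrite dg_sum => [|i]; last exact: dg_lt.
by case: ltnP => // Nj; rewrite dg_big // (leq_trans nN).
Qed.

Lemma deg_raw m : \sum_(l <- raw m) degL l = degM p m.
Proof.
rewrite /raw big_flatten big_map.
under eq_bigr do rewrite big_nseq iter_addn_0.
rewrite /letters big_allpairs_dep; set N := size m.2 + _.
have -> : iota 0 (size m.1).+1 = 0 :: iota 1 (size m.1) by [].
rewrite [RHS]addnC big_cons; congr (_ + _).
  rewrite -[N]subn0 -/(index_iota 0 N) big_mkord.
  rewrite -(sum_wide (F := fun j => degL (0, j) * tb m j) (leq_addr _ _)).
    by apply: eq_bigr => j _; rewrite mulnC.
  by move=> j /tb_size ->; rewrite muln0.
have -> : iota 1 (size m.1) = [seq k.+1 | k <- iota 0 (size m.1)] by rewrite -[1]addn0 iotaDl.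
rewrite big_map -{1}[size m.1]subn0 -/(index_iota 0 _) big_mkord; apply: eq_bigr => k _.
have kN : xe m k <= N by rewrite /N (bigD1 k) //=; lia.
rewrite -/(xe m k) [in RHS](dg_expand kN) big_distrl /= -{1}[N]subn0 -/(index_iota 0 _) big_mkord.
by apply: eq_bigr => j _; rewrite /degL /=; lia.
Qed.

End Digits.

(** * Matching of words *)

Section Lexicographic.
Variables (T : eqType) (r : rel T).

Fixpoint lexs (u v : seq T) : bool :=
  match u, v with
  | _, [::] => false
  | [::], _ :: _ => true
  | x :: u', y :: v' => r x y || (x == y) && lexs u' v'
  end.

Lemma lexs_cat w u v : irreflexive r -> lexs (w ++ u) (w ++ v) = lexs u v.
Proof. by move=> ir; elim: w => //= x w ->; rewrite ir eqxx. Qed.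

Lemma lexs_irr : irreflexive r -> irreflexive lexs.
Proof. by move=> ir; elim=> //= x u ->; rewrite ir andbF. Qed.

Lemma lexs_trans : transitive r -> transitive lexs.
Proof.
move=> tr v u w; elim: v u w => [|y v IH] [|x u] [|z w] //=.
case/orP=> [xy|/andP[/eqP-> uv]].
  by case/orP=> [yz|/andP[/eqP<- _]]; [rewrite (tr _ _ _ xy yz) | rewrite xy].
case/orP=> [->//|/andP[-> vw]]; apply/orP; right; exact: IH vw.
Qed.

Lemma lexs_prefix u v : v != [::] -> lexs u (u ++ v).
Proof. by case: v => // y v _; elim: u => //= x u ->; rewrite eqxx orbT. Qed.

End Lexicographic.

Section Matching.
Import Order.TTheory.
Variables (d : Order.disp_t) (L : orderType d) (cap : L -> nat).
Hypothesis cap2 : forall x, 1 < cap x.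
Local Notation lt := (fun x y : L => (x < y)%O).
Local Notation le := (fun x y : L => (x <= y)%O).

(** The monomial basis of the truncated commutative algebra. *)
Definition normal (w : seq L) : bool :=
  sorted le w && all (fun x => count_mem x w < cap x) w.

Lemma normal_count w x : normal w -> count_mem x w < cap x.
Proof.
move=> /andP[_ /allP h]; case: (boolP (x \in w)) => [/h //|/count_memPn ->].
by apply: ltn_trans (cap2 x).
Qed.

Lemma normalI w : sorted le w -> (forall x, count_mem x w < cap x) -> normal w.
Proof. by move=> h1 h2; rewrite /normal h1; apply/allP => x _. Qed.

Lemma le_tr : transitive le. Proof. by move=> y x z; apply: le_trans. Qed.

Lemma sorted_head a w : sorted le (a :: w) -> all (le a) w.
Proof. by move=> /= h; apply: order_path_min h => //; apply: le_tr. Qed.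

Lemma sorted_block a w : sorted le (a :: w) ->
  exists r, a :: w = nseq (count_mem a (a :: w)) a ++ r /\ all (lt a) r.
Proof.
elim: w => [|b w IH] h; first by exists [::]; rewrite /= eqxx.
have /andP[ab _] := sorted_head h.
move: ab; rewrite le_eqVlt => /orP[/eqP E|ab].
  subst b; have [|r [E hr]] := IH; first by case/andP: h.
  by exists r; split=> //; rewrite [in LHS]E /= eqxx.
exists (b :: w); split; last first.
  have /andP[_ hb] := h; rewrite /= ab; apply: sub_all (sorted_head hb) => x.
  exact: lt_le_trans.
have : a \notin b :: w.
  apply/negP => ha; have : all (le b) (b :: w).
    by rewrite /= lexx; case/andP: h => _; apply: sorted_head.
  by move/allP/(_ _ ha); rewrite leNgt ab.
by move/count_memPn => /= E; rewrite /= eqxx E.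
Qed.

(* When [pr] is a power of a letter, [need pr w] is the length of the shortest
   prefix of [w] whose concatenation with [pr] is no longer normal, if any.  The
   words [x] with [chain [::] x] are thus Anick's chains for the quadratic
   relations x y = y x and the truncations x ^ (cap x) = 0. *)
Definition need (pr w : seq L) : option nat :=
  match pr, w with
  | [::], _ => Some 1
  | a :: _, [::] => None
  | a :: _, b :: _ =>
      if (b < a)%O then Some 1
      else if b == a then
        if cap a <= size pr + count_mem a w then Some (cap a - size pr) else None
      else None
  end.

Lemma need_cons a pr b w : need (a :: pr) (b :: w) =
  if (b < a)%O then Some 1
  else if b == a then
    if cap a <= size (a :: pr) + count_mem a (b :: w) then Some (cap a - size (a :: pr)) else None
  else None.
Proof. by []. Qed.

Fixpoint chain (pr : seq L) (P : seq (seq L)) : bool :=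
  if P is w :: P' then (need pr w == Some (size w)) && chain w P' else true.

(* The first entry violating the chain condition either splits at the required
   prefix ([isU]) or merges with its predecessor ([isD]). *)
Fixpoint isU (pr : seq L) (X : seq (seq L)) : bool :=
  if X is w :: X' then
    if need pr w is Some k then if size w <= k then isU w X' else true else false
  else false.

Fixpoint isD (pr : seq L) (X : seq (seq L)) : bool :=
  if X is w :: X' then
    if need pr w is Some k then if size w <= k then isD w X' else false else true
  else false.

(** All entries of a chain turn out to be of this form, for which [need] is designed; the empty
    block starts a chain. *)
Definition blk (w : seq L) : Prop :=
  w = [::] \/ exists a e, [/\ w = nseq e a, 0 < e & e < cap a].

Definition nice (w : seq L) : bool := normal w && (w != [::]).

Lemma need_le pr w k : nice w -> need pr w = Some k -> k <= size w.
Proof.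
case: pr w => [|a pr] [|b w] // _; first by case=> <-.
rewrite /need; case: ifP => _; first by case=> <-.
case: eqP => // ->; case: ifP => // h [<-].
by rewrite leq_subLR; apply: leq_trans h _; rewrite leq_add2l count_size.
Qed.

Lemma chain_cat pr P Q : chain pr (P ++ Q) = chain pr P && chain (last pr P) Q.
Proof. by elim: P pr => //= w P IH pr; rewrite IH andbA. Qed.

Lemma isU_cat pr P X : chain pr P -> isU pr (P ++ X) = isU (last pr P) X.
Proof.
elim: P pr => //= w P IH pr /andP[/eqP-> h]; rewrite leqnn; exact: IH.
Qed.

Lemma trichotomy pr X : all nice X -> [|| chain pr X, isU pr X | isD pr X].
Proof.
elim: X pr => //= w X IH pr /andP[nw nX].
case E: (need pr w) => [k|]; last by rewrite !orbT.
have := need_le nw E; case: ifP => [h1 h2|_ _]; last by rewrite orbT.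
have -> : k = size w by apply/eqP; rewrite eqn_leq h1 h2.
by rewrite eqxx /=; apply: IH.
Qed.

Lemma isU_split pr X : all nice X -> isU pr X -> exists P w R k,
  [/\ X = P ++ w :: R, chain pr P, need (last pr P) w = Some k & k < size w].
Proof.
elim: X pr => //= w X IH pr /andP[nw nX]; case E: (need pr w) => [k|] //.
case: ifP => h; last by exists [::], w, X, k; rewrite ltnNge h.
case/(IH _ nX)=> P [w' [R [k' [-> hP hn hk]]]].
exists (w :: P), w', R, k'; split=> //=; rewrite hP andbT E.
by apply/eqP; congr Some; apply/eqP; rewrite eqn_leq h (need_le nw E).
Qed.

Lemma isD_split pr X : all nice X -> isD pr X -> exists P w R,
  [/\ X = P ++ w :: R, chain pr P & need (last pr P) w = None].
Proof.
elim: X pr => //= w X IH pr /andP[nw nX]; case E: (need pr w) => [k|]; last first.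
  by exists [::], w, X.
case: ifP => h // /(IH _ nX)[P [w' [R [-> hP hn]]]].
exists (w :: P), w', R; split=> //=; rewrite hP andbT E.
by apply/eqP; congr Some; apply/eqP; rewrite eqn_leq h (need_le nw E).
Qed.

Lemma count_nseq_neq (a b : L) e : b != a -> count_mem b (nseq e a) = 0.
Proof. by move=> ba; rewrite count_nseq /= eq_sym (negbTE ba). Qed.

Lemma need_blk pr w : blk pr -> nice w -> need pr w = Some (size w) -> blk w /\ w != [::].
Proof.
move=> bpr /andP[nw w0]; split=> //; right.
have single b : size w = 1 -> head b w = b -> exists a e, [/\ w = nseq e a, 0 < e & e < cap a].
  by case: w nw w0 H => // x [|] //= _ _ _ _ ->; exists b, 1; rewrite cap2.
case: w nw w0 H single => // b w nw _ H single; move: H.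
case: bpr => [->|[a [[|e] [-> // _ ea]]]]; first by case=> h; apply: (single b) => //=; rewrite -h.
rewrite /need /=; case: ifP => _; first by case=> h; apply: (single b) => //=; rewrite -h.
case: eqP => // E; subst b; case: ifP => // h [sz].
have h1 := count_size (pred1 a) (a :: w); rewrite /= eqxx size_nseq in h h1.
(* [need] returns the number of copies of a missing to the cap, and w has at least that many; having
   exactly that length, w is a power of a. *)
have cnt : count_mem a (a :: w) == size (a :: w).
  by rewrite eqn_leq count_size /= eqxx -sz size_nseq leq_subLR; exact: h.
exists a, (size (a :: w)); split=> //; last by rewrite -(eqP cnt) normal_count.
by apply/all_pred1P; rewrite all_count.
Qed.

Lemma chain_blk pr P : blk pr -> all nice P -> chain pr P -> blk (last pr P).
Proof.
elim: P pr => //= w P IH pr b /andP[nw nP] /andP[/eqP E hP].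
by apply: IH => //; have [] := need_blk b nw E.
Qed.

Lemma sorted_cat_blk (a : L) e w : sorted le w -> all (le a) w -> sorted le (nseq e a ++ w).
Proof.
move=> sw aw; elim: e => //= e IH; rewrite path_min_sorted //.
by rewrite all_cat aw andbT; apply/allP => x /nseqP[-> _].
Qed.

(** When nothing is needed, w starts with no letter smaller than that of pr, and the copies of that
    letter do not reach the cap. *)
Lemma normal_merge pr w : blk pr -> nice w -> need pr w = None ->
  pr != [::] /\ normal (pr ++ w).
Proof.
move=> bpr /andP[nw w0] nd; case: bpr nd => [->|[a [[|e] [-> // _ ea]]]]; first by case: w nw w0.
case: w nw w0 => // b w nw _ nd; split=> //.
have ab : (a <= b)%O by move: nd; rewrite /need /= leNgt; case: ifP.
have sw : sorted le (b :: w) by case/andP: nw.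
have aw : all (le a) (b :: w).
  by rewrite /= ab; apply: sub_all (sorted_head sw) => x; apply: le_trans.
apply: normalI; first exact: sorted_cat_blk.
move=> x; rewrite count_cat; have [->|xa] := eqVneq x a; last first.
  by rewrite count_nseq_neq // normal_count.
rewrite count_nseq [pred1 a a]/= eqxx mul1n; move: nd.
have -> : need (nseq e.+1 a) (b :: w) = if b == a then
    if cap a <= e.+1 + count_mem a (b :: w) then Some (cap a - e.+1) else None else None.
  by rewrite -[nseq e.+1 a]/(a :: nseq e a) need_cons ltNge ab /= size_nseq.
case: eqP => [E|/eqP ne].
  by case: leqP.
have lt_ab : (a < b)%O by rewrite lt_neqAle eq_sym ne.
have -> : count_mem a (b :: w) = 0.
  apply/count_memPn/negP => ha; have : all (le b) (b :: w) by rewrite /= lexx; apply: sorted_head.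
  by move/allP/(_ _ ha); rewrite leNgt lt_ab.
by rewrite addn0.
Qed.

Lemma need_cat pr c w : c != [::] -> need pr c = Some (size c) ->
  need pr (c ++ w) = Some (size c).
Proof.
case: pr c => [|a pr] [|b c] // _; rewrite cat_cons !need_cons.
case: ifP => // _; case: eqP => // E; case: ifP => // h <-.
by rewrite ifT //; apply: leq_trans h _; rewrite leq_add2l -cat_cons count_cat leq_addr.
Qed.

(** The chain condition on pr demands that pr be split off again from [pr ++ w], so merging at the
    first defect turns type D into type U. *)
Lemma isU_merge P pr w R : all nice (P ++ pr :: w :: R) -> chain [::] (P ++ [:: pr]) ->
  need pr w = None -> [/\ nice (pr ++ w), isU [::] (P ++ (pr ++ w) :: R) & blk pr].
Proof.
rewrite all_cat => /andP[nP /= /and3P[npr nw nR]] hc hn.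
have hb : blk pr.
  by have := chain_blk (or_introl erefl) _ hc; rewrite last_cat; apply; rewrite all_cat nP /= npr.
have [pr0 nm] := normal_merge hb nw hn.
split=> //; first by rewrite /nice nm; case: (pr) pr0.
move: hc; rewrite chain_cat => /andP[hP /= /andP[/eqP hpr _]].
rewrite isU_cat //= need_cat //.
case/andP: nw => _ w0; rewrite size_cat ifF //; apply/negbTE.
by rewrite -ltnNge -addn1 leq_add2l lt0n size_eq0.
Qed.

Lemma need_head_lt (a b : L) pr w : (b < a)%O -> need (a :: pr) (b :: w) = Some 1.
Proof. by rewrite need_cons => ->. Qed.

(** The needed prefix of w is a power of its first letter. Since w is normal, the remainder neither
    starts lower nor reaches the cap, so nothing is needed after that prefix. *)
Lemma split_back pr w k : blk pr -> nice w -> need pr w = Some k -> k < size w ->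
  [/\ 0 < k, need pr (take k w) = Some (size (take k w)), need (take k w) (drop k w) = None,
      nice (take k w) & nice (drop k w)].
Proof.
move=> bpr /andP[nw _] E kw.
case: w nw E kw => // b w nw E kw.
have sw : sorted le (b :: w) by case/andP: nw.
have nt : normal (take k (b :: w)).
  apply: normalI; first by apply: take_sorted.
  move=> x; apply: leq_ltn_trans (normal_count x nw).
  by rewrite -{2}(cat_take_drop k (b :: w)) count_cat leq_addr.
have ndr : normal (drop k (b :: w)).
  apply: normalI; first by apply: drop_sorted.
  move=> x; apply: leq_ltn_trans (normal_count x nw).
  by rewrite -{2}(cat_take_drop k (b :: w)) count_cat leq_addl.
have d0 : drop k (b :: w) != [::] by rewrite -size_eq0 size_drop subn_eq0 -ltnNge.
have st : size (take k (b :: w)) = k by rewrite size_takel // ltnW.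
have [r [Eb hr]] := sorted_block sw; set c := count_mem b (b :: w) in Eb.
have cb : c < cap b := normal_count b nw.
have key e : 0 < e -> e <= c -> take e (b :: w) = nseq e b /\ drop e (b :: w) = nseq (c - e) b ++ r.
  move=> e0 ec; rewrite Eb take_cat drop_cat size_nseq.
  case: ltnP => h; first by rewrite take_nseq ?drop_nseq.
  have -> : e = c by apply/eqP; rewrite eqn_leq ec h.
  by rewrite subnn take0 drop0 cats0.
have none e : 0 < e -> e <= c -> drop e (b :: w) != [::] ->
    need (nseq e b) (nseq (c - e) b ++ r) = None.
  move=> e0 ec; have [_ ->] := key e e0 ec; case: e e0 ec => // e _ ec.
  have cr : count_mem b r = 0.
    by apply/count_memPn/negP => /(allP hr); rewrite ltxx.
  case F: (c - e.+1) => [|f]; last first.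
    rewrite -[nseq e.+1 b]/(b :: nseq e b) need_cons ltxx eqxx -[b :: _ ++ r]/(nseq f.+1 b ++ r).
    rewrite count_cat cr count_nseq /= eqxx mul1n addn0 size_nseq -F addnC subnK //.
    by rewrite leqNgt cb.
  case: (r) hr => // g r' /andP[bg _] _; rewrite -[nseq e.+1 b]/(b :: nseq e b) need_cons.
  by rewrite ltNge (ltW bg) /= eq_sym (lt_eqF bg).
have c1 : 0 < c by rewrite /c /= eqxx.
have fin : [/\ 0 < k, k <= c & need pr (nseq k b) = Some k].
  case: bpr E => [->|[a [[|e] [-> // _ ea]]]]; first by case=> <-.
  rewrite -[nseq e.+1 a]/(a :: nseq e a) need_cons; case: ifP => h.
    by case=> <-; split=> //; apply: need_head_lt.
  case: eqP => // Ea; rewrite -Ea /= size_nseq in ea *; case: ifP => // h' [<-].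
  have h2 : cap b - e.+1 <= c by rewrite leq_subLR.
  split=> //; first by rewrite subn_gt0.
  case F: (cap b - e.+1) => [|f]; first by move: ea; rewrite -subn_gt0 F.
  rewrite -[nseq f.+1 b]/(b :: nseq f b) /= ltxx eqxx count_nseq /= eqxx mul1n.
  by rewrite add1n -F subnKC ?(ltnW ea) // leqnn.
case: fin => k0 kc nk; have [E1 E2] := key k k0 kc.
split=> //.
- by rewrite E1 size_nseq.
- by rewrite E1 E2 none.
- by rewrite /nice nt E1; case: (k) k0.
by rewrite /nice ndr d0.
Qed.

(** If c' begins below the letter of c, so does the sorted word v. Otherwise c and c' together reach
    the cap and v could not be normal. *)
Lemma lexs_merge_chain c c' v : blk c -> c != [::] -> nice c' -> need c c' = Some (size c') ->
  normal v -> perm_eq v (c ++ c') -> lexs lt v c.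
Proof.
case=> [->//|[a [[|e] [-> // _ ea]]]] _ /andP[_].
case: c' => // b c' _; rewrite -[nseq e.+1 a]/(a :: nseq e a) need_cons => hn nv pv.
have bv : b \in v by rewrite (perm_mem pv) mem_cat mem_head orbT.
case: v nv pv bv => // x v nv pv bv /=.
have xb : (x <= b)%O.
  move: bv; rewrite inE => /orP[/eqP->//|].
  by have /andP[/sorted_head/allP h _] := nv; apply: h.
move: hn; case: ifP => [ba _|_]; first by rewrite (le_lt_trans xb ba).
case: eqP => // E; subst b; case: ifP => // h _.
have := normal_count a nv; rewrite (permP pv) ltnNge count_cat.
have -> : count_mem a (a :: nseq e a) = size (a :: nseq e a).
  by rewrite /= eqxx count_nseq /= eqxx mul1n size_nseq.
by rewrite h.
Qed.

Lemma cat_split (T : Type) (A B P Q : seq T) : size A <= size P -> A ++ B = P ++ Q ->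
  P = A ++ drop (size A) P /\ B = drop (size A) P ++ Q.
Proof.
move=> sz E; have E1 := congr1 (take (size A)) E; have E2 := congr1 (drop (size A)) E.
move: E1 E2; rewrite take_size_cat // drop_size_cat // take_cat drop_cat.
case: ltngtP sz => // h _; first by move=> E1 E2; rewrite {1}E1 cat_take_drop.
by rewrite h subnn take0 drop0 cats0 drop_size => -> ->; rewrite cats0.
Qed.

(* Acyclicity of the matching, for the associated graded differential. *)
Lemma isU_lexs P pr w R A c c' C v :
  all nice (P ++ pr :: w :: R) -> chain [::] (P ++ [:: pr]) -> need pr w = None ->
  A ++ c :: c' :: C = P ++ pr :: w :: R -> normal v -> perm_eq v (c ++ c') ->
  isU [::] (A ++ v :: C) ->
  (size A = size P /\ v = pr ++ w) \/
  lexs (lexs lt) (A ++ v :: C) (P ++ (pr ++ w) :: R).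
Proof.
move=> nY hc hn E nv pv hU.
have irr : irreflexive lt by move=> x; rewrite ltxx.
have irr2 : irreflexive (lexs lt) by apply: lexs_irr.
have nY' : all nice (A ++ c :: c' :: C) by rewrite E.
(* A merge at the defect gives [pr ++ w] back; a merge inside the chain replaces an entry by a
   smaller one. *)
have [sz|sz] := leqP (size A) (size P).
  have [EP EQ] := cat_split sz E; move: EP EQ; case: (drop _ _) => [|q Q] EP EQ.
    left; rewrite EP cats0; split=> //.
    have [e1 e2 _] : [/\ c = pr, c' = w & C = R] by move: EQ => /= [].
    subst c c'; apply: (sorted_eq (leT := le)) => //.
    - exact: le_tr.
    - by move=> x y; apply: le_anti.
    - by case/andP: nv.
    have nw : nice w by move: nY; rewrite all_cat /= => /and4P[].
    have [_ _ hb] := isU_merge nY hc hn.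
    by have [_ /andP[]] := normal_merge hb nw hn.
  right; move: EQ => /= [Ec EC]; subst q; rewrite EP -catA lexs_cat //= orbC.
  move: nY'; rewrite all_cat /= => /and4P[nA nc nc' _].
  move: hc; rewrite EP -catA chain_cat => /andP[hA /= /andP[/eqP hcc hQ]].
  have hb : blk c.
    have [] // := need_blk _ nc hcc; exact: chain_blk (or_introl erefl) nA hA.
  have hn' : need c c' = Some (size c').
    by move: EC hQ; case: Q {EP} => [|q Q] /= [-> _] /andP[/eqP].
  have c0 : c != [::] by case/andP: nc.
  by rewrite (lexs_merge_chain hb c0 nc' hn' nv pv) orbT.
(* Merging w with its successor leaves pr, a proper prefix of [pr ++ w]. Merging further right keeps
   the defect, so the word is not of type U. *)
have [EA EQ] := cat_split (ltnW sz) (esym E); move: EA EQ; case: (drop _ _) => [|q Q] EA EQ.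
  by move: sz; rewrite EA cats0 ltnn.
move: EQ => /= [e1 EQ]; subst q; case: Q EA EQ => [|q Q] EA.
  move=> /= [e1 e2]; right; rewrite EA -catA lexs_cat //=.
  by rewrite lexs_prefix //; move: nY; rewrite all_cat /= => /and4P[_ _ /andP[]].
move=> /= [e1 EQ]; subst q; move: hU.
rewrite EA -catA /= -[pr :: w :: _]/([:: pr] ++ w :: _) catA isU_cat //.
by rewrite last_cat /= hn.
Qed.

(** The matching from type U to type D: cuts the first overlong entry after its needed prefix. *)
Fixpoint spl (pr : seq L) (X : seq (seq L)) : seq (seq L) :=
  if X is w :: X' then
    if need pr w is Some k then
      if size w <= k then w :: spl w X' else take k w :: drop k w :: X'
    else X
  else [::].

Lemma spl_cat pr P X : chain pr P -> spl pr (P ++ X) = P ++ spl (last pr P) X.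
Proof.
by elim: P pr => //= w P IH pr /andP[/eqP-> h]; rewrite leqnn; congr (_ :: _); apply: IH.
Qed.

Lemma spl_isU X : all nice X -> isU [::] X -> exists P pr w R,
  [/\ X = P ++ (pr ++ w) :: R, spl [::] X = P ++ pr :: w :: R,
      all nice (P ++ pr :: w :: R), chain [::] (P ++ [:: pr]) & need pr w = None].
Proof.
move=> nX hU; have [P [w [R [k [EX hP hn kw]]]]] := isU_split nX hU.
have := nX; rewrite EX all_cat /= => /and3P[nP nw nR].
have hb := chain_blk (or_introl erefl) nP hP.
have [k0 h1 h2 h3 h4] := split_back hb nw hn kw.
exists P, (take k w), (drop k w), R; rewrite cat_take_drop; split=> //.
- by rewrite spl_cat //= hn leqNgt kw.
- by rewrite all_cat nP /= h3 h4.
by rewrite chain_cat hP /= h1 eqxx.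
Qed.

Lemma spl_merge P pr w R : all nice (P ++ pr :: w :: R) -> chain [::] (P ++ [:: pr]) ->
  need pr w = None -> spl [::] (P ++ (pr ++ w) :: R) = P ++ pr :: w :: R.
Proof.
move=> nY; rewrite chain_cat => /andP[hP /= /andP[/eqP hpr _]] hn.
move: nY; rewrite all_cat /= => /and4P[_ /andP[_ pr0] /andP[_ w0] _].
rewrite spl_cat //= need_cat // size_cat ifF ?take_size_cat ?drop_size_cat //.
by apply/negbTE; rewrite -ltnNge -addn1 leq_add2l lt0n size_eq0.
Qed.

End Matching.

(** * Vanishing in the absence of critical words *)

Section Words.
Import Order.TTheory.
Variable p : nat.
Hypothesis p_pr : prime p.
Let p1 : 1 < p := prime_gt1 p_pr.

Definition lletter : Type := (nat *l nat)%type.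
HB.instance Definition _ := Order.Total.on lletter.

Local Notation ltL := (fun x y : lletter => (x < y)%O).
Local Notation leL := (fun x y : lletter => (x <= y)%O).

Definition word (m : Mono) : seq lletter := sort leL (raw p m).

Definition lcap (l : lletter) : nat := cap p l.

Lemma cap_gt1 (l : lletter) : 1 < lcap l.
Proof. by rewrite /lcap /cap; case: l => -[|k] j. Qed.

Lemma count_word m (l : lletter) : count_mem l (word m) = dig p m l.
Proof. by rewrite (permP (permEl (perm_sort _ _))) count_raw. Qed.

Lemma word_normal m : normal lcap (word m).
Proof.
apply: normalI; first by apply: sort_sorted; apply: le_total.
by move=> l; rewrite count_word dig_lt.
Qed.

Lemma word_inj m m' : canon m -> canon m' -> word m = word m' -> m = m'.
Proof.
move=> cm cm' E; apply: (dig_inj p_pr) => // l.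
by rewrite -!(count_word _ (l : lletter)) E.
Qed.

Lemma dig_unitM l : dig p unitM l = 0.
Proof. by case: l => -[|k] j; rewrite /dig ?tb_unitM // xe_unitM /dg div0n mod0n. Qed.

Lemma word_nice m : good m -> nice lcap (word m).
Proof.
move=> /andP[cm mu]; rewrite /nice word_normal; apply: contraNneq mu => E.
apply/eqP; apply: (dig_inj p_pr) => // l.
by rewrite dig_unitM -(count_word _ (l : lletter)) E.
Qed.

Lemma word_monoOf w : normal lcap w -> word (monoOf p w) = w.
Proof.
move=> nw; apply: (sorted_eq (leT := leL)).
- by move=> y x z; apply: le_trans.
- by move=> x y; apply: le_anti.
- by apply: sort_sorted; apply: le_total.
- by case/andP: nw.
apply/allP => l _; apply/eqP; rewrite [LHS]count_word dig_monoOf // => x.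
exact: (normal_count cap_gt1 (x : lletter) nw).
Qed.

Lemma good_monoOf w : nice lcap w -> good (monoOf p w).
Proof.
move=> /andP[nw w0]; rewrite /good canon_monoOf; apply: contraNneq w0 => E.
rewrite -(word_monoOf nw) E -size_eq0 -all_pred0; apply/allP => l.
by rewrite -[_ \in _]has_pred1 has_count count_word dig_unitM.
Qed.

Definition degW (w : seq lletter) : nat := \sum_(l <- w) degL p l.

Lemma degW_word m : degW (word m) = degM p m.
Proof. by rewrite /degW (perm_big _ (permEl (perm_sort _ _))) deg_raw. Qed.

Lemma degW_cat u v : degW (u ++ v) = degW u + degW v.
Proof. by rewrite /degW big_cat. Qed.

Lemma map_word_basis t s (x : seq Mono) : x \in cobarBasis p t s ->
  [/\ size (map word x) = s, all (nice lcap) (map word x) & sumn (map degW (map word x)) = t].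
Proof.
rewrite cobarBasisP // => /and3P[/eqP sx gx /eqP dx]; split; first by rewrite size_map.
  by rewrite all_map; apply: sub_all gx => m; apply: word_nice.
by rewrite -map_comp -dx; congr sumn; apply: eq_map => m; apply: degW_word.
Qed.

Lemma basis_of_words t s (X : seq (seq lletter)) :
  size X = s -> all (nice lcap) X -> sumn (map degW X) = t ->
  map (monoOf p) X \in cobarBasis p t s /\ map word (map (monoOf p) X) = X.
Proof.
move=> sX nX dX; have E : map word (map (monoOf p) X) = X.
  rewrite -map_comp -[RHS]map_id; apply/eq_in_map => w /(allP nX)/andP[nw _].
  exact: word_monoOf.
split=> //; rewrite cobarBasisP // size_map sX eqxx /=; apply/andP; split.
  by rewrite all_map; apply: sub_all nX => w; apply: good_monoOf.
rewrite -dX -{2}E -2!map_comp; apply/eqP; congr sumn; rewrite -map_comp.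
by apply: eq_map => w /=; rewrite degW_word.
Qed.

Lemma map_word_inj t s (x y : seq Mono) : x \in cobarBasis p t s -> y \in cobarBasis p t s ->
  map word x = map word y -> x = y.
Proof.
rewrite !cobarBasisP // => /and3P[_ gx _] /and3P[_ gy _].
elim: x y gx gy => [|m x IH] [|m' y] //= /andP[/andP[cm _] gx] /andP[/andP[cm' _] gy] [E1 E2].
by rewrite (word_inj cm cm' E1) (IH y).
Qed.

(* The Milnor product of two basis elements is their commutative product modulo
   elements with fewer generators, hence [wtS] is compared first. *)
Definition wtS (x : seq Mono) : nat := sumn (map wt x).
Definition prec (x y : seq Mono) : bool :=
  (wtS x < wtS y) || (wtS x == wtS y) && lexs (lexs ltL) (map word x) (map word y).

Lemma prec_irr : irreflexive prec.
Proof.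
move=> x; rewrite /prec ltnn eqxx /=; apply: lexs_irr; apply: lexs_irr => a.
by rewrite /= ltxx.
Qed.

Lemma prec_trans : transitive prec.
Proof.
have tr : transitive (lexs (lexs ltL)).
  by apply: lexs_trans; apply: lexs_trans => y x z; apply: lt_trans.
move=> y x z; rewrite /prec => /orP[xy|/andP[/eqP-> xy]].
  by case/orP=> [yz|/andP[/eqP<- _]]; rewrite ?xy // (ltn_trans xy yz).
case/orP=> [->//|/andP[-> yz]]; by rewrite (tr _ _ _ xy yz) orbT.
Qed.

Definition Uw (x : seq Mono) : bool := isU lcap [::] (map word x).
Definition Dw (x : seq Mono) : bool := isD lcap [::] (map word x).
Definition critical (x : seq Mono) : bool := chain lcap [::] (map word x).

Notation cf a b c := ((coefPsi p a b c)%:~R : 'F_p)%R.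

(* [y] is the word matched with [u]; every other word of type U occurring in the
   transposed differential of [y] precedes [u]. *)
Definition matched t s (u y : seq Mono) : Prop :=
  y \in cobarBasis p t s.+1 /\ exists i a0,
  [/\ i < s, canon a0, u = ins i a0 y,
      (cf a0 (nth unitM y i) (nth unitM y i.+1) != 0)%R &
      forall j a, j < s -> canon a -> (cf a (nth unitM y j) (nth unitM y j.+1) != 0)%R ->
        Uw (ins j a y) -> (j = i /\ a = a0) \/ prec (ins j a y) u].

Lemma map_ins (T T' : Type) (f : T -> T') i a y : map f (ins i a y) = ins i (f a) (map f y).
Proof. by rewrite /ins map_cat map_take /= map_drop. Qed.

Lemma ins_cat (T : Type) (A : seq T) c c' C v : ins (size A) v (A ++ c :: c' :: C) = A ++ v :: C.
Proof. by rewrite /ins take_size_cat // -[_.+2]/(2 + size A) -drop_drop drop_size_cat //= drop0. Qed.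

Lemma wtS_ins i a y : i.+1 < size y ->
  wtS (ins i a y) + (wt (nth unitM y i) + wt (nth unitM y i.+1)) = wt a + wtS y.
Proof.
by move=> h; have := perm_sumn (perm_map wt (perm_ins unitM a h)) => /= E; rewrite addnC -addnA.
Qed.

Lemma wt_balance A W a S U V : A + W = a + S -> U + V = V + S ->
  (a < W -> A < U) /\ (a = W -> A = U).
Proof. lia. Qed.

Lemma matched_of_split t s (u y : seq Mono) P pr w R :
  u \in cobarBasis p t s -> y \in cobarBasis p t s.+1 ->
  map word u = P ++ (pr ++ w) :: R -> map word y = P ++ pr :: w :: R ->
  chain lcap [::] (P ++ [:: pr]) -> need lcap pr w = None ->
  matched t s u y.
Proof.
move=> hu hy Eu Ey hc hn; split=> //.
have [szu nu du] := map_word_basis hu; have [szy ny dy] := map_word_basis hy.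
have := hy; rewrite cobarBasisP // => /and3P[/eqP sy gy _].
have := hu; rewrite cobarBasisP // => /and3P[/eqP su gu _].
pose i := size P; pose a0 := nth unitM u i.
have is_ : i < s by rewrite -szu Eu size_cat /=; rewrite /i; lia.
have ga0 : good a0 by apply: (allP gu); rewrite mem_nth // su.
have wa0 : word a0 = pr ++ w.
  rewrite /a0 -(nth_map unitM [::]) ?su // Eu nth_cat ltnn subnn //.
have wy k : k < s.+1 -> word (nth unitM y k) = nth [::] (map word y) k.
  by move=> ks; rewrite (nth_map unitM) // sy.
have wyi : word (nth unitM y i) = pr by rewrite wy ?Ey ?nth_cat ?ltnn ?subnn //; lia.
have wyi1 : word (nth unitM y i.+1) = w.
  by rewrite wy ?Ey ?nth_cat; [rewrite ltnNge leqnSn subSnn | lia].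
have cy k : k < s.+1 -> canon (nth unitM y k).
  by move=> ks; have /andP[] := allP gy _ (mem_nth unitM (etrans (congr1 (leq k.+1) sy) ks)).
have [ix0 nz0] : (forall k, xe a0 k = xe (nth unitM y i) k + xe (nth unitM y i.+1) k) /\
   (cf a0 (nth unitM y i) (nth unitM y i.+1) != 0)%R.
  apply: (coefPsi_dig_neq0 p_pr); try (apply: cy; lia).
  by move=> l; rewrite -!(count_word _ (l : lletter)) wa0 wyi wyi1 count_cat.
have Eins : ins i a0 y = u.
  have hb : ins i a0 y \in cobarBasis p t s.
    by apply: (ins_basis p_pr hy is_) nz0; case/andP: ga0.
  by apply: (map_word_inj hb hu); rewrite map_ins Ey Eu wa0 ins_cat.
exists i, a0; split=> //; first by case/andP: ga0.
move=> j a js ca nz Ua.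
have jy : j.+1 < size y by rewrite sy.
have iy : i.+1 < size y by rewrite sy.
have wta : wt a <= wt (nth unitM y j) + wt (nth unitM y j.+1).
  by apply: (coef_psi_wt p1); apply: contraNneq nz => ->.
have wt0 : wt a0 = wt (nth unitM y i) + wt (nth unitM y i.+1).
  apply: stat_add => // k; have := count_word a0 (0, k).
  by rewrite wa0 count_cat -wyi -wyi1 !count_word.
have := wtS_ins a0 iy; rewrite Eins wt0 => /(wt_balance (wtS_ins a jy)) [wlt weq].
(* With fewer generators the merged word precedes u by weight. Otherwise the merge is a leading
   term, and the acyclicity for joined letters decides. *)
move: wta; rewrite leq_eqVlt => /orP[/eqP wta|/wlt wta]; last by right; apply/orP; left.
have da := coefPsi_dig p_pr ca (cy _ (leqW js)) (cy j.+1 js) (esym wta) nz.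
pose A := take j (map word y); pose C := drop j.+2 (map word y).
pose c := word (nth unitM y j); pose c' := word (nth unitM y j.+1).
have EA : map word y = A ++ c :: c' :: C.
  rewrite /A /C /c /c' (wy j (leqW js)) (wy j.+1 js).
  have hj : j.+1 < size (map word y) by rewrite szy.
  by rewrite -(drop_nth _ hj) -(drop_nth _ (ltnW hj)) cat_take_drop.
have sA : size A = j by rewrite /A size_takel // szy; apply: leqW; apply: ltnW.
have Ei : map word (ins j a y) = A ++ word a :: C by rewrite map_ins EA -{1}sA ins_cat.
have pa : perm_eq (word a) (c ++ c').
  by apply/allP => l _; apply/eqP; rewrite [LHS]count_word da count_cat !count_word.
have ny' := ny; rewrite Ey in ny'.
have := isU_lexs cap_gt1 ny' hc hn (etrans (esym EA) Ey) (word_normal a) pa.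
rewrite -Ei => /(_ Ua) [[sP wv]|lx].
  left; rewrite -sA sP; split=> //; apply: word_inj => //; first by case/andP: ga0.
  by rewrite wv wa0.
by right; apply/orP; right; rewrite Eu lx andbT weq.
Qed.

Definition spM (u : seq Mono) : seq Mono := map (monoOf p) (spl lcap [::] (map word u)).

Lemma matched_spM t s (u : seq Mono) : u \in cobarBasis p t s -> Uw u -> matched t s u (spM u).
Proof.
move=> hu Uu; have [su nu du] := map_word_basis hu.
have [P [pr [w [R [Eu Es nY hc hn]]]]] := spl_isU cap_gt1 nu Uu.
have [||] := @basis_of_words t s.+1 (P ++ pr :: w :: R) _ nY.
- by rewrite -su Eu !size_cat /= addnS.
- by rewrite -du Eu !map_cat !sumn_cat /= degW_cat !addnA.
rewrite -Es -/(spM u) => hy Ey.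
by apply: (matched_of_split hu hy Eu) hc hn; rewrite Ey Es.
Qed.

Lemma spM_surj t s (y : seq Mono) : y \in cobarBasis p t s.+1 -> Dw y ->
  exists u, [/\ u \in cobarBasis p t s, Uw u & y = spM u].
Proof.
move=> hy Dy; have [sy ny dy] := map_word_basis hy.
have [P [w [R [Ey hP hn]]]] := isD_split ny Dy.
case/lastP: P hP hn Ey => [|P pr] hP hn Ey.
  by move: hn; rewrite /=.
rewrite last_rcons in hn; rewrite cat_rcons in Ey; rewrite -cats1 in hP.
rewrite Ey in sy ny dy; have [nprw Uu _] := isU_merge cap_gt1 ny hP hn.
have [|||hu Eu] := @basis_of_words t s (P ++ (pr ++ w) :: R).
- by move: sy; rewrite !size_cat /= !addnS => -[].
- by move: ny; rewrite !all_cat /= nprw => /and4P[-> _ _ ->].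
- by rewrite -dy !map_cat !sumn_cat /= degW_cat !addnA.
exists (map (monoOf p) (P ++ (pr ++ w) :: R)); split=> //; first by rewrite /Uw Eu.
rewrite /spM Eu (spl_merge ny hP hn) -Ey -map_comp -[LHS]map_id.
apply/eq_in_map => m my; move: hy; rewrite cobarBasisP // => /and3P[_ gy _].
have gm := allP gy _ my; have /andP[cm _] := gm.
by apply: word_inj => //; [exact: canon_monoOf | rewrite /= word_monoOf // word_normal].
Qed.

End Words.

(** * Linear algebra of a triangular matching *)

Section LinearAlgebra.
Local Open Scope ring_scope.
Variables (p t : nat).
Hypothesis p_pr : prime p.
Let p1 : (1 < p)%N := prime_gt1 p_pr.

Notation basis s := (cobarBasis p t s).
Definition delta (u : seq Mono) : seq Mono -> 'F_p := fun x => (x == u)%:R.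

Lemma dcob_add s g h c y :
  dcob p t s (fun x => g x + c * h x) y = dcob p t s g y + c * dcob p t s h y.
Proof.
rewrite /dcob mulr_sumr -big_split; apply: eq_bigr => i _ /=.
rewrite [X in _ = _ + X]mulrCA -mulrDr [c * _]mulr_sumr -big_split; congr (_ * _).
apply: eq_bigr => a _ /=.
by rewrite mulrDl mulrA.
Qed.

Lemma dcob_neq0 s f y : dcob p t s f y != 0 -> exists i a,
  [/\ (i < s)%N, canon a, f (ins i a y) != 0 & (coefPsi p a (nth unitM y i) (nth unitM y i.+1))%:~R != 0 :> 'F_p].
Proof.
move=> nz; pose T i a := f (ins i a y) * (coefPsi p a (nth unitM y i) (nth unitM y i.+1))%:~R.
case: (boolP [exists i : 'I_s, has (fun a => T i a != 0) (monos t.+1)]).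
  case/existsP=> i /hasP[a ha]; rewrite mulf_eq0 negb_or => /andP[h1 h2].
  by exists i, a; split=> //; apply: monos_canon ha.
rewrite negb_exists => /forallP H; case/eqP: nz; rewrite /dcob big1 // => i _.
rewrite big_seq big1 ?mulr0 // => a ha; have /hasPn/(_ a ha) := H i.
by rewrite negbK => /eqP.
Qed.

(** At the partner y the differential reads off f u alone: every other merge with nonzero
    coefficient lies outside type U or precedes u, and f vanishes there. *)
Lemma dcob_matched s f u y : matched p t s u y -> (forall x, f x != 0 -> Uw p x) ->
  (forall x, f x != 0 -> ~~ prec p x u) -> dcob p t s f y = 0 -> u \in basis s -> f u = 0.
Proof.
move=> [hy [i [a0 [is_ ca0 Eu nz H]]]] fU fP d0 hu; apply/eqP; apply/negPn/negP => fu.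
have a0m : a0 \in monos t.+1.
  apply: (mem_monos p1 ca0); move: hu; rewrite cobarBasisP // => /and3P[_ _ /eqP <-].
  have hb : a0 \in u by rewrite Eu mem_ins.
  by rewrite sumnE big_map (perm_big _ (perm_to_rem hb)) big_cons /= leq_addr.
move: d0; rewrite /dcob (bigD1 (Ordinal is_)) //= (bigD1_seq a0) ?undup_uniq //=.
have z j a : (j < s)%N -> a \in monos t.+1 -> (j != i) || (a != a0) ->
   f (take j y ++ a :: drop j.+2 y) * (coefPsi p a (nth unitM y j) (nth unitM y j.+1))%:~R = 0.
  move=> js ha ne; apply/eqP; rewrite mulf_eq0; apply/negPn/negP; rewrite negb_or => /andP[h1 h2].
  have [[ej ea]|pr] := H j a js (monos_canon ha) h2 (fU _ h1).
    by move: ne; rewrite ej ea !eqxx.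
  by have := fP _ h1; rewrite pr.
rewrite [X in _ * (_ + X)]big_seq_cond [X in _ * (_ + X)]big1 ?addr0; last first.
  by move=> a /andP[ha ne]; rewrite z // ne orbT.
rewrite big1 ?addr0; last first.
  move=> j ji; rewrite big_seq big1 ?mulr0 // => a ha; rewrite z //.
  by apply/orP; left; apply: contraNneq ji => E; apply/eqP/val_inj.
rewrite -/(ins i a0 y) -Eu => /eqP; rewrite !mulf_eq0 signr_eq0 /= (negbTE fu).
by rewrite (negbTE nz).
Qed.

Definition rank s (u : seq Mono) : nat := count (fun v => prec p v u) (basis s).

Lemma rank_lt s v u : v \in basis s -> prec p v u -> (rank s v < rank s u)%N.
Proof.
move=> hv vu; rewrite /rank.
have sub : subpred (fun x => prec p x v) (fun x => prec p x u).
  by move=> x xv; apply: prec_trans xv vu.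
rewrite !(permP (perm_to_rem hv)) /=.
by rewrite prec_irr vu add0n add1n ltnS; apply: sub_count.
Qed.

(** The differential is injective on cochains supported on type U: a least word in the support is
    excluded by its partner. *)
Lemma cocycle_U_zero s f : (forall x, f x != 0 -> (x \in basis s) && Uw p x) ->
  (forall y, y \in basis s.+1 -> dcob p t s f y = 0) -> forall x, f x = 0.
Proof.
move=> fU d0.
suff H n : forall u, (rank s u < n)%N -> f u = 0 by move=> x; apply: (H (rank s x).+1).
elim: n => // n IH u un; have [//|fu] := eqVneq (f u) 0.
have /andP[hu Uu] := fU _ fu; have M := matched_spM p_pr hu Uu.
apply: (dcob_matched M) => //.
- by move=> x /fU/andP[].
- move=> x fx; apply/negP => xu; have /andP[hx _] := fU _ fx.
  by case/eqP: fx; apply: IH; apply: leq_trans (rank_lt hx xu) _.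
by apply: d0; case: M.
Qed.

(** Substitution in the order of increasing rank: a multiple of [delta u] adjusts the value at the
    partner of u. *)
Lemma solve_D s (f : seq Mono -> 'F_p) : exists g, (forall x, g x != 0 -> (x \in basis s) && Uw p x) /\
  forall y, y \in basis s.+1 -> Dw p y -> dcob p t s g y = f y.
Proof.
pose le u v := (rank s u <= rank s v)%N.
pose us := sort le [seq u <- undup (basis s) | Uw p u].
have us_mem u : (u \in us) = (u \in basis s) && Uw p u.
  by rewrite mem_sort mem_filter mem_undup andbC.
have us_uniq : uniq us by rewrite sort_uniq filter_uniq // undup_uniq.
have us_sorted : sorted le us by apply: sort_sorted => x y; apply: leq_total.
suff [g [gU gS]] : exists g, (forall x, g x != 0 -> x \in us) /\
    forall u, u \in us -> dcob p t s g (spM p u) = f (spM p u).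
  exists g; split=> [x /gU|y hy Dy]; first by rewrite us_mem.
  by have [u [hu Uu ->]] := spM_surj p_pr hy Dy; apply: gS; rewrite us_mem hu.
have {us_mem}: all (fun u => (u \in basis s) && Uw p u) us by apply/allP => u; rewrite us_mem.
elim/last_ind: us us_uniq us_sorted => [|us u IH].
  move=> _ _ _; exists (fun _ => 0); split=> // x; by rewrite eqxx.
rewrite rcons_uniq all_rcons => /andP[nu uus] su /andP[/andP[hu Uu] aus].
have sus : sorted le us by apply: subseq_sorted su; [move=> y x z; apply: leq_trans | apply: subseq_rcons].
have lu v : v \in us -> (rank s v <= rank s u)%N.
  move=> hv; have := su; rewrite -cats1 sorted_pairwise; last by move=> y x z; apply: leq_trans.
  by rewrite pairwise_cat => /and3P[/allrelP/(_ v u hv (mem_head _ _))].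
have [g [gU gS]] := IH uus sus aus; have M := matched_spM p_pr hu Uu.
have du x : delta u x != 0 -> x = u.
  by rewrite /delta; case: (eqVneq x u) => //; rewrite eqxx.
have Mu : dcob p t s (delta u) (spM p u) != 0.
  apply/eqP => d0; have : delta u u = 0.
    by apply: (dcob_matched M) => // x /du ->; rewrite ?prec_irr.
  by rewrite /delta eqxx => /eqP; rewrite oner_eq0.
pose c := (f (spM p u) - dcob p t s g (spM p u)) / dcob p t s (delta u) (spM p u).
exists (fun x => g x + c * delta u x); split=> [x|v].
  rewrite mem_rcons inE; case: (eqVneq x u) => //= xu.
  by rewrite /delta (negbTE xu) mulr0 addr0; apply: gU.
rewrite mem_rcons inE dcob_add => /orP[/eqP->|hv]; first by rewrite /c divfK // addrC subrK.
(* Earlier values are undisturbed: a merge of [spM v] giving u would make u equal to v or precede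
   it, against the sorting by rank. *)
rewrite gS // [X in _ + X](_ : _ = 0) ?addr0 //; apply/eqP; rewrite mulf_eq0; apply/orP; right.
apply/negPn/negP => /dcob_neq0[j [a [js ca /du Ei nz]]].
have /andP[hv' Uv] := allP aus _ hv.
have [_ [i [a0 [is_ _ Ev _ H]]]] := matched_spM p_pr hv' Uv.
have := H j a js ca nz; rewrite Ei => /(_ Uu) [[ej ea]|pr].
  by move: nu; rewrite -Ei ej ea -Ev hv.
by have := rank_lt hu pr; rewrite ltnNge lu.
Qed.

Theorem Ext_vanishing s : (forall x, x \in basis s -> ~~ critical p x) -> ExtA_vanishes p s t.
Proof.
move=> nc f cf d0; case: s nc f cf d0 => [|s] nc f cf d0.
  (* In homological degree 0 a basis word is empty, hence critical. *)
  move=> x; apply/eqP; apply/negPn/negP => fx.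
  by have := nc x (cf x fx); rewrite /critical; have := cf x fx; rewrite cobarBasisP // => /and3P[/eqP/size0nil ->].
have [g [gU gS]] := solve_D s f.
have cg : cochain p t s g by move=> x /gU/andP[].
pose h x := f x + (-1) * rcob t s g x.
have hz : forall x, h x = 0.
  apply: (@cocycle_U_zero s.+1) => [x hx|y hy].
    have bx : x \in basis s.+1.
      apply: contraNT hx => nb; rewrite /h /rcob (negbTE nb) mulr0 addr0.
      by apply: contraNT nb => /cf.
    rewrite bx /=; have [_ nx _] := map_word_basis p_pr bx.
    case/or3P: (trichotomy [::] nx) => [cx|//|Dx]; first by have := nc x bx; rewrite /critical cx.
    by case/eqP: hx; rewrite /h /rcob bx gS // mulN1r subrr.
  by rewrite /h dcob_add d0 // dcob_rcob // mulr0 addr0.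
exists g; split=> // x bx; have := hz x; rewrite /h /rcob bx mulN1r => /eqP.
by rewrite subr_eq0 => /eqP.
Qed.

End LinearAlgebra.

(** * Degrees of critical words *)

Section Intervals.
Variable p : nat.
Hypothesis p1 : 1 < p.

Definition ival (l r : nat) : nat := \sum_(l <= j < r) p ^ j.

Lemma ival0 l : ival l 0 = 0.
Proof. by rewrite /ival big_geq. Qed.

Lemma ival_shift l r : ival l r = (l < r) && (l == 0) + p * ival l.-1 r.-1.
Proof.
case: r => [|r]; first by rewrite !ival0 ltn0 muln0.
rewrite /ival big_distrr /=; case: l => [|l] /=.
  rewrite big_nat_recl // expn0; congr (_ + _).
  by apply: eq_bigr => j _; rewrite expnS.
by rewrite andbF add0n big_add1 /=; apply: eq_bigr => j _; rewrite expnS.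
Qed.

Lemma ival_mul l r : l <= r -> (p - 1) * ival l r = p ^ r - p ^ l.
Proof.
move=> lr; rewrite -(subnKC lr); elim: (r - l) => [|k IH].
  by rewrite addn0 /ival big_geq // muln0 subnn.
rewrite addnS /ival big_nat_recr ?leq_addr //= mulnDr -/(ival _ _) IH expnS.
have : p ^ l <= p ^ (l + k) by rewrite leq_exp2l // leq_addr.
nia.
Qed.

Lemma modpD a T : (a + p * T) %% p = a %% p.
Proof. by rewrite addnC mulnC modnMDl. Qed.

Lemma modpM T : (p * T) %% p = 0.
Proof. by rewrite modnMr. Qed.

(** The nonzero base-p digits of a block are adjacent, those of p^n + p^m are separated by a
    zero. *)
Lemma ival_two_powers m n a b : m.+2 <= n -> ival a b <> p ^ n + p ^ m.
Proof.
elim: m n a b => [|m IH] n a b mn.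
  case: n mn => [|[|n]] // _; rewrite ival_shift expn0.
  case: (boolP ((a < b) && (a == 0))) => [/andP[ab /eqP a0]|_] E.
    subst a; have {E} : p * ival 0 b.-1 = p ^ n.+2 by move: E; rewrite /=; lia.
    rewrite expnS => /eqP; rewrite eqn_pmul2l ?(ltnW p1) // => /eqP.
    rewrite ival_shift eqxx andbT; case: (posnP b.-1) => [-> /=|b0].
      rewrite ival0 muln0; have := expn_gt0 p n.+1; lia.
    by move/(congr1 (modn^~ p)); rewrite expnS modpD modpM modn_small.
  by move: E => /(congr1 (modn^~ p)); rewrite add0n modpM expnS addnC modpD modn_small.
case: n mn => // n mn; rewrite ival_shift !expnS -mulnDr.
case: ((a < b) && (a == 0)).
  by move/(congr1 (modn^~ p)); rewrite modpD modpM modn_small.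
by rewrite add0n => /eqP; rewrite eqn_pmul2l ?(ltnW p1) // => /eqP; apply: IH.
Qed.

Variable I : seq (nat * nat).

(** What the blocks contribute from position k on, divided by p^k; [cover k] is the uncarried digit
    at k. *)
Definition tail (k : nat) : nat := \sum_(i <- I) ival (i.1 - k) (i.2 - k).
Definition cover (k : nat) : nat := count (fun i => i.1 <= k < i.2) I.

Lemma tail_shift k : tail k = cover k + p * tail k.+1.
Proof.
rewrite /tail /cover -sum1_count [X in _ = X + _]big_mkcond big_distrr -big_split /=.
apply: eq_bigr => -[l r] _ /=; rewrite ival_shift !subnS; congr (_ + _).
rewrite subn_eq0 andbC; case: (leqP l k) => lk //=.
have -> : l - k = 0 by apply/eqP; rewrite subn_eq0.
by rewrite subn_gt0; case: (k < r).
Qed.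

Lemma cover_size k : cover k <= size I.
Proof. exact: count_size. Qed.

(** A cover is at most p, so a nonzero digit determines it. Only the digit 0 leaves two values, 0
    and p, the latter with a carry of 1. *)
Lemma digit_unique c s T Y : c <= p -> 0 < s -> s < p -> c + p * T = s + p * Y -> c = s /\ T = Y.
Proof.
move=> cp s0 sp E; have E2 : c %% p = s.
  by have := congr1 (modn^~ p) E; rewrite !modpD [s %% p]modn_small.
have cs : c = s.
  move: cp; rewrite leq_eqVlt => /orP[/eqP cp|cp]; last by rewrite -E2 modn_small.
  by move: E2 s0; rewrite cp modnn => <-.
split=> //; move: E; rewrite cs => /addnI/eqP; rewrite eqn_pmul2l ?(ltnW p1) //.
by move/eqP.
Qed.

Lemma digit_zero c T Y : c <= p -> c + p * T = p * Y -> (c = 0 /\ T = Y) \/ (c = p /\ T.+1 = Y).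
Proof.
move=> cp E; have pc : p %| c by rewrite -(dvdn_addl _ (dvdn_mulr T (dvdnn p))) E dvdn_mulr.
move: cp; rewrite leq_eqVlt => /orP[/eqP cp|cp].
  by right; split=> //; move: E; rewrite cp -mulnS => /eqP; rewrite eqn_pmul2l ?(ltnW p1) // => /eqP.
left; have c0 : c = 0 by case: (posnP c) => // c0; move: (dvdn_leq c0 pc); rewrite leqNgt cp.
by split=> //; move: E; rewrite c0 add0n => /eqP; rewrite eqn_pmul2l ?(ltnW p1) // => /eqP.
Qed.

(** A carry of 1 passing through a zero digit. *)
Lemma digit_minus1 c T Y : c <= p -> c + p * T + 1 = p * Y -> c = p - 1 /\ T + 1 = Y.
Proof.
move=> cp E; have E' : (c + 1) + p * T = p * Y by rewrite -E; lia.
have : (c + 1 = 0 /\ T = Y) \/ (c + 1 = p /\ T.+1 = Y).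
  have [cp'|cp'] := leqP (c + 1) p; first exact: digit_zero.
  have cE : c = p by lia.
  have : p %| c + 1 by rewrite -(dvdn_addl _ (dvdn_mulr T (dvdnn p))) E' dvdn_mulr.
  by rewrite cE dvdn_addr // dvdn1 => /eqP pp; move: p1; rewrite pp.
by case; lia.
Qed.

Lemma interval_sum_neq m n s : 3 < m -> m + 2 <= n -> 2 <= s -> s < p -> size I <= s + 1 ->
  \sum_(i <- I) ival i.1 i.2 <> p ^ n + p ^ m + s * p + s.
Proof.
move=> m4 mn s2 sp sI E.
have cp k : cover k <= p by apply: leq_trans (cover_size k) (leq_trans sI _); rewrite addn1.
have s0 : 0 < s by apply: ltn_trans s2.
have t0 : tail 0 = s + p * (s + p * (p ^ (n - 2) + p ^ (m - 2))).
  have -> : tail 0 = \sum_(i <- I) ival i.1 i.2 by apply: eq_bigr => i _; rewrite !subn0.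
  rewrite E; have -> : p ^ n = p * (p * p ^ (n - 2)) by rewrite -!expnS; congr (_ ^ _); lia.
  have -> : p ^ m = p * (p * p ^ (m - 2)) by rewrite -!expnS; congr (_ ^ _); lia.
  lia.
have [c0 t1] := digit_unique (cp 0) s0 sp (etrans (esym (tail_shift 0)) t0).
have [c1 t2] := digit_unique (cp 1) s0 sp (etrans (esym (tail_shift 1)) t1).
have pk a k : 0 < k -> k <= a -> p ^ (a - k.-1) = p * p ^ (a - k).
  by move=> k0 ka; rewrite -expnS; congr (_ ^ _); lia.
have t2' : cover 2 + p * tail 3 = p * (p ^ (n - 3) + p ^ (m - 3)).
  by rewrite -tail_shift t2 mulnDr -(pk n 3) ?(pk m 3) //; lia.
case: (digit_zero (cp 2) t2') => -[c2 t3].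
  (* No block covers position 2, so the s blocks covering 0 end before it and p^n + p^m must come
     from at most one other block. *)
  pose J := [seq i <- I | ~~ (i.1 <= 0 < i.2)].
  have sJ : size J <= 1.
    rewrite size_filter; have := count_predC (fun i => i.1 <= 0 < i.2) I.
    by rewrite -/(cover 0) c0 /predC => e; rewrite -(leq_add2l s) e.
  have tJ : tail 2 = \sum_(i <- J) ival (i.1 - 2) (i.2 - 2).
    rewrite /tail /J big_filter [LHS](bigID (fun i => i.1 <= 0 < i.2)) /=.
    rewrite big_seq_cond big1 ?add0n // => -[l r] /= /andP[hi /andP[l0 r0]].
    have : ~~ has (fun i => i.1 <= 2 < i.2) I by rewrite has_count -/(cover 2) c2.
    move/hasPn/(_ _ hi); rewrite /= (leq_trans l0) //= -leqNgt => r2.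
    have -> : r - 2 = 0 by apply/eqP; rewrite subn_eq0.
    exact: ival0.
  move: tJ; rewrite t2; case: J sJ => [|[l r] [|]] //= _.
    rewrite big_nil; have := expn_gt0 p (n - 2); have := ltnW p1; lia.
  rewrite big_seq1 => /esym; apply: ival_two_powers; lia.
(* Here p blocks cover position 2, and there are at most s + 1 <= p blocks in all. *)
have all2 : all (fun i => i.1 <= 2 < i.2) I.
  rewrite all_count eqn_leq count_size /= -/(cover 2) c2.
  by apply: leq_trans sI _; rewrite addn1.
(* The carry out of position 2 meets the zero digits at 3, ..., m-1, so p - 1 blocks cover each of
   these and the carry moves on. *)
have key j : j + 3 <= m -> tail (j + 3) + 1 = p ^ (n - (j + 3)) + p ^ (m - (j + 3)) /\
    (0 < j -> cover (j + 2) = p - 1).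
  elim: j => [|j IH] jm; first by rewrite addn1.
  have [|Ej _] := IH; first lia.
  have : cover (j + 3) + p * tail (j + 3).+1 + 1 = p * (p ^ (n - (j + 3).+1) + p ^ (m - (j + 3).+1)).
    by rewrite -tail_shift Ej mulnDr -(pk n (j + 3).+1) -?(pk m (j + 3).+1) //; lia.
  case/(digit_minus1 (cp _)) => cj tj; rewrite addSn; split=> // _.
  by rewrite -cj; congr cover; lia.
have [|tm cm] := key (m - 3); first lia.
have m3 : m - 3 + 3 = m by lia.
rewrite m3 subnn expn0 in tm; have {}tm : tail m = p ^ (n - m) by lia.
(* Here m > 3 matters: position m - 1 lies beyond 2. *)
have cm1 : cover m.-1 = p - 1 by rewrite -cm; [congr cover; lia | lia].
have tm' : cover m + p * tail m.+1 = p * p ^ (n - m.+1).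
  by rewrite -tail_shift tm -(pk n m.+1) //; lia.
(* All blocks contain position 2, so none starts later and covers only decrease. *)
have cmle : cover m <= cover m.-1.
  rewrite /cover -!sum1_count big_mkcond [X in _ <= X]big_mkcond big_seq [X in _ <= X]big_seq.
  apply: leq_sum => i hi; have /andP[h1 h2] := allP all2 _ hi.
  case: ifP => // /andP[_ h]; rewrite ifT //; lia.
(* The carry already accounts for the digit 1 of p^m, so the cover at m is 0 or p, and p is too
   large. Then every block ends before m and nothing produces p^n. *)
have cm0 : cover m = 0 by case: (digit_zero (cp m) tm') => -[] //; lia.
have : tail m = 0.
  rewrite /tail big_seq big1 // => -[l r] hi /=.
  have /andP[/= h1 h2] := allP all2 _ hi.
  have : ~~ has (fun i => i.1 <= m < i.2) I by rewrite has_count -/(cover m) cm0.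
  move/hasPn/(_ _ hi) => /= h; have -> : r - m = 0 by lia.
  exact: ival0.
rewrite tm; have := expn_gt0 p (n - m); have := ltnW p1; lia.
Qed.

End Intervals.

(** * Critical words as sums of blocks *)

Section CriticalDegrees.
Import Order.TTheory.
Variable p : nat.
Hypothesis p_pr : prime p.
Let p1 : 1 < p := prime_gt1 p_pr.

(* [d] is the internal degree of a product of at most [k] of the May generators
   h_{i,j}, b_{i,j} and a_i. *)
Definition rep (d k : nat) : Prop := exists (I : seq (nat * nat)) (N : nat),
  [/\ size I <= k, N <= k & d = 2 * (p - 1) * \sum_(i <- I) ival p i.1 i.2 + N].

Lemma rep0 : rep 0 0.
Proof. by exists [::], 0; rewrite big_nil muln0. Qed.

Lemma rep_add d k d' k' : rep d k -> rep d' k' -> rep (d + d') (k + k').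
Proof.
move=> [I [N [sI hN ->]]] [I' [N' [sI' hN' ->]]]; exists (I ++ I'), (N + N').
rewrite size_cat big_cat leq_add // leq_add //; split=> //=.
by rewrite mulnDr addnACA.
Qed.

Lemma rep_leq d k k' : k <= k' -> rep d k -> rep d k'.
Proof. by move=> kk [I [N [sI hN ->]]]; exists I, N; split=> //; apply: leq_trans kk. Qed.

Lemma degL_xi k j : degL p (k.+1, j) = 2 * (p - 1) * ival p j (j + k.+1).
Proof.
rewrite /degL /= -mulnA ival_mul ?leq_addr // expnD.
by rewrite mulnCA mulnBr muln1.
Qed.

Lemma degL_tau j : degL p (0, j) = 2 * (p - 1) * ival p 0 j + 1.
Proof.
rewrite /degL /= -mulnA ival_mul // expn0; have := expn_gt0 p j; have := ltnW p1; lia.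
Qed.

Lemma rep_letter l : rep (degL p l) 1.
Proof.
case: l => -[|k] j.
  by exists [:: (0, j)], 1; rewrite big_seq1 degL_tau.
by exists [:: (j, j + k.+1)], 0; rewrite big_seq1 degL_xi addn0.
Qed.

(** p copies of xi_k^(p^j) have the degree of xi_k^(p^(j+1)), again one block; this accounts for the
    b_{i,j}. *)
Lemma rep_power l : 2 < cap p l -> rep (p * degL p l) 1.
Proof.
case: l => -[|k] j // _; exists [:: (j.+1, j.+1 + k.+1)], 0; rewrite big_seq1 addn0; split=> //.
by rewrite [_.1]/= [_.2]/= -degL_xi /degL /= mulnA -expnS.
Qed.

(** The second entry of a b_{i,j}. Taus are excluded, since for them this power is a single
    letter. *)
Definition full (w : seq lletter) : Prop :=
  exists a : lletter, 2 < cap p a /\ w = nseq (cap p a).-1 a.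

(** After one letter a, the power of a needed is one less than its cap; after that power, a single
    letter suffices again. So no other powers arise. *)
Lemma need_step (pr w : seq lletter) : pr = [::] \/ (exists a, pr = [:: a]) \/ full pr ->
  nice (lcap p) w -> need (lcap p) pr w = Some (size w) ->
  (exists b, w = [:: b]) \/ (exists a, pr = [:: a] /\ w = nseq (cap p a).-1 a /\ full w).
Proof.
move=> hpr hw E.
have single : size w = 1 -> exists b, w = [:: b] by case: (w) => [|b []] // _; exists b.
have bpr : blk (lcap p) pr.
  case: hpr => [->|[[a ->]|[a [ca ->]]]]; [by left| |]; right.
    by exists a, 1; rewrite (cap_gt1 p_pr).
  exists a, (cap p a).-1; rewrite /lcap; split=> //; lia.
have [bw w0] := need_blk (cap_gt1 p_pr) bpr hw E.
case: bw w0 => [->//|[b [[|e] [Ew // _ eb]]]] _.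
case: pr E {bpr} hpr => [|a pr] E hpr; first by left; apply: single; case: E.
move: E; rewrite {1}Ew -[nseq e.+1 b]/(b :: nseq e b) need_cons.
case: ifP => _; first by case=> /esym h; left; apply: single.
case: eqP => // Eab; subst b; case: ifP => // _ [sz].
case: hpr => [//|[[a' [Ea Epr]]|[a' [ca Epr]]]].
  subst a' pr; have we : e.+1 = (cap p a).-1 by rewrite -(size_nseq e.+1 a) -Ew -sz /lcap /= subn1.
  have [c2|c2] := leqP (cap p a) 2.
    left; exists a; rewrite Ew we; have := cap_gt1 p_pr a; rewrite /lcap => c1.
    by have -> : cap p a = 2 by apply/eqP; rewrite eqn_leq c2 c1.
  right; exists a; rewrite Ew we; split=> //; split=> //; exists a; split=> //.
have Ea : a = a' by move: Epr; case: (cap p a') ca => [|[|c]] //= _ [].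
subst a'; left; apply: single; rewrite -sz -[(size pr).+1]/(size (a :: pr)) Epr size_nseq /lcap.
by move: ca; lia.
Qed.

(** The second clause keeps a single letter pending, because the next entry may complete it to a
    p-th power. *)
Lemma rep_chain (X : seq (seq lletter)) pr : all (nice (lcap p)) X -> chain (lcap p) pr X ->
  (pr = [::] \/ full pr -> rep (sumn (map (degW p) X)) (size X)) /\
  (forall a, pr = [:: a] -> rep (degL p a + sumn (map (degW p) X)) (size X).+1).
Proof.
elim: X pr => [|w X IH] pr /=.
  by move=> _ _; split=> [_|a _]; [apply: rep0 | rewrite addn0; apply: rep_letter].
move=> /andP[nw nX] /andP[/eqP E hX]; have [IH1 IH2] := IH w nX hX.
have one b : w = [:: b] -> rep (degW p w + sumn (map (degW p) X)) (size X).+1.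
  by move=> Ew; rewrite {1}Ew /degW big_seq1; apply: IH2.
split=> [hpr|a Epr].
  have [|[b /one//]|[a [Ea [Ew fw]]]] := need_step _ nw E.
    by case: hpr; [left | right; right].
  case: hpr => [|[a' [ca]]]; first by rewrite Ea.
  by rewrite Ea; case: (cap p a') ca => [|[|[|c]]].
have [|[b /one hb]|[a' [Ea [Ew fw]]]] := need_step _ nw E.
- by right; left; exists a.
- by rewrite -[(size X).+2]add1n; apply: rep_add => //; apply: rep_letter.
move: Ea; rewrite Epr => -[Ea]; subst a'.
have c2 : 2 < cap p a.
  by case: fw => a' [ca E2]; move: Ew; rewrite E2; case: (cap p a') (ca) => [|[|[|c]]] //= _; case: (cap p a) => [|[|[|c']]].
have cp : cap p a = p by move: c2; case: (a) => -[|k] j.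
have dw : degW p w = (p - 1) * degL p a.
  by rewrite Ew cp /degW big_nseq iter_addn_0 mulnC subn1.
(* The two entries of a p-th power give only one block, hence the slack. *)
apply: (@rep_leq _ (1 + size X)); first by rewrite add1n.
rewrite addnA dw -{1}[degL p a]mul1n -mulnDl subnKC ?(ltnW p1) //.
by apply: rep_add; [apply: rep_power | apply: IH1; right].
Qed.

Lemma rep_critical t s x : x \in cobarBasis p t s -> critical p x -> rep t s.
Proof.
move=> hx cx; have [sx nx dx] := map_word_basis p_pr hx.
by have [/(_ (or_introl erefl)) + _] := rep_chain nx cx; rewrite dx sx.
Qed.

End CriticalDegrees.

Theorem theorem3p3 (p m n s r : nat) :
  prime p -> (5 <= p)%N -> (5 < m + 2)%N -> (m + 2 <= n)%N ->
  (2 <= s)%N -> (s < p)%N -> (2 <= r)%N -> (r <= s + 3)%N ->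
  ExtA_vanishes p (s + 3 - r) (tdeg p n m s + s - r - 1).
Proof.
move=> p_pr p5 m4 mn s2 sp r2 rs; apply: Ext_vanishing => // x hx.
apply/negP => /(rep_critical p_pr hx)[I [N [sI hN]]].
have m3 : 3 < m by lia.
have sI' : size I <= s + 1 by lia.
have := interval_sum_neq (prime_gt1 p_pr) m3 mn s2 sp sI'.
rewrite /tdeg; set V := \sum_(i <- I) _; set X := p ^ n + p ^ m + s * p + s => VX E.
have X0 : s <= X by rewrite /X leq_addl.
(* As 0 <= N <= s + 3 - r, the difference N - (s - r - 1) lies between 3 - s and 4, hence strictly
   between -2(p-1) and 2(p-1) by s < p and p >= 5. This forces V = X; [X0] keeps the subtractions in
   the degree from truncating. *)
case: (ltngtP V X) => // VX'; clear -VX' E p5 s2 sp r2 rs hN X0; clearbody V X; nia.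
Qed.
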